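(* Let $H\in(1/3,1/2)$, let $x_0\in\mathbb{R}$, and let $\sigma\in\mathcal{C}^\infty_b$ be bounded. Let $X$ be the solution of $$X_t=x_0+\int_0^t\sigma(X_s)\,d^\circ B_s,\qquad t\in[0,1],$$ and let $\widehat{X}^n$ be its Crank-Nicholson scheme with step size $1/n$. Then, for any $\alpha<3H-1/2$, $$n^\alpha\left[\widehat{X}^n_1-X_1\right]\ \longrightarrow\ 0\qquad\text{in probability, as }n\to\infty.$$
   Context: $B=(B_t)_{t\in[0,1]}$ is a fractional Brownian motion with Hurst parameter $H$: a continuous centered Gaussian process with covariance $R_H(s,t)=\frac12(s^{2H}+t^{2H}-|t-s|^{2H})$. $\mathcal{C}^\infty_b$ denotes the $\mathcal{C}^\infty$ functions $\mathbb{R}\to\mathbb{R}$ all of whose derivatives of order $\ge1$ are bounded; here $\sigma$ itself is bounded in addition. The (Russo-Vallois) symmetric integral $\int_0^tZ_s\,d^\circ B_s$ of a continuous process $Z$ is the limit, uniformly in $t\in[0,1]$ in probability, of $(2\varepsilon)^{-1}\int_0^t(Z_{s+\varepsilon}+Z_s)(B_{s+\varepsilon}-B_s)\,ds$ as $\varepsilon\to0$, when it exists (processes being extended continuously beyond time 1). The equation has a unique solution in the set of processes of the form $X_t=f(B_t)$ with $f\in\mathcal{C}^5(\mathbb{R})$, namely $X_t=\phi(x_0,B_t)$, where $\phi$ is defined by $\frac{\partial\phi}{\partial x_2}(x_1,x_2)=\sigma(\phi(x_1,x_2))$, $\phi(x_1,0)=x_1$; ''the solution'' means this process. Crank-Nicholson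 scheme: $\widehat{X}^n_0=x_0$ and, for $k\in\{0,\dots,n-1\}$, $$\widehat{X}^n_{(k+1)/n}=\widehat{X}^n_{k/n}+\tfrac12\left(\sigma(\widehat{X}^n_{k/n})+\sigma(\widehat{X}^n_{(k+1)/n})\right)(B_{(k+1)/n}-B_{k/n}).$$ The scheme is implicit; almost surely, for all $n$ sufficiently large, the maps $x\mapsto x-\frac12(B_{(k+1)/n}-B_{k/n})\sigma(x)$, $0\le k\le n-1$, are invertible, so that the scheme is well defined (its values when it is not are irrelevant for the limit). *)

(* Defs.v *)
From HB Require Import structures.
From mathcomp Require Import all_boot all_order all_algebra.
From mathcomp Require Import all_classical all_reals all_analysis.
Set Implicit Arguments.
Unset Strict Implicit.
Unset Printing Implicit Defensive.
Import Order.TTheory GRing.Theory Num.Theory.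
Import numFieldNormedType.Exports.
Local Open Scope classical_set_scope.
Local Open Scope ring_scope.

Definition class_C {R : realType} (k : nat) (f : R -> R) : Prop :=
  (forall (j : nat) (x : R), (j < k)%N -> derivable (derive1n j f) x 1) /\
  continuous (derive1n k f : R -> R).

Definition class_Cinf_b {R : realType} (f : R -> R) : Prop :=
  (forall k : nat, class_C k f) /\
  (forall k : nat, (0 < k)%N -> exists M : R, forall x : R, `|derive1n k f x| <= M).

(* Degenerate (constant) laws count as Gaussian; they are listed separately
   because [normal_prob m 0] is not the Dirac mass at [m]. *)
Definition gaussian {d : measure_display} {T : measurableType d}
    {R : realType} (P : probability T R) (Y : T -> R) : Prop :=
  (exists m : R, forall A : set R, measurable A ->
     pushforward P Y A = \d_m A) \/
  (exists m s : R, s != 0 /\ forall A : set R, measurable A ->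
     pushforward P Y A = normal_prob m s A).

Definition gaussian_process {d : measure_display} {T : measurableType d}
    {R : realType} (P : probability T R) (B : R -> {RV P >-> R}) : Prop :=
  forall (m : nat) (a t : 'I_m -> R),
    (forall i : 'I_m, t i \in `[0, 1]) ->
    gaussian P (fun w => \sum_(i < m) a i * B (t i) w).

Definition fbm_cov {R : realType} (H s t : R) : R :=
  2^-1 * (s `^ (2 * H) + t `^ (2 * H) - `|t - s| `^ (2 * H)).

(* The time set is [0, 1]: the variables [B t] for other [t] are
   unconstrained, and nothing below depends on them. *)
Definition fractional_brownian_motion {d : measure_display}
    {T : measurableType d} {R : realType} (P : probability T R)
    (H : R) (B : R -> {RV P >-> R}) : Prop :=
  [/\ gaussian_process B,
      forall t : R, t \in `[0, 1] -> ('E_P[B t] = 0)%E,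
      forall s t : R, s \in `[0, 1] -> t \in `[0, 1] ->
        covariance P (B s) (B t) = (fbm_cov H s t)%:E &
      forall w : T, {within `[0, 1], continuous (fun t : R => B t w)}].

(* [Num.min (s + e) 1] extends the processes beyond time 1 by their value at
   time 1; for continuous paths the limit as e -> 0+ does not depend on the
   choice of the continuous extension. *)
Definition symmetric_approx {T : Type} {R : realType} (Z B : R -> T -> R)
    (e t : R) (w : T) : R :=
  (2 * e)^-1 * \int[lebesgue_measure]_(s in `[0, t])
    ((Z (Num.min (s + e) 1) w + Z s w) * (B (Num.min (s + e) 1) w - B s w)).

(* J is the symmetric integral of Z with respect to B, as a process
   on [0, 1]. *)
Definition is_symmetric_integral {d : measure_display}
    {T : measurableType d} {R : realType} (P : probability T R)
    (Z B J : R -> T -> R) : Prop :=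
  forall eta : R, 0 < eta ->
    P [set w | exists2 t : R, t \in `[0, 1] &
         eta < `|symmetric_approx Z B e t w - J t w|] @[e --> 0^'+] --> 0%E.

(* The integral equation, in the class of processes f(B_t), f of class C^5,
   in which it has exactly one solution. *)
Definition sde_solution {d : measure_display} {T : measurableType d}
    {R : realType} (P : probability T R) (B : R -> {RV P >-> R})
    (sigma : R -> R) (x0 : R) (X : R -> T -> R) : Prop :=
  (exists2 f : R -> R, class_C 5 f &
     forall (t : R) (w : T), t \in `[0, 1] -> X t w = f (B t w)) /\
  is_symmetric_integral P (fun t w => sigma (X t w)) B
    (fun t w => X t w - x0).

Definition increment {T : Type} {R : realType} (B : R -> T -> R)
    (n k : nat) (w : T) : R :=
  B (k.+1%:R / n%:R) w - B (k%:R / n%:R) w.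

(* The scheme is implicit: its recursion is imposed at the outcomes where
   every step is uniquely solvable, and Y n is arbitrary (but measurable)
   elsewhere. *)
Definition crank_nicholson {T : Type} {R : realType} (B : R -> T -> R)
    (sigma : R -> R) (x0 : R) (Y : nat -> R -> T -> R) : Prop :=
  forall (n : nat) (w : T), (0 < n)%N ->
    (forall k : nat, (k < n)%N ->
       bijective (fun x : R => x - 2^-1 * increment B n k w * sigma x)) ->
    Y n 0 w = x0 /\
    forall k : nat, (k < n)%N ->
      Y n (k.+1%:R / n%:R) w = Y n (k%:R / n%:R) w +
        2^-1 * (sigma (Y n (k%:R / n%:R) w) + sigma (Y n (k.+1%:R / n%:R) w))
          * increment B n k w.

(* Main.v *)
Require Import Defs.
From HB Require Import structures.
From mathcomp Require Import all_boot all_order all_algebra.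
From mathcomp Require Import all_classical all_reals all_analysis.
From mathcomp Require Import measurable_realfun.
From mathcomp Require Import zify ring lra.
Set Implicit Arguments.
Unset Strict Implicit.
Unset Printing Implicit Defensive.
Import Order.TTheory GRing.Theory Num.Theory.
Import numFieldNormedType.Exports.
Local Open Scope classical_set_scope.
Local Open Scope ring_scope.

(** The solution is f(B_t), where f is the solution of f' = sigma(f) with
    f(0) = x0 ([solution_flow]).  The scheme stays in the range of f: if its
    current value is f(y) and the next increment is u, the implicit equation is
    solved by f(y + v) with
      v = u + (g(y) + g(y + v)) / 2 * u^3 + O(|u|^5)
    for a smooth bounded g ([step_exists], [step_expansion]).  The scheme is
    thus f along a sequence Y_k that follows the grid values b_k = B_{k/n} up to
    the cubic drift.  As g is Lipschitz, a discrete Gronwall argument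
    ([gronwall], [scheme_error]) bounds the final error, as soon as
    sum |u_j|^3 is small, by a constant times
      |S_n| + sum |u_j|^5 + sum (|S_j| + |S_{j+1}|) |u_j|^3,
    where S_k = sum_{j < k} (g(b_j) + g(b_{j+1})) / 2 * u_j^3.

    With H > 1/3 the mean of sum |u_j|^3 is of order n^(1-3H), which tends
    to 0, and the rate comes from the cancellations in S_k: the point is
    E S_k^2 <= C n^(1-6H+delta) for every delta > 0, uniformly in k <= n
    ([cubic_sum_le]).  Write u^3 = He_3(u) + 3 n^(-2H) u, where He_3 is the
    third Hermite polynomial for the variance n^(-2H) of the increments.
    - The linear part is a trapezoidal sum for an antiderivative of g, hence
      bounded in mean square ([linear_sum_le]).
    - For the Hermite part ([weighted_hermite_le]), the grid is cut into blocks
      of about n^(1-delta) steps, and g is expanded at the left end of each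
      block, so far that the remainder is negligible.  The coefficients are
      bounded and constant on a block, so they can be dropped at the cost of a
      factor n^delta, the number of blocks.  There remain the moments
      E[He_3(u_i) He_3(u_j) X^p Z^p] of Gaussian variables, where X and Z are
      increments inside the block.  Gaussian integration by parts
      ([hmoment_rec]) bounds them by n^(-12H) + |cov(u_i, u_j)| n^(-4H)
      ([hmoment_le]).  For H < 1/2 distinct increments are negatively
      correlated, so that sum_j |cov(u_i, u_j)| <= 3 n^(-2H)
      ([sum_cov_grid_incr_le]).

    The identification of f uses the trapezoidal rule once more: if G' =
    sigma(f), the symmetric approximation of the integral up to time 1 is, up
    to O(e^-1 int |B_{s+e} - B_s|^3 ds), the mean increment
    e^-1 int (G(B_{s+e}) - G(B_s)) ds, which tends to G(B_1) - G(B_0)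
    ([symmetric_path]).  The error has mean O(e^(3H-1)).  As the law of B_1 has
    full support, f(y) - x0 = G(y) - G(0) for every y. *)

(** * Taylor and trapezoidal estimates *)

Section Calculus.
Context {R : realType}.
Implicit Types (f g : R -> R) (a b x : R).

Lemma is_derive1_continuous f df :
  (forall x, is_derive x 1 f (df x)) -> continuous f.
Proof.
move=> fd x; apply: differentiable_continuous; apply/derivable1_diffP.
exact: (@ex_derive _ _ _ _ _ _ _ (fd x)).
Qed.

Lemma mean_value_le f df a b (C : R) :
  (forall x, is_derive x 1 f (df x)) ->
  (forall x, `|x - a| <= `|b - a| -> `|df x| <= C) ->
  `|f b - f a| <= C * `|b - a|.
Proof.
move=> fd dfC; have fc := is_derive1_continuous fd.
have [ab|ba] := leP a b.
  have [c cab ->] := @MVT_segment R f df a b ab (fun x _ => fd x)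
    (continuous_subspaceT fc).
  rewrite normrM ler_wpM2r//; apply: dfC.
  move: cab; rewrite in_itv/= => /andP[ac cb].
  by rewrite !ger0_norm ?subr_ge0// lerD2r.
have [c cab] := @MVT_segment R f df b a (ltW ba) (fun x _ => fd x)
    (continuous_subspaceT fc).
rewrite -normrN opprB => ->; rewrite normrM -(normrN (a - b)) opprB ler_wpM2r//.
apply: dfC; move: cab; rewrite in_itv/= => /andP[bc ca].
rewrite -(normrN (c - a)) -(normrN (b - a)) !opprB.
by rewrite !ger0_norm ?subr_ge0 ?lerD2l ?lerN2// ltW.
Qed.

Lemma taylor_le (q : nat) : forall (G : nat -> R -> R) a b (C : R),
  (forall k, (k < q)%N -> forall x, is_derive x 1 (G k) (G k.+1 x)) ->
  (forall x, `|x - a| <= `|b - a| -> `|G q x| <= C) ->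
  `|G 0%N b - \sum_(k < q) G k a * (b - a) ^+ k / k`!%:R| <= C * `|b - a| ^+ q.
Proof.
elim: q => [|q IH] G a b C Gd GC.
  by rewrite big_ord0 subr0 expr0 mulr1; apply: GC.
pose T x := \sum_(k < q) G k.+1 a * (x - a) ^+ k / k`!%:R.
pose h x := G 0%N x - \sum_(k < q.+1) G k a * (x - a) ^+ k / k`!%:R.
have hd x : is_derive x 1 h (G 1%N x - T x).
  apply: is_deriveB; first exact: Gd.
  have -> : (fun y => \sum_(k < q.+1) G k a * (y - a) ^+ k / k`!%:R) =
    \sum_(k < q.+1) (fun y => G k a * (y - a) ^+ k / k`!%:R).
    by apply/funext => y; rewrite fct_sumE.
  have -> : T x = \sum_(k < q.+1) (G k a * (k%:R * (x - a) ^+ k.-1) / k`!%:R).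
    rewrite big_ord_recl/= mul0r mulr0 mul0r add0r; apply: eq_bigr => k _.
    rewrite /bump/= add1n factS natrM.
    have k0 : (k`!%:R : R) != 0 by rewrite pnatr_eq0 -lt0n fact_gt0.
    have k1 : (k.+1%:R : R) != 0 by rewrite pnatr_eq0.
    by move: (k.+1%:R : R) (k`!%:R : R) k0 k1 => c1 c0 k0 k1; field; rewrite k0 k1.
  apply: is_derive_sum => k.
  have -> : (fun y : R => G k a * (y - a) ^+ k / k`!%:R) =
      (G k a / k`!%:R) \*: ((id - cst a : R -> R) ^+ k).
    by apply/funext => y; rewrite /= fctE mulrAC.
  apply: is_derive_eq.
  by rewrite subr0 /GRing.scale/= mulr1 mulrAC.
have h0 : h a = 0.
  rewrite /h big_ord_recl/= expr0 fact0 divr1 mulr1 big1 ?addr0 ?subrr// => k _.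
  by rewrite ?subrr expr0n mulr0 mul0r.
rewrite exprSr mulrA.
have := @mean_value_le h _ a b (C * `|b - a| ^+ q) hd.
rewrite h0 subr0; apply => x xab.
have C0 : 0 <= C by apply: le_trans (GC a _) => //; rewrite subrr normr0.
apply: le_trans (IH (fun k => G k.+1) a x C _ _) _.
- by move=> k kq; apply: Gd.
- by move=> y ya; apply: GC; apply: le_trans xab.
by rewrite ler_wpM2l// lerXn2r// nnegrE.
Qed.

(** Two Taylor expansions at [a], one of [G] and one of [g], combined so that
    the second order terms cancel. *)
Lemma trapezoid_le (G g g1 g2 : R -> R) a b (C : R) :
  (forall x, is_derive x 1 G (g x)) ->
  (forall x, is_derive x 1 g (g1 x)) ->
  (forall x, is_derive x 1 g1 (g2 x)) ->
  (forall x, `|x - a| <= `|b - a| -> `|g2 x| <= C) ->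
  `|G b - G a - 2^-1 * (g a + g b) * (b - a)| <= 2 * C * `|b - a| ^+ 3.
Proof.
move=> dG dg dg1 g2C.
have := @taylor_le 3 (fun k => nth G [:: G; g; g1; g2] k) a b C.
have := @taylor_le 2 (fun k => nth g [:: g; g1; g2] k) a b C.
rewrite !big_ord_recr !big_ord0/= !(expr0, fact0, factS, mulr1, divr1, add0r, muln1, expr1).
set u := b - a => H1 H2.
have {}H1 : `|g b - (g a + g1 a * u)| <= C * `|u| ^+ 2.
  by apply: H1 => // -[|[|[]]].
have {}H2 : `|G b - (G a + g a * u + g1 a * u ^+ 2 / 2)| <= C * `|u| ^+ 3.
  by apply: H2 => // -[|[|[]]].
have -> : G b - G a - 2^-1 * (g a + g b) * u =
  (G b - (G a + g a * u + g1 a * u ^+ 2 / 2)) -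
   2^-1 * u * (g b - (g a + g1 a * u)) by field.
apply: le_trans (ler_normB _ _) _.
rewrite !normrM (ger0_norm (_ : 0 <= 2^-1)) ?invr_ge0//.
have C0 : 0 <= C by apply: le_trans (g2C a _) => //; rewrite subrr normr0.
have : 2^-1 * `|u| * `|g b - (g a + g1 a * u)| <= 2^-1 * `|u| * (C * `|u| ^+ 2).
  by rewrite ler_wpM2l// mulr_ge0// invr_ge0.
have : 0 <= C * `|u| ^+ 3 by rewrite mulr_ge0// exprn_ge0.
have -> : 2^-1 * `|u| * (C * `|u| ^+ 2) = 2^-1 * (C * `|u| ^+ 3) by field.
lra.
Qed.

End Calculus.

(** * Functions with bounded derivatives *)

Section BoundedDerivatives.
Context {R : realType}.
Implicit Types (f g h : R -> R) (a b x : R).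

(** The integral over a segment gives an antiderivative near a point of the
    interior only, so the lower bound of the integral depends on the point:
    the integrals from [- N], normalized at 0, agree for different [N] at the
    points that both reach. *)
Lemma antiderivative_exists h : continuous h ->
  exists G : R -> R, forall x, is_derive x 1 G (h x).
Proof.
move=> hc.
have hi (a b : R) : lebesgue_measure.-integrable `[a, b] (EFin \o h).
  apply: continuous_compact_integrable; first exact: segment_compact.
  exact: continuous_subspaceT.
pose I (a b : R) := (\int[lebesgue_measure]_(t in `[a, b]) h t)%R.
pose A (N x : R) := I (- N) x - I (- N) 0.
have AA (N M x : R) : 0 <= M -> M <= N -> `|x| <= M -> A N x = A M x.
  move=> M0 MN xM; rewrite /A.
  have E y : - M <= y -> I (- N) y = I (- N) (- M) + I (- M) y.
    move=> My.
    have := @Rintegral_itvB R h (BLeft (- N)) (BRight y) (- M) (hi _ _).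
    rewrite Rintegral_itv_obnd_cbnd; last first.
      apply: integrableS (hi (- M) y) => //.
      by apply: subset_itvr; rewrite bnd_simp.
    by rewrite !bnd_simp lerN2 => /(_ MN My); rewrite /I => <-; rewrite addrC subrK.
  rewrite (E x) ?(E 0) ?oppr_le0//; last by move: xM; rewrite ler_norml => /andP[].
  by ring.
pose G x := A (`|x| + 1) x.
exists G => x.
pose N := `|x| + 2.
have Ad : is_derive x 1 (A N) (h x).
  have [||||d e] := @continuous_FTC1_closed R h (- N) x (x + 1).
  - by rewrite ltrDl.
  - exact: hi.
  - by rewrite ltrNl /N; have := ler_norm (- x); rewrite normrN; lra.
  - exact: hc.
  rewrite /A -[h x]subr0.
  apply: is_deriveB; rewrite -e.
  by apply: DeriveDef; [exact: d|rewrite -derive1E].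
apply: near_eq_is_derive Ad.
near=> y.
have yx : `|x - y| < 1 by near: y; apply: (@cvgr_dist_lt _ R^o).
have := ler_normB y (y - x); rewrite opprB addrCA subrr addr0.
have := ler_normB x (x - y); rewrite opprB addrCA subrr addr0 => h1.
rewrite (distrC y x) => h2.
rewrite /G; apply: AA; rewrite /N ?addr_ge0//; last by rewrite lerDl.
by move: h1 h2 yx; lra.
Unshelve. all: end_near.
Qed.

Fixpoint bounded_derivs (k : nat) (h : R -> R) : Prop :=
  (exists C, forall x, `|h x| <= C) /\
  if k is k'.+1 then
    exists2 h', (forall x, is_derive x 1 h (h' x)) & bounded_derivs k' h'
  else True.

Lemma bounded_derivsW k h : bounded_derivs k.+1 h -> bounded_derivs k h.
Proof.
elim: k h => [|k IH] h; first by case.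
by move=> [hb [h' hd /IH h'k]]; split => //; exists h'.
Qed.

Lemma bounded_derivsD k f g :
  bounded_derivs k f -> bounded_derivs k g -> bounded_derivs k (fun x => f x + g x).
Proof.
elim: k f g => [|k IH] f g.
  move=> [[C fC] _] [[D gD] _]; split => //; exists (C + D) => x.
  by apply: le_trans (ler_normD _ _) _; rewrite lerD.
move=> [[C fC] [f' fd fk]] [[D gD] [g' gd gk]]; split.
  by exists (C + D) => x; apply: le_trans (ler_normD _ _) _; rewrite lerD.
exists (fun x => f' x + g' x); last exact: IH.
by move=> x; apply: is_deriveD.
Qed.

Lemma bounded_derivsM k f g :
  bounded_derivs k f -> bounded_derivs k g -> bounded_derivs k (fun x => f x * g x).
Proof.
have bM (u v : R -> R) : (exists C, forall x, `|u x| <= C) ->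
    (exists C, forall x, `|v x| <= C) -> exists C, forall x, `|u x * v x| <= C.
  by move=> [C uC] [D vD]; exists (C * D) => x; rewrite normrM ler_pM.
elim: k f g => [|k IH] f g.
  by move=> [fb _] [gb _]; split => //; exact: bM.
move=> fk1 gk1; have [fb [f' fd fk]] := fk1; have [gb [g' gd gk]] := gk1.
split; first exact: bM.
exists (fun x => f x * g' x + g x * f' x).
  by move=> x; apply: is_deriveM.
by apply: bounded_derivsD; apply: IH => //; exact: bounded_derivsW.
Qed.

Lemma bounded_derivs_cst k (c : R) : bounded_derivs k (fun=> c).
Proof.
elim: k c => [|k IH] c; first by split => //; exists `|c|.
split; first by exists `|c|.
by exists (fun=> 0) => // x; exact: is_derive_cst.
Qed.

Lemma is_derive1_comp_eq f g (df dg x : R) : is_derive (f x) 1 g dg ->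
  is_derive x 1 f df -> is_derive x 1 (g \o f) (dg * df).
Proof.
move=> gd fd; have gD := @ex_derive _ _ _ _ _ _ _ gd; have fD := @ex_derive _ _ _ _ _ _ _ fd.
apply: DeriveDef.
  apply/derivable1_diffP; apply: differentiable_comp; exact/derivable1_diffP.
rewrite -derive1E (derive1_comp fD gD) !derive1E.
by rewrite (@derive_val _ _ _ _ _ _ _ gd) (@derive_val _ _ _ _ _ _ _ fd).
Qed.

(** [f] itself may be unbounded: what makes the induction work is that the
    derivative of [h \o f] is again a bounded function of [f]. *)
Lemma bounded_derivs_comp k s f h :
  (forall x, is_derive x 1 f (s (f x))) ->
  bounded_derivs k s -> bounded_derivs k h -> bounded_derivs k (h \o f).
Proof.
move=> fd; elim: k h => [|k IH] h.
  by move=> _ [[C hC] _]; split => //; exists C => x; exact: hC.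
move=> sk1 [[C hC] [h' hd hk]]; split; first by exists C => x; exact: hC.
exists ((fun y => h' y * s y) \o f).
  by move=> x; exact: is_derive1_comp_eq.
apply: IH; first exact: bounded_derivsW.
by apply: bounded_derivsM => //; exact: bounded_derivsW.
Qed.

Definition smooth_bounded h := forall k, bounded_derivs k h.

Lemma smooth_bounded_derive h : smooth_bounded h ->
  (forall x, is_derive x 1 h (derive1 h x)) /\ smooth_bounded (derive1 h).
Proof.
move=> hs.
have [_ [h' hd _]] := hs 1%N.
have E : derive1 h = h'.
  by apply/funext => x; rewrite derive1E; exact: derive_val.
split; first by rewrite E.
move=> k; have [_ [h2 hd2 hk]] := hs k.+1.
suff -> : derive1 h = h2 by [].
by apply/funext => x; rewrite derive1E; exact: derive_val.
Qed.

Lemma smooth_bounded_derivs h : smooth_bounded h ->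
  exists G : nat -> R -> R, [/\ G 0%N = h,
    forall k x, is_derive x 1 (G k) (G k.+1 x) &
    forall k, smooth_bounded (G k)].
Proof.
move=> hs; exists (fun k => derive1n k h).
have S k : smooth_bounded (derive1n k h).
  by elim: k => [//|k IH]; rewrite derive1nS; exact: (smooth_bounded_derive IH).2.
by split; [|move=> k x; exact: (smooth_bounded_derive (S k)).1|exact: S].
Qed.

Lemma smooth_bounded_bound h : smooth_bounded h ->
  exists2 C, 0 <= C & forall x, `|h x| <= C.
Proof.
by case/(_ 0%N) => -[C hC] _; exists C => //; apply: le_trans (hC 0).
Qed.

Lemma class_Cinf_b_smooth (sigma : R -> R) : class_Cinf_b sigma ->
  (exists M : R, forall x : R, `|sigma x| <= M) -> smooth_bounded sigma.
Proof.
move=> [sC sb] s0 k.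
have sbj j : exists M, forall x, `|derive1n j sigma x| <= M.
  by case: j => [|j]; [exact: s0|exact: sb].
rewrite -[sigma]/(derive1n 0 sigma); elim: k 0%N => [|k IH] j; first by split.
split; first exact: sbj.
exists (derive1n j.+1 sigma); last exact: IH.
move=> x; have [/(_ j x (ltnSn j)) d _] := sC j.+1.
by apply: DeriveDef; [exact: d|rewrite -derive1E].
Qed.

End BoundedDerivatives.

(** * Random variables with moments of all orders *)

Section Moments.
Context d (T : measurableType d) {R : realType} (P : probability T R).
Implicit Types (f g : T -> R).

(** An algebra of random variables on which the expectation is a linear real
    functional: it contains Gaussian variables and bounded variables, so that
    no integrability question arises for the polynomial expressions below. *)
Definition all_moments f := measurable_fun setT f /\
  forall N, P.-integrable setT (EFin \o (fun w => `|f w| ^+ N)).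

Definition Ex f : R := (\int[P]_w f w)%R.

Lemma integrable_le f g : measurable_fun setT f ->
  (forall w, `|f w| <= g w) -> P.-integrable setT (EFin \o g) ->
  P.-integrable setT (EFin \o f).
Proof.
move=> mf fg; apply: le_integrable => //; first exact/measurable_EFinP.
by move=> w _ /=; rewrite lee_fin (le_trans (fg w))// ler_norm.
Qed.

Lemma all_moments_measurable f : all_moments f -> measurable_fun setT f.
Proof. by case. Qed.

Lemma all_moments_integrable f : all_moments f -> P.-integrable setT (EFin \o f).
Proof.
by move=> [mf /(_ 1%N) i]; apply: integrable_le i => // w; rewrite expr1.
Qed.

Lemma measurable_normX f N : measurable_fun setT f ->
  measurable_fun setT (fun w => `|f w| ^+ N).
Proof. by move=> mf; apply: measurable_funX; exact: measurableT_comp. Qed.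

Lemma all_moments_bounded f C : measurable_fun setT f ->
  (forall w, `|f w| <= C) -> all_moments f.
Proof.
move=> mf fC; split => // N; apply: (@integrable_le _ (cst (C ^+ N))).
- exact: measurable_normX.
- by move=> w /=; rewrite ger0_norm ?exprn_ge0// lerXn2r// nnegrE// (le_trans _ (fC w)).
- exact: finite_measure_integrable_cst.
Qed.

Lemma all_moments_cst c : all_moments (cst c).
Proof. by apply: (@all_moments_bounded _ `|c|). Qed.

Lemma all_momentsD f g : all_moments f -> all_moments g ->
  all_moments (fun w => f w + g w).
Proof.
move=> [mf fi] [mg gi]; split; first exact: measurable_funD.
move=> N; apply: (@integrable_le _ (fun w => 2 ^+ N * (`|f w| ^+ N + `|g w| ^+ N))).
- by apply: measurable_normX; exact: measurable_funD.
- move=> w; rewrite ger0_norm ?exprn_ge0//.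
  wlog fg : f g mf mg fi gi / `|f w| <= `|g w|.
    move=> W; have [/W|/ltW/W] := leP `|f w| `|g w|; first exact.
    by rewrite addrC [X in _ * X]addrC; exact.
  apply: (@le_trans _ _ (2 ^+ N * `|g w| ^+ N)).
    rewrite -exprMn lerXn2r ?nnegrE ?mulr_ge0//.
    by apply: le_trans (ler_normD _ _) _; lra.
  by rewrite ler_wpM2l ?exprn_ge0// lerDr exprn_ge0.
exact: (integrableZl measurableT (2 ^+ N) (integrableD measurableT (fi N) (gi N))).
Qed.

Lemma all_momentsM f g : all_moments f -> all_moments g ->
  all_moments (fun w => f w * g w).
Proof.
move=> [mf fi] [mg gi]; split; first exact: measurable_funM.
move=> N; apply: (@integrable_le _ (fun w => `|f w| ^+ N.*2 + `|g w| ^+ N.*2)).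
- by apply: measurable_normX; exact: measurable_funM.
- move=> w; rewrite ger0_norm ?exprn_ge0// normrM exprMn -!mul2n !(mulnC 2%N) !exprM.
  move: (`|f w| ^+ N) (`|g w| ^+ N) => a b.
  have : 0 <= (a - b) ^+ 2 by rewrite sqr_ge0.
  have : 0 <= a ^+ 2 by rewrite sqr_ge0.
  have : 0 <= b ^+ 2 by rewrite sqr_ge0.
  lra.
exact: (integrableD measurableT (fi N.*2) (gi N.*2)).
Qed.

Lemma all_momentsZ c f : all_moments f -> all_moments (fun w => c * f w).
Proof. by move=> fm; apply: all_momentsM fm; exact: all_moments_cst. Qed.

Lemma all_momentsN f : all_moments f -> all_moments (fun w => - f w).
Proof.
by move=> /(all_momentsZ (-1)); under eq_fun do rewrite mulN1r.
Qed.

Lemma all_momentsB f g : all_moments f -> all_moments g ->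
  all_moments (fun w => f w - g w).
Proof. by move=> fm /all_momentsN; exact: all_momentsD. Qed.

Lemma all_momentsX f N : all_moments f -> all_moments (fun w => f w ^+ N).
Proof.
move=> fm; elim: N => [|N IH]; first exact: (all_moments_cst 1).
rewrite (_ : (fun w => _) = fun w => f w * f w ^+ N); first exact: all_momentsM.
by apply/funext => w; rewrite exprS.
Qed.

Lemma all_moments_norm f : all_moments f -> all_moments (fun w => `|f w|).
Proof.
move=> [mf fi]; split; first exact: measurableT_comp.
move=> N; rewrite (_ : (fun w => _) = (fun w => `|f w| ^+ N)); first exact: fi.
by apply/funext => w; rewrite normr_id.
Qed.

Lemma all_moments_sum I (r : seq I) (p : pred I) (F : I -> T -> R) :
  (forall i, p i -> all_moments (F i)) ->
  all_moments (fun w => \sum_(i <- r | p i) F i w).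
Proof.
move=> Fm; elim: r => [|i r IH].
  rewrite (_ : (fun w => _) = cst 0); first exact: all_moments_cst.
  by apply/funext => w; rewrite big_nil.
rewrite (_ : (fun w => _) = (fun w => (if p i then F i w else 0) +
  \sum_(j <- r | p j) F j w)).
  by apply: all_momentsD => //; case: (p i) (@Fm i) => [H|_]; [exact: H|exact: all_moments_cst].
by apply/funext => w; rewrite big_cons; case: ifP => // _; rewrite add0r.
Qed.

Lemma ExD f g : all_moments f -> all_moments g ->
  Ex (fun w => f w + g w) = Ex f + Ex g.
Proof. by move=> fm gm; rewrite /Ex RintegralD//; exact: all_moments_integrable. Qed.

Lemma ExZ c f : all_moments f -> Ex (fun w => c * f w) = c * Ex f.
Proof. by move=> fm; rewrite /Ex RintegralZl//; exact: all_moments_integrable. Qed.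

Lemma ExN f : all_moments f -> Ex (fun w => - f w) = - Ex f.
Proof.
move=> fm; rewrite -mulN1r -ExZ//; congr Ex; apply/funext => w.
by rewrite mulN1r.
Qed.

Lemma ExB f g : all_moments f -> all_moments g ->
  Ex (fun w => f w - g w) = Ex f - Ex g.
Proof.
by move=> fm gm; rewrite (ExD fm (all_momentsN gm)) ExN.
Qed.

Lemma Ex_cst c : Ex (fun=> c) = c.
Proof.
have e : fine (P setT) = 1 by rewrite probability_setT.
by rewrite /Ex Rintegral_cst// -[RHS]mulr1; congr (_ * _); exact: e.
Qed.

Lemma Ex_sum I (r : seq I) (p : pred I) (F : I -> T -> R) :
  (forall i, p i -> all_moments (F i)) ->
  Ex (fun w => \sum_(i <- r | p i) F i w) = \sum_(i <- r | p i) Ex (F i).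
Proof.
move=> Fm; elim: r => [|i r IH].
  rewrite (_ : (fun w => _) = cst 0) ?Ex_cst ?big_nil//.
  by apply/funext => w; rewrite big_nil.
rewrite (_ : (fun w => _) = (fun w => (if p i then F i w else 0) +
  \sum_(j <- r | p j) F j w)); last first.
  by apply/funext => w; rewrite big_cons; case: ifP => // _; rewrite add0r.
rewrite ExD ?IH; last 2 first.
- by case: (p i) (@Fm i) => [H|_]; [exact: H|exact: all_moments_cst].
- exact: all_moments_sum.
by rewrite big_cons; case: (p i) => //; rewrite Ex_cst add0r.
Qed.

Lemma Ex_le f g : all_moments f -> all_moments g ->
  (forall w, f w <= g w) -> Ex f <= Ex g.
Proof.
by move=> fm gm fg; apply: le_Rintegral => //; exact: all_moments_integrable.
Qed.

Lemma Ex_ge0 f : (forall w, 0 <= f w) -> 0 <= Ex f.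
Proof. by move=> f0; apply: Rintegral_ge0. Qed.

Lemma Ex_norm f : all_moments f -> `|Ex f| <= Ex (fun w => `|f w|).
Proof.
by move=> fm; apply: le_normr_Rintegral => //; exact: all_moments_integrable.
Qed.

Lemma integral_Ex f : all_moments f -> (\int[P]_w (f w)%:E = (Ex f)%:E)%E.
Proof.
move=> fm; rewrite /Ex /Rintegral fineK//; apply: integrable_fin_num => //.
exact: all_moments_integrable.
Qed.

Lemma measurable_lt (f : T -> R) (c : R) : measurable_fun setT f ->
  measurable [set w | c < f w].
Proof.
move=> mf; rewrite -(setTI [set w | _]).
by have := measurable_fun_ltr (measurable_cst c) mf measurableT (Y := [set true]); apply.
Qed.

Lemma markov_integral (f : T -> R) (c : R) : measurable_fun setT f ->
  (forall w, 0 <= f w) -> 0 < c ->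
  (P [set w | (c < f w)%R] <= (c^-1)%:E * \int[P]_w (f w)%:E)%E.
Proof.
move=> mf f0 c0.
have mA := measurable_lt c mf.
rewrite lee_pdivlMl//.
have mI : measurable_fun setT (EFin \o \1_[set w | (c < f w)%R] : T -> \bar R).
  by apply/measurable_EFinP; exact: measurable_indic.
rewrite -(setIT [set w | (c < f w)%R]) -integral_indic//.
rewrite -(@ge0_integralZl _ _ _ P setT measurableT (EFin \o \1_[set w | (c < f w)%R]))//;
  [|by move=> w _; rewrite lee_fin|by rewrite lee_fin ltW].
apply: ge0_le_integral => //.
- by move=> w _; rewrite -EFinM lee_fin mulr_ge0// ltW.
- by apply: measurable_funeM.
- exact/measurable_EFinP.
move=> w _; rewrite -EFinM lee_fin indicE; case: (boolP (w \in _)) => [|_].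
  by rewrite inE/= mulr1 => /ltW.
by rewrite mulr0.
Qed.

Lemma markov_le f (c : R) : all_moments f -> (forall w, 0 <= f w) -> 0 < c ->
  (P [set w | (c < f w)%R] <= (Ex f / c)%:E)%E.
Proof.
move=> fm f0 c0; apply: le_trans (markov_integral (all_moments_measurable fm) f0 c0) _.
by rewrite integral_Ex// -EFinM mulrC.
Qed.

End Moments.

(** * Moments and support of Gaussian laws *)

Section NormalMoments.
Context {R : realType}.
Local Notation mu := (@lebesgue_measure R).

(** The bound on [(x - m) * F x] makes the boundary terms of the fundamental
    theorem of calculus vanish as the interval grows. *)
Lemma integral_derivative_eq0 (F f : R -> R) (m C : R) :
  (forall x : R, is_derive x 1 F (f x)) -> continuous f ->
  mu.-integrable setT (EFin \o f) ->
  (forall x, `|(x - m) * F x| <= C) -> (\int[mu]_x (f x)%:E = 0)%E.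
Proof.
move=> Fd fc fi FC.
pose D (n : nat) := `[m - n.+1%:R, m + n.+1%:R]%classic.
have mf : measurable_fun setT f by exact: continuous_measurable_fun.
have Fc := is_derive1_continuous Fd.
have E n : (\int[mu]_(x in D n) (f x)%:E = (F (m + n.+1%:R) - F (m - n.+1%:R))%:E)%E.
  rewrite EFinB; apply: continuous_FTC2.
  - by rewrite ltrD2l gtrN// ltr0n.
  - exact: continuous_subspaceT.
  - split; [by move=> x _; exact: (@ex_derive _ _ _ _ _ _ _ (Fd x))|exact: cvg_at_right_filter (Fc _)|exact: cvg_at_left_filter (Fc _)].
  - by move=> x _; rewrite derive1E; exact: derive_val.
have L1 : (\int[mu]_(x in D n) (f x)%:E @[n --> \oo] --> 0%:E)%E.
  rewrite (_ : (fun n => _) = fun n => (F (m + n.+1%:R) - F (m - n.+1%:R))%:E); last first.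
    by apply/funext => n; rewrite E.
  apply: cvg_EFin; first by near=> n.
  have C0 : 0 <= C by apply: le_trans (FC 0).
  apply/(@cvgr0Pnorm_le _ R^o) => e e0; near=> n => /=.
  have n0 : 0 < n.+1%:R :> R by rewrite ltr0n.
  have b (x : R) : `|x - m| = n.+1%:R -> `|F x| <= C / n.+1%:R.
    by move=> xm; rewrite ler_pdivlMr// mulrC -xm -normrM.
  apply: le_trans (ler_normB _ _) _.
  apply: (@le_trans _ _ (C / n.+1%:R + C / n.+1%:R)).
    apply: lerD; apply: b; first by rewrite addrC addKr gtr0_norm.
    by rewrite addrC addKr normrN gtr0_norm.
  rewrite -mulrDl ler_pdivrMr// -ler_pdivrMl// -natr1.
  rewrite ler_wpDr//; near: n; exact: nbhs_infty_ger.
have L2 : (\int[mu]_(x in D n) (f x)%:E @[n --> \oo] --> \int[mu]_x (f x)%:E)%E.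
  rewrite (_ : (fun n => _) = fun n => (\int[mu]_x ((EFin \o f) \_ (D n)) x)%E); last first.
    by apply/funext => n; rewrite integral_mkcond.
  have [] := @dominated_convergence _ _ _ mu setT measurableT
    (fun n => (EFin \o f) \_ (D n)) (EFin \o f) (abse \o (EFin \o f)).
  - move=> n; apply/(measurable_restrictT _ _).1 => //; first exact: measurable_itv.
    by apply/measurable_EFinP; apply: measurable_funTS.
  - exact/measurable_EFinP.
  - apply: aeW => x _.
    apply: cvg_near_cst; near=> n.
    rewrite patchE ifT// inE /D/= in_itv/=.
    have : `|x - m| <= n.+1%:R.
      by rewrite -natr1 ler_wpDr//; near: n; exact: nbhs_infty_ger.
    by rewrite ler_norml => /andP[]; lra.
  - exact: integrable_abse.
  - apply: aeW => x n _; rewrite patchE; case: ifP => // _.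
    by rewrite /point abse0/= lee_fin.
  by move=> _ _; exact.
exact: (cvg_unique _ L2 L1).
Unshelve. all: end_near.
Qed.

Lemma exprn_le_expR (t : R) (N : nat) : 0 <= t -> t ^+ N.+1 <= N.+1`!%:R * expR t.
Proof.
move=> t0; rewrite mulrC -ler_pdivrMr ?ltr0n ?fact_gt0//.
by apply: le_trans (expR_ge1Dxn N t0); rewrite lerDr.
Qed.

(** Doubling the variance leaves a factor exp(- z^2 / (4 s^2)) to absorb the
    polynomial; this reduces integrability and decay of moments to the
    corresponding properties of a normal density. *)
Lemma normal_tail_le (s : R) (N : nat) : s != 0 -> exists2 C, 0 <= C &
  forall m x, `|x - m| ^+ N * normal_pdf m s x <= C * normal_pdf m (Num.sqrt 2 * s) x.
Proof.
move=> s0; have s20 : 0 < s ^+ 2 by rewrite exprn_even_gt0.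
have r0 : Num.sqrt 2 * s != 0 by rewrite mulf_neq0// gt_eqF// sqrtr_gt0.
(* |z|^N <= 1 + (z^2)^(N+1), and z^2 = 4 s^2 t with t^(N+1) <= (N+1)! exp t. *)
pose K := 1 + (4 * s ^+ 2) ^+ N.+1 * N.+1`!%:R.
have K0 : 0 <= K.
  by rewrite addr_ge0// mulr_ge0// exprn_ge0// mulr_ge0// ltW.
have p0 := normal_peak_gt0 r0.
exists (normal_peak s * K / normal_peak (Num.sqrt 2 * s)).
  by rewrite divr_ge0 ?mulr_ge0 ?normal_peak_ge0.
move=> m x; rewrite !normal_pdfE//= !mulrA mulfVK ?gt_eqF//.
rewrite -!mulrA mulrCA ler_wpM2l ?normal_peak_ge0//.
rewrite /normal_fun; set z := x - m.
have e1 : (Num.sqrt 2 * s) ^+ 2 *+ 2 = 4 * s ^+ 2.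
  by rewrite exprMn sqr_sqrtr// -mulr_natr; ring.
rewrite e1; pose t := z ^+ 2 / (4 * s ^+ 2).
have t0 : 0 <= t by rewrite divr_ge0 ?sqr_ge0// mulr_ge0// ltW.
have -> : - z ^+ 2 / (4 * s ^+ 2) = t + (- z ^+ 2 / (s ^+ 2 *+ 2)).
  by rewrite /t -mulr_natr; field; rewrite s0.
rewrite expRD mulrA ler_wpM2r ?expR_ge0//.
have zt : z ^+ 2 = 4 * s ^+ 2 * t by rewrite /t mulrC mulfVK// mulf_neq0// ?gt_eqF.
have tN : (z ^+ 2) ^+ N.+1 <= (4 * s ^+ 2) ^+ N.+1 * N.+1`!%:R * expR t.
  rewrite zt exprMn -[leRHS]mulrA; apply: ler_wpM2l; last exact: exprn_le_expR.
  by apply: exprn_ge0; rewrite mulr_ge0// ltW.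
apply: (@le_trans _ _ (1 + (z ^+ 2) ^+ N.+1)).
  have zz : 0 <= (z ^+ 2) ^+ N.+1 by apply: exprn_ge0; exact: sqr_ge0.
  have [z1|/ltW z1] := leP `|z| 1.
    apply: (@le_trans _ _ 1); last by rewrite lerDl.
    exact: exprn_ile1.
  apply: ler_wpDl => //; rewrite -real_normK ?num_real// -exprM.
  by apply: ler_weXn2l => //; lia.
by rewrite /K mulrDl mul1r lerD// -[leLHS]expR0 ler_expR.
Qed.

Lemma normal_moment_integrable (m s : R) (N : nat) : s != 0 ->
  mu.-integrable setT (EFin \o (fun x => (x - m) ^+ N * normal_pdf m s x)).
Proof.
move=> s0; have [C C0 HC] := normal_tail_le N s0.
apply: (@le_integrable _ _ _ mu setT measurableT _
  (fun x => C%:E * (normal_pdf m (Num.sqrt 2 * s) x)%:E)%E).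
- apply/measurable_EFinP; apply: measurable_funM; last exact: measurable_normal_pdf.
  by apply: measurable_funX; apply: measurable_funB.
- move=> x _ /=; rewrite lee_fin !normrM !(ger0_norm (normal_pdf_ge0 _ _ _)).
  by rewrite normrX (ger0_norm C0).
- by apply: integrableZl => //; exact: integrable_normal_pdf.
Qed.

Lemma is_derive_normal_pdf (m s x : R) : s != 0 ->
  is_derive x 1 (normal_pdf m s) (- (x - m) / s ^+ 2 * normal_pdf m s x).
Proof.
move=> s0; rewrite normal_pdfE//=.
have d1 : is_derive x 1 (fun y : R => - (y - m) ^+ 2 / (s ^+ 2 *+ 2)) (- (x - m) / s ^+ 2).
  have -> : (fun y : R => - (y - m) ^+ 2 / (s ^+ 2 *+ 2)) =
    (- (s ^+ 2 *+ 2)^-1) \*: ((id - cst m : R -> R) ^+ 2).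
    by apply/funext => y; rewrite /= !fctE /GRing.scale/= mulrC mulrN mulNr.
  apply: is_derive_eq; rewrite subr0 /GRing.scale/= !mulr1 expr1 !fctE -mulr_natr.
  by field; rewrite s0.
have d2 := is_derive1_comp_eq (is_derive_expR _) d1.
have -> : (fun y => normal_peak s * normal_fun m s y) = normal_peak s \*:
  (expR \o (fun y : R => - (y - m) ^+ 2 / (s ^+ 2 *+ 2))) by [].
apply: is_derive_eq; rewrite /GRing.scale/= /normal_fun; ring.
Qed.

Lemma continuous_normal_moment (m s : R) N : s != 0 ->
  continuous (fun x => (x - m) ^+ N * normal_pdf m s x).
Proof.
move=> s0 x; apply: cvgM; last exact: continuous_normal_pdf.
apply: (cvg_comp (fun x => x - m) (fun x => x ^+ N)); last exact: exprn_continuous.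
by apply: (@cvgB _ R^o); [exact: cvg_id|exact: cvg_cst].
Qed.

Lemma normal_moment_bounded (m s : R) (N : nat) : s != 0 ->
  exists C, forall x, `|(x - m) ^+ N * normal_pdf m s x| <= C.
Proof.
move=> s0; have [C C0 HC] := normal_tail_le N s0.
exists (C * normal_peak (Num.sqrt 2 * s)) => x.
rewrite normrM normrX (ger0_norm (normal_pdf_ge0 _ _ _)).
apply: le_trans (HC _ _) _; rewrite ler_wpM2l//; apply: normal_pdf_ub.
by rewrite mulf_neq0// gt_eqF// sqrtr_gt0.
Qed.

(** The derivative of [(x - m)^(N+1)] times the density has integral 0. *)
Lemma normal_moment_rec (m s : R) (N : nat) : s != 0 ->
  (\int[mu]_x ((x - m) ^+ N.+2 * normal_pdf m s x)%:E =
   (N.+1%:R * s ^+ 2)%:E * \int[mu]_x ((x - m) ^+ N * normal_pdf m s x)%:E)%E.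
Proof.
move=> s0.
pose F (x : R) := (x - m) ^+ N.+1 * normal_pdf m s x.
pose f (x : R) := N.+1%:R * ((x - m) ^+ N * normal_pdf m s x) -
   (s ^+ 2)^-1 * ((x - m) ^+ N.+2 * normal_pdf m s x).
have iN := @normal_moment_integrable m s _ s0.
have Fd (x : R) : is_derive x 1 F (f x).
  have d := @is_derive_normal_pdf m s x s0.
  have -> : F = ((id - cst m : R -> R) ^+ N.+1) * normal_pdf m s.
    by apply/funext => y; rewrite /F /= !fctE.
  apply: is_derive_eq; rewrite subr0 /GRing.scale/= mulr1 /f !fctE/=.
  by rewrite !exprS; field; rewrite s0.
have fc : continuous f.
  move=> x; apply: (@cvgB _ R^o); apply: cvgM; do ?[exact: cvg_cst];
    exact: continuous_normal_moment.
have [C HC] := @normal_moment_bounded m s N.+2 s0.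
have fi : mu.-integrable setT (EFin \o f).
  rewrite (_ : EFin \o f = (fun x => N.+1%:R%:E * ((x - m) ^+ N * normal_pdf m s x)%:E) \-
     (fun x => ((s ^+ 2)^-1)%:E * ((x - m) ^+ N.+2 * normal_pdf m s x)%:E))%E; last first.
    by apply/funext => x /=; rewrite /f EFinB !EFinM.
  by apply: integrableB => //; apply: integrableZl => //; exact: iN.
have : (\int[mu]_x (f x)%:E = 0)%E.
  by apply: (integral_derivative_eq0 Fd fc fi (m := m) (C := C)) => x;
    rewrite /F mulrA -exprS.
rewrite (_ : (fun x => _) = (fun x => N.+1%:R%:E * ((x - m) ^+ N * normal_pdf m s x)%:E) \-
     (fun x => ((s ^+ 2)^-1)%:E * ((x - m) ^+ N.+2 * normal_pdf m s x)%:E))%E; last first.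
  by apply/funext => x /=; rewrite /f EFinB !EFinM.
rewrite integralB//; [|by apply: integrableZl => //; exact: iN..].
rewrite !integralZl//; [|exact: iN..].
have /fineK <- := integrable_fin_num measurableT (iN N).
have /fineK <- := integrable_fin_num measurableT (iN N.+2).
rewrite -!EFinM -EFinB => -[] /eqP; rewrite subr_eq0 => /eqP e.
by congr EFin; rewrite mulrAC e mulrAC mulVf ?mul1r// expf_neq0.
Qed.

Lemma normal_mean0 (m s : R) : s != 0 ->
  (\int[mu]_x ((x - m) * normal_pdf m s x)%:E = 0)%E.
Proof.
move=> s0.
pose f (x : R) := - (s ^+ 2)^-1 * ((x - m) ^+ 1 * normal_pdf m s x).
have Fd (x : R) : is_derive x 1 (normal_pdf m s) (f x).
  apply: (is_derive_eq (is_derive_normal_pdf m x s0)).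
  by rewrite /f expr1; field; rewrite s0.
have fc : continuous f.
  by move=> x; apply: cvgM; [exact: cvg_cst|exact: continuous_normal_moment].
have [C HC] := @normal_moment_bounded m s 1 s0.
have i1 := normal_moment_integrable m 1 s0.
have fE : EFin \o f = (fun x => (- (s ^+ 2)^-1)%:E * ((x - m) ^+ 1 * normal_pdf m s x)%:E)%E.
  by apply/funext => x /=; rewrite /f EFinM.
have fi : mu.-integrable setT (EFin \o f) by rewrite fE; exact: integrableZl.
have := integral_derivative_eq0 Fd fc fi (m := m) (C := C).
rewrite (_ : (fun x => (f x)%:E) = EFin \o f)// fE integralZl// => E.
have {E} : (((- (s ^+ 2)^-1)%:E * (\int[mu]_x ((x - m) ^+ 1 * normal_pdf m s x)%:E)) = 0)%E.
  by apply: E => x; exact: HC.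
move/eqP; rewrite mule_eq0 eqe oppr_eq0 invr_eq0 expf_eq0/= (negbTE s0)/=.
by move/eqP; under eq_integral do rewrite expr1.
Qed.
End NormalMoments.

Section GaussianMoments.
Context d (T : measurableType d) {R : realType} (P : probability T R).
Local Notation mu := (@lebesgue_measure R).
Implicit Types (Y : {RV P >-> R}).

Lemma ge0_integral_normal_prob (m s : R) (f : R -> \bar R) :
  measurable_fun setT f -> (forall x, (0 <= f x)%E) ->
  (\int[normal_prob m s]_x f x = \int[mu]_x (f x * (normal_pdf m s x)%:E))%E.
Proof.
move=> mf f0.
have dom := normal_prob_dominates m s.
have fge := Radon_Nikodym_SigmaFinite.f_ge0 dom.
have fi := Radon_Nikodym_SigmaFinite.f_integrable dom.
rewrite -(Radon_Nikodym_SigmaFinite.change_of_variables dom f0 measurableT mf).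
apply: ge0_ae_eq_integral => //.
- by apply: emeasurable_funM => //; exact: measurable_int fi.
- apply: emeasurable_funM => //; apply/measurable_EFinP; exact: measurable_normal_pdf.
- by move=> x _; rewrite mule_ge0.
- by move=> x _; rewrite mule_ge0// lee_fin normal_pdf_ge0.
apply: ae_eqe_mul2l.
apply: integral_ae_eq => //.
- by apply/measurable_EFinP; exact: measurable_normal_pdf.
- move=> E _ mE; rewrite -(Radon_Nikodym_SigmaFinite.f_integral dom mE).
  by [].
Qed.

Lemma ge0_integral_law d' (T' : measurableType d') (Q : {measure set T' -> \bar R})
    (Y : T -> T') (f : T' -> \bar R) :
  measurable_fun setT Y ->
  (forall A, measurable A -> pushforward P Y A = Q A) ->
  measurable_fun setT f -> (forall x, (0 <= f x)%E) ->
  (\int[P]_w f (Y w) = \int[Q]_x f x)%E.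
Proof.
move=> mY YQ mf f0.
pose mixin := isMeasurableFun.Build _ _ _ _ _ mY.
pose Yp : {mfun _ >-> _} := HB.pack Y mixin.
rewrite -(ge0_integral_distribution (Yp : {RV P >-> T'}) mf f0).
by apply: eq_measure_integral => A mA _; exact: YQ.
Qed.

Section normal.
Variables (Y : T -> R) (m s : R).
Hypotheses (mY : measurable_fun setT Y) (s0 : s != 0).
Hypothesis Yms : forall A : set R, measurable A -> pushforward P Y A = normal_prob m s A.

Let ge0E (f : R -> \bar R) : measurable_fun setT f -> (forall x, (0 <= f x)%E) ->
  (\int[P]_w f (Y w) = \int[mu]_x (f x * (normal_pdf m s x)%:E))%E.
Proof.
move=> mf f0; rewrite -ge0_integral_normal_prob//.
exact: (@ge0_integral_law _ (measurableTypeR R) (normal_prob m s) Y f mY Yms mf f0).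
Qed.

Lemma normal_all_moments : all_moments P (fun w => Y w - m).
Proof.
split; first exact: measurable_funB.
move=> N; apply/integrableP; split.
  by apply/measurable_EFinP/measurable_normX; exact: measurable_funB.
rewrite (_ : (\int[P]_x _)%E = (\int[P]_w (fun x => (`|x - m| ^+ N)%:E) (Y w))%E); last first.
  by apply: eq_integral => w _ /=; rewrite ger0_norm ?exprn_ge0.
rewrite (ge0E (f := fun x => (`|x - m| ^+ N)%:E)).
- have /integrableP[_] := normal_moment_integrable m N s0.
  apply: le_lt_trans; rewrite le_eqVlt; apply/orP; left; apply/eqP.
  apply: eq_integral => x _ /=.
  by rewrite normrM normrX (ger0_norm (normal_pdf_ge0 _ _ _)).
- by apply/measurable_EFinP/measurable_normX; apply: measurable_funB.
- by move=> x; rewrite lee_fin exprn_ge0.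
Qed.

Lemma normal_Ex N : (Ex P (fun w => (Y w - m) ^+ N))%:E =
  (\int[mu]_x ((x - m) ^+ N * normal_pdf m s x)%:E)%E.
Proof.
rewrite -integral_Ex; last by apply: all_momentsX; exact: normal_all_moments.
have mf : measurable_fun setT (fun x : R => ((x - m) ^+ N)%:E).
  by apply/measurable_EFinP; apply: measurable_funX; apply: measurable_funB.
rewrite integralE [RHS]integralE.
have -> : (\int[P]_w (fun w => ((Y w - m) ^+ N)%:E)^\+ w =
  \int[P]_w (fun x : R => ((x - m) ^+ N)%:E)^\+%E (Y w))%E.
  by apply: eq_integral => w _; rewrite !funeposE.
have -> : (\int[P]_w (fun w => ((Y w - m) ^+ N)%:E)^\- w =
  \int[P]_w (fun x : R => ((x - m) ^+ N)%:E)^\-%E (Y w))%E.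
  by apply: eq_integral => w _; rewrite !funenegE.
rewrite (ge0E (f := (fun x : R => ((x - m) ^+ N)%:E)^\+%E))//; last exact: measurable_funepos.
rewrite (ge0E (f := (fun x : R => ((x - m) ^+ N)%:E)^\-%E))//; last exact: measurable_funeneg.
congr (_ - _)%E; apply: eq_integral => x _.
  by rewrite !funeposE maxe_pMl ?lee_fin ?normal_pdf_ge0// mul0e EFinM.
by rewrite !funenegE maxe_pMl ?lee_fin ?normal_pdf_ge0// mul0e EFinM mulNe.
Qed.

Lemma normal_Ex_rec N : Ex P (fun w => (Y w - m) ^+ N.+2) =
  N.+1%:R * s ^+ 2 * Ex P (fun w => (Y w - m) ^+ N).
Proof.
by apply: EFin_inj; rewrite EFinM !normal_Ex normal_moment_rec.
Qed.

Lemma normal_Ex_mean : Ex P Y = m.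
Proof.
have := normal_Ex 1; under eq_integral do rewrite expr1.
rewrite normal_mean0// => -[] /eqP.
rewrite (_ : (fun w => _) = (fun w => Y w - m)); last by apply/funext => w; rewrite expr1.
have Ym : all_moments P Y.
  rewrite (_ : Y = fun w => (Y w - m) + m); last by apply/funext => w; rewrite subrK.
  by apply: all_momentsD; [exact: normal_all_moments|exact: all_moments_cst].
by rewrite ExB ?Ex_cst ?subr_eq0; [move/eqP|exact: Ym|exact: all_moments_cst].
Qed.

Lemma normal_support a b : a < b -> (0 < P (Y @^-1` `]a, b[))%E.
Proof.
move=> ab.
have mI : measurable (`]a, b[%classic : set R) by exact: measurable_itv.
have -> : P (Y @^-1` `]a, b[) = normal_prob m s `]a, b[ by rewrite -Yms.
rewrite lt0e measure_ge0 andbT; apply/eqP.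
rewrite /normal_prob => i0.
have mp : measurable_fun `]a, b[ (EFin \o normal_pdf m s).
  by apply/measurable_EFinP; apply: measurable_funTS; exact: measurable_normal_pdf.
have : (\int[mu]_(x in `]a, b[) `|(EFin \o normal_pdf m s) x| = 0)%E.
  by rewrite -[RHS]i0; apply: eq_integral => x _ /=; rewrite ger0_norm ?normal_pdf_ge0.
move/(ae_eq_integral_abs mu mI mp) => [N [mN N0 sub]].
have : (mu `]a, b[ <= mu N)%E.
  apply: le_measure; rewrite ?inE// => x xab; apply: sub => /= /(_ xab).
  move=> -[] /eqP; rewrite normal_pdfE//= mulf_eq0 gt_eqF ?normal_peak_gt0//=.
  by rewrite gt_eqF// expR_gt0.
by rewrite N0 lebesgue_measure_itv/= lte_fin ab -EFinB lee_fin leNgt subr_gt0 ab.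
Qed.

End normal.

End GaussianMoments.

Section GaussianRV.
Context d (T : measurableType d) {R : realType} (P : probability T R).

Section dirac.
Variables (Y : T -> R) (m : R).
Hypothesis mY : measurable_fun setT Y.
Hypothesis Ym : forall A : set R, measurable A -> pushforward P Y A = \d_m A.

Lemma dirac_all_moments : all_moments P (fun w => Y w - m).
Proof.
split; first exact: measurable_funB.
move=> N; apply/integrableP; split.
  by apply/measurable_EFinP/measurable_normX; exact: measurable_funB.
rewrite (_ : (\int[P]_x _)%E = (\int[P]_w (fun x => (`|x - m| ^+ N)%:E) (Y w))%E); last first.
  by apply: eq_integral => w _ /=; rewrite ger0_norm ?exprn_ge0.
have mN : measurable_fun setT (fun x : R => (`|x - m| ^+ N)%:E).
  by apply/measurable_EFinP/measurable_normX; exact: measurable_funB.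
rewrite (@ge0_integral_law _ _ _ P _ _ (\d_m) Y _ mY Ym mN).
  by rewrite integral_dirac// diracT mul1e ltry.
by move=> x; rewrite lee_fin exprn_ge0.
Qed.

Lemma dirac_Ex_norm N : Ex P (fun w => `|Y w - m| ^+ N.+1) = 0.
Proof.
apply: EFin_inj; rewrite -integral_Ex; last first.
  by apply: all_momentsX; apply: all_moments_norm; exact: dirac_all_moments.
have mN : measurable_fun setT (fun x : R => (`|x - m| ^+ N.+1)%:E).
  by apply/measurable_EFinP/measurable_normX; exact: measurable_funB.
rewrite (@ge0_integral_law _ _ _ P _ _ (\d_m) Y _ mY Ym mN).
  by rewrite integral_dirac// diracT mul1e subrr normr0 expr0n.
by move=> x; rewrite lee_fin exprn_ge0.
Qed.

Lemma dirac_Ex N : Ex P (fun w => (Y w - m) ^+ N.+1) = 0.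
Proof.
apply/eqP; rewrite -normr_eq0 eq_le normr_ge0 andbT.
apply: le_trans (Ex_norm (all_momentsX N.+1 dirac_all_moments)) _.
rewrite (_ : (fun w => _) = (fun w => `|Y w - m| ^+ N.+1)) ?dirac_Ex_norm//.
by apply/funext => w; rewrite normrX.
Qed.

End dirac.

Lemma gaussian_all_moments (Y : T -> R) : measurable_fun setT Y ->
  gaussian P Y -> all_moments P Y.
Proof.
move=> mY gY.
suff [m Ym] : exists m, all_moments P (fun w => Y w - m).
  rewrite (_ : Y = fun w => (Y w - m) + m); last by apply/funext => w; rewrite subrK.
  by apply: all_momentsD => //; exact: all_moments_cst.
case: gY => [[m Ym]|[m [s [s0 Ym]]]]; exists m; first exact: dirac_all_moments.
exact: normal_all_moments Ym.
Qed.

(** Together with the existence of all moments, this recursion, which holds for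
    any variance (0 included), is all that the moment calculus below needs to
    know about Gaussian laws. *)
Lemma gaussian_Ex_rec (Y : T -> R) N : measurable_fun setT Y ->
  gaussian P Y -> Ex P Y = 0 ->
  Ex P (fun w => Y w ^+ N.+2) =
  N.+1%:R * Ex P (fun w => Y w ^+ 2) * Ex P (fun w => Y w ^+ N).
Proof.
move=> mY gY EY0; have Ya := gaussian_all_moments mY gY.
have YE (m : R) : Ex P (fun w => Y w - m) = 0 -> m = 0.
  rewrite ExB ?Ex_cst//; last exact: all_moments_cst.
  by rewrite EY0 sub0r => /eqP; rewrite oppr_eq0 => /eqP.
case: gY => [[m Ym]|[m [s [s0 Ym]]]].
  have m0 : m = 0.
    have := dirac_Ex mY Ym 0; rewrite (_ : (fun w => _) = fun w => Y w - m); first exact: YE.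
    by apply/funext => w; rewrite expr1.
  have E k : Ex P (fun w => Y w ^+ k.+1) = 0.
    rewrite -(dirac_Ex mY Ym k); congr Ex; apply/funext => w.
    by rewrite m0 subr0.
  by rewrite !E mulr0 mul0r.
have m0 : m = 0 by rewrite -(normal_Ex_mean mY s0 Ym).
have E k : Ex P (fun w => Y w ^+ k) = Ex P (fun w => (Y w - m) ^+ k).
  by congr Ex; apply/funext => w; rewrite m0 subr0.
rewrite !E (normal_Ex_rec mY s0 Ym N) (normal_Ex_rec mY s0 Ym 0).
rewrite (_ : (fun w => (Y w - m) ^+ 0) = cst 1) ?Ex_cst ?mulr1 ?mul1r//.
Qed.

Lemma gaussian_support (Y : T -> R) a b : measurable_fun setT Y ->
  gaussian P Y -> Ex P Y = 0 -> Ex P (fun w => Y w ^+ 2) != 0 -> a < b ->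
  (0 < P (Y @^-1` `]a, b[))%E.
Proof.
move=> mY gY EY0 EY2 ab; have Ya := gaussian_all_moments mY gY.
case: gY => [[m Ym]|[m [s [s0 Ym]]]]; last exact: normal_support s0 Ym _ _ ab.
exfalso; move/eqP: EY2; apply.
have m0 : m = 0.
  have := dirac_Ex mY Ym 0; rewrite (_ : (fun w => _) = fun w => Y w - m).
    rewrite ExB ?Ex_cst//; last exact: all_moments_cst.
    by rewrite EY0 sub0r => /eqP; rewrite oppr_eq0 => /eqP.
  by apply/funext => w; rewrite expr1.
rewrite -(dirac_Ex mY Ym 1); congr Ex; apply/funext => w.
by rewrite m0 subr0.
Qed.

End GaussianRV.

(** * Integration by parts in a Gaussian space *)

Section GaussianSpace.
Context d (T : measurableType d) {R : realType} (P : probability T R).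
Local Notation E := (Ex P).
Local Notation am := (all_moments P).
Implicit Types (X Y Z U Q : T -> R).

(** Differentiation at 0 under the expectation is legitimate because the
    expectation is a polynomial in [t].  It serves to polarize identities on
    the powers of one Gaussian variable into identities on several. *)
Lemma is_derive_Ex_expr n X Y Z : am X -> am Y -> am Z ->
  is_derive (0 : R) 1 (fun t => E (fun w => Z w * (Y w + t * X w) ^+ n))
    (n%:R * E (fun w => Z w * (Y w ^+ n.-1 * X w))).
Proof.
move=> aX aY aZ.
pose p : {poly R} := \poly_(i < n.+1) (E (fun w => Z w * (Y w ^+ (n - i) * X w ^+ i)) *+ 'C(n, i)).
have ai i j : am (fun w => Z w * (Y w ^+ i * X w ^+ j)).
  by apply: all_momentsM => //; apply: all_momentsM; exact: all_momentsX.
have -> : (fun t => E (fun w => Z w * (Y w + t * X w) ^+ n)) = horner p.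
  apply/funext => t; rewrite horner_poly.
  rewrite (_ : (fun w => _) = (fun w => \sum_(i < n.+1)
     (t ^+ i *+ 'C(n, i)) * (Z w * (Y w ^+ (n - i) * X w ^+ i)))); last first.
    apply/funext => w; rewrite exprDn mulr_sumr; apply: eq_bigr => i _.
    rewrite exprMn mulrnAr mulrnAl; congr (_ *+ _).
    by move: (Y w ^+ _) (X w ^+ i) (t ^+ i) (Z w) => a b e z; ring.
  rewrite Ex_sum; last by move=> i _; exact: all_momentsZ.
  by apply: eq_bigr => i _; rewrite ExZ// mulrC mulrnAr mulrnAl.
apply: is_derive_eq.
rewrite -[0 in LHS]/(0 : R) horner_coef0 coef_deriv coef_poly.
case: n @p => [|n] p /=; first by rewrite !mul0r mul0rn.
by rewrite bin1 subn1/= mulr1n mulr_natl.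
Qed.

Lemma is_derive_unique (f : R -> R) (x a b : R) : is_derive x 1 f a -> is_derive x 1 f b -> a = b.
Proof. by move=> /@derive_val <- /@derive_val <-. Qed.

(** A linear space of centered Gaussian variables, seen through its moments
    only. *)
Record gaussian_space (G : (T -> R) -> Prop) : Prop := GaussianSpace {
  gs_lin : forall (t : R) X Y, G X -> G Y -> G (fun w => Y w + t * X w);
  gs_am : forall X, G X -> am X;
  gs_mean : forall X, G X -> E X = 0;
  gs_rec : forall X N, G X -> E (fun w => X w ^+ N.+2) =
    N.+1%:R * E (fun w => X w ^+ 2) * E (fun w => X w ^+ N) }.

Variable G : (T -> R) -> Prop.
Hypothesis GG : gaussian_space G.

Let G_lin := gs_lin GG.
Let G_am := gs_am GG.
Let G_mean := gs_mean GG.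
Let G_rec := gs_rec GG.

Definition covar X Y := E (fun w => X w * Y w).
Local Notation cov := covar.

(** Differentiating the moment recursion of [Y + t U] at [t = 0] gives a
    recursion for [E (U * Y ^ m)]. *)
Lemma stein_power U Y m : G U -> G Y ->
  E (fun w => U w * Y w ^+ m) = m%:R * cov U Y * E (fun w => Y w ^+ m.-1).
Proof.
move=> GU GY; have aU := G_am GU; have aY := G_am GY.
have one : am (cst 1) by exact: all_moments_cst.
have D n : is_derive (0 : R) 1 (fun t => E (fun w => (Y w + t * U w) ^+ n))
    (n%:R * E (fun w => U w * Y w ^+ n.-1)).
  have := is_derive_Ex_expr n aU aY one.
  rewrite (_ : (fun w => cst 1 w * (Y w ^+ n.-1 * U w)) = fun w => U w * Y w ^+ n.-1); last first.
    by apply/funext => w; rewrite mul1r mulrC.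
  rewrite (_ : (fun t => E (fun w => cst 1 w * (Y w + t * U w) ^+ n)) =
     fun t => E (fun w => (Y w + t * U w) ^+ n))//.
  apply/funext => t; congr Ex; apply/funext => w; by rewrite mul1r.
have rec N : N.+2%:R * E (fun w => U w * Y w ^+ N.+1) =
   N.+1%:R * (2%:R * cov U Y * E (fun w => Y w ^+ N) +
     E (fun w => Y w ^+ 2) * (N%:R * E (fun w => U w * Y w ^+ N.-1))).
  apply: (is_derive_unique (D N.+2)).
  rewrite (_ : (fun t => _) = (N.+1%:R \*: ((fun t => E (fun w => (Y w + t * U w) ^+ 2)) *
       (fun t => E (fun w => (Y w + t * U w) ^+ N))))); last first.
    apply/funext => t; rewrite /= (G_rec N (G_lin t GU GY)) /GRing.scale/= mulrA.
    by [].
  have D2 := D 2%N; have DN := D N.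
  apply: is_derive_eq; rewrite /GRing.scale/=; congr (_ * _).
  have e0 k : E (fun w => (Y w + 0 * U w) ^+ k) = E (fun w => Y w ^+ k).
    by congr Ex; apply/funext => w; rewrite mul0r addr0.
  rewrite !e0 /covar (_ : (fun w => U w * Y w ^+ 1) = fun w => U w * Y w)//.
  by ring.
have [k km] := ubnP m; elim: k m km => // k IH [|[|m]] /= km.
- rewrite !mul0r (_ : (fun w => _) = U) ?G_mean//.
  by apply/funext => w; rewrite mulr1.
- rewrite mul1r (_ : (fun w => Y w ^+ 0) = cst 1)// Ex_cst mulr1.
  by congr Ex; apply/funext => w; rewrite expr1.
have nz n : (n.+1%:R : R) != 0 by rewrite pnatr_eq0.
apply: (mulfI (nz m.+2)); rewrite rec.
have km1 : (m < k)%N by move: km; rewrite !ltnS => /ltnW.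
rewrite /= IH//.
case: m km km1 => [|m] km km1 /=.
  rewrite !mul0r !mulr0 addr0 (_ : (fun w => Y w ^+ 1) = Y)//; rewrite G_mean//.
  by rewrite !mulr0.
rewrite (G_rec m GY) -(natr1 m.+2) -(natr1 m.+1) -(natr1 m).
by ring.
Qed.

(** [Q] stands for a polynomial in Gaussian variables and [Q'] for its
    derivative in the direction [U].  Since random variables do not remember
    the polynomial that they come from, the pair is characterized by
    integration by parts; testing against all powers of all [Y] makes the
    property stable under multiplication by Gaussian variables. *)
Definition Stein U Q Q' := [/\ am Q, am Q' & forall Y m, G Y ->
  E (fun w => U w * (Y w ^+ m * Q w)) =
  m%:R * cov U Y * E (fun w => Y w ^+ m.-1 * Q w) + E (fun w => Y w ^+ m * Q' w)].

Lemma Stein_cst U c : G U -> Stein U (cst c) (cst 0).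
Proof.
move=> GU; split; [exact: all_moments_cst..|move=> Y m GY].
have aU := G_am GU; have aY := G_am GY.
have aX n : am (fun w => Y w ^+ n) by exact: all_momentsX.
rewrite (_ : (fun w => U w * _) = fun w => c * (U w * Y w ^+ m)); last first.
  by apply/funext => w /=; ring.
rewrite (_ : (fun w => Y w ^+ m.-1 * _) = fun w => c * Y w ^+ m.-1); last first.
  by apply/funext => w /=; ring.
rewrite (_ : (fun w => Y w ^+ m * _) = cst 0); last first.
  by apply/funext => w /=; ring.
rewrite !ExZ//; last exact: all_momentsM.
by rewrite Ex_cst stein_power//; ring.
Qed.

Lemma SteinD U Q1 Q1' Q2 Q2' : G U -> Stein U Q1 Q1' -> Stein U Q2 Q2' ->
  Stein U (fun w => Q1 w + Q2 w) (fun w => Q1' w + Q2' w).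
Proof.
move=> GU [a1 a1' S1] [a2 a2' S2]; split; [exact: all_momentsD..|move=> Y m GY].
have aU := G_am GU; have aY := G_am GY.
have aX n : am (fun w => Y w ^+ n) by exact: all_momentsX.
rewrite (_ : (fun w => U w * _) = fun w => U w * (Y w ^+ m * Q1 w) +
   U w * (Y w ^+ m * Q2 w)); last by apply/funext => w; ring.
rewrite (_ : (fun w => Y w ^+ m.-1 * _) = fun w => Y w ^+ m.-1 * Q1 w +
   Y w ^+ m.-1 * Q2 w); last by apply/funext => w; ring.
rewrite (_ : (fun w => Y w ^+ m * _) = fun w => Y w ^+ m * Q1' w +
   Y w ^+ m * Q2' w); last by apply/funext => w; ring.
rewrite !ExD ?S1 ?S2//; try (do ?[apply: all_momentsM => //]; fail).
all: try by do ?apply: all_momentsM.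
by ring.
Qed.

(** The property of [Q] for [Y + t X] and the exponent [m + 1], differentiated
    at [t = 0], is the property of [X * Q] for [Y] and the exponent [m]. *)
Lemma SteinM U X Q Q' : G U -> G X -> Stein U Q Q' ->
  Stein U (fun w => X w * Q w) (fun w => cov U X * Q w + X w * Q' w).
Proof.
move=> GU GX [aQ aQ' S]; have aU := G_am GU; have aX := G_am GX.
split; [exact: all_momentsM|by apply: all_momentsD; [exact: all_momentsZ|exact: all_momentsM]|].
move=> Y m GY; have aY := G_am GY.
have aYX n : am (fun w => Y w ^+ n) by exact: all_momentsX.
have D1 := is_derive_Ex_expr m.+1 aX aY (all_momentsM aU aQ).
have D2 := is_derive_Ex_expr m aX aY aQ.
have D3 := is_derive_Ex_expr m.+1 aX aY aQ'.
have D4 : is_derive (0 : R) 1 (fun t => cov U (fun w => Y w + t * X w)) (cov U X).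
  have := is_derive_Ex_expr 1 aX aY aU; rewrite mul1r.
  rewrite (_ : (fun w => U w * (Y w ^+ 0 * X w)) = fun w => U w * X w)//.
  by apply/funext => w; rewrite mul1r.
have := is_derive_unique D1 (b := m.+1%:R * (cov U Y * (m%:R * E (fun w => Q w * (Y w ^+ m.-1 * X w)))
   + cov U X * E (fun w => Q w * Y w ^+ m)) + m.+1%:R * E (fun w => Q' w * (Y w ^+ m * X w))).
rewrite /= => H.
have {}H : m.+1%:R * E (fun w => U w * Q w * (Y w ^+ m * X w)) =
  m.+1%:R * (cov U Y * (m%:R * E (fun w => Q w * (Y w ^+ m.-1 * X w)))
   + cov U X * E (fun w => Q w * Y w ^+ m)) + m.+1%:R * E (fun w => Q' w * (Y w ^+ m * X w)).
  apply: H.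
  rewrite (_ : (fun t => _) = ((m.+1%:R \*: ((fun t => cov U (fun w => Y w + t * X w)) *
     (fun t => E (fun w => Q w * (Y w + t * X w) ^+ m)))) +
     (fun t => E (fun w => Q' w * (Y w + t * X w) ^+ m.+1)))); last first.
    apply/funext => t; rewrite /= !fctE/=.
    have := S _ m.+1 (G_lin t GX GY); rewrite /= => S1.
    rewrite (_ : (fun w => U w * Q w * (Y w + t * X w) ^+ m.+1) =
      fun w => U w * ((Y w + t * X w) ^+ m.+1 * Q w)); last by apply/funext => w; ring.
    rewrite S1 /GRing.scale/= mulrA; congr (_ * E _ + E _).
      by apply/funext => w; rewrite mulrC.
    by apply/funext => w; rewrite mulrC.
  apply: is_derive_eq; rewrite /GRing.scale/=; congr (_ + _); congr (_ * _).
  congr (_ * _ + _).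
    by congr Ex; apply/funext => w; rewrite mul0r addr0.
  rewrite mulrC; congr (_ * _).
  by congr Ex; apply/funext => w; rewrite mul0r addr0.
have nz : (m.+1%:R : R) != 0 by rewrite pnatr_eq0.
move: H; rewrite -mulrDr => /(mulfI nz) H.
rewrite (_ : (fun w => U w * _) = (fun w => U w * Q w * (Y w ^+ m * X w))); last first.
  by apply/funext => w; ring.
rewrite H (_ : (fun w => Y w ^+ m * _) = (fun w => cov U X * (Q w * Y w ^+ m) +
   Q' w * (Y w ^+ m * X w))); last by apply/funext => w; ring.
rewrite ExD ?ExZ; last 3 first.
- by apply: all_momentsM.
- by apply: all_momentsZ; apply: all_momentsM.
- by do ?apply: all_momentsM.
rewrite (_ : (fun w => Y w ^+ m.-1 * _) = (fun w => Q w * (Y w ^+ m.-1 * X w))).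
  by ring.
by apply/funext => w; ring.
Qed.

(** Acting on Stein pairs by the Leibniz rule is, unlike being a Stein pair, a
    property that obviously passes to products. *)
Definition gderiv U F F' := am F /\ am F' /\ forall Q Q', Stein U Q Q' ->
  Stein U (fun w => F w * Q w) (fun w => F' w * Q w + F w * Q' w).

Lemma gderiv_cst U c : G U -> gderiv U (cst c) (cst 0).
Proof.
move=> GU; split; [exact: all_moments_cst|split; [exact: all_moments_cst|]].
move=> Q Q' [aQ aQ' S].
rewrite (_ : (fun w => cst 0 w * _ + _) = fun w => c * Q' w); last first.
  by apply/funext => w /=; ring.
split; [exact: all_momentsZ..|move=> Y m GY].
have aU := G_am GU; have aY := G_am GY.
have aYX n : am (fun w => Y w ^+ n) by exact: all_momentsX.
rewrite (_ : (fun w => U w * _) = fun w => c * (U w * (Y w ^+ m * Q w))); last first.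
  by apply/funext => w /=; ring.
rewrite (_ : (fun w => Y w ^+ m.-1 * _) = fun w => c * (Y w ^+ m.-1 * Q w)); last first.
  by apply/funext => w /=; ring.
rewrite (_ : (fun w => Y w ^+ m * (c * _)) = fun w => c * (Y w ^+ m * Q' w)); last first.
  by apply/funext => w /=; ring.
rewrite !ExZ; [|by do ?apply: all_momentsM..].
by rewrite S//; ring.
Qed.

Lemma gderiv_id U X : G U -> G X -> gderiv U X (cst (cov U X)).
Proof.
move=> GU GX; split; [exact: G_am|split; [exact: all_moments_cst|]].
by move=> Q Q' S; apply: SteinM.
Qed.

Lemma gderivM U F F' K K' : gderiv U F F' -> gderiv U K K' ->
  gderiv U (fun w => F w * K w) (fun w => F' w * K w + F w * K' w).
Proof.
move=> [aF [aF' dF]] [aK [aK' dK]]; split; first exact: all_momentsM.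
split; first by apply: all_momentsD; exact: all_momentsM.
move=> Q Q' /dK/dF.
rewrite (_ : (fun w => F w * (K w * Q w)) = (fun w => F w * K w * Q w)); last first.
  by apply/funext => w; ring.
congr (Stein _ _ _); by apply/funext => w; ring.
Qed.

Lemma gderivD U F F' K K' : G U -> gderiv U F F' -> gderiv U K K' ->
  gderiv U (fun w => F w + K w) (fun w => F' w + K' w).
Proof.
move=> GU [aF [aF' dF]] [aK [aK' dK]]; split; first exact: all_momentsD.
split; first exact: all_momentsD.
move=> Q Q' S; have := SteinD GU (dF _ _ S) (dK _ _ S).
rewrite (_ : (fun w => F w * Q w + K w * Q w) = (fun w => (F w + K w) * Q w)); last first.
  by apply/funext => w; ring.
congr (Stein _ _ _); by apply/funext => w; ring.
Qed.

Lemma gderiv_eq U F F' K' : gderiv U F F' -> F' =1 K' -> gderiv U F K'.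
Proof. by move=> dF /funext <-. Qed.

Lemma gderivZ U c F F' : G U -> gderiv U F F' ->
  gderiv U (fun w => c * F w) (fun w => c * F' w).
Proof.
move=> GU dF; apply: (gderiv_eq (gderivM (gderiv_cst c GU) dF)) => w /=; ring.
Qed.

Lemma gderivX U X p : G U -> G X ->
  gderiv U (fun w => X w ^+ p) (fun w => p%:R * cov U X * X w ^+ p.-1).
Proof.
move=> GU GX; elim: p => [|p IH].
  by apply: (gderiv_eq (gderiv_cst 1 GU)) => w; rewrite !mul0r.
rewrite (_ : (fun w => X w ^+ p.+1) = fun w => X w * X w ^+ p); last first.
  by apply/funext => w; rewrite exprS.
apply: (gderiv_eq (gderivM (gderiv_id GU GX) IH)) => w /=.
case: p {IH} => [|p] /=; first by rewrite expr0; ring.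
by rewrite (exprS _ p) -(natr1 p.+1); ring.
Qed.

(** Gaussian integration by parts, E[U F] = E[D_U F]. *)
Lemma Ex_by_parts U F F' : G U -> gderiv U F F' -> E (fun w => U w * F w) = E F'.
Proof.
move=> GU [aF [aF' /(_ _ _ (Stein_cst 1 GU))[_ _ /(_ _ 0%N GU)]]].
rewrite !mul0r add0r.
rewrite (_ : (fun w => U w * _) = fun w => U w * F w).
  by move=> ->; congr Ex; apply/funext => w /=; ring.
by apply/funext => w /=; ring.
Qed.

(** The monic Hermite polynomials for the normal law of variance [v]. *)
Fixpoint hermite (v : R) (a : nat) (x : R) : R :=
  if a is a1.+1 then x * hermite v a1 x -
    (if a1 is a2.+1 then a1%:R * v * hermite v a2 x else 0) else 1.

Lemma hermiteS v a x :
  hermite v a.+1 x = x * hermite v a x - a%:R * v * hermite v a.-1 x.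
Proof. by case: a => [|a] //=; rewrite !mul0r. Qed.

Lemma gderiv_hermite U X v a : G U -> G X ->
  gderiv U (fun w => hermite v a (X w)) (fun w => a%:R * cov U X * hermite v a.-1 (X w)).
Proof.
move=> GU GX.
have [k ak] := ubnP a; elim: k a ak => // k IH [|a] ak.
  by apply: (gderiv_eq (gderiv_cst 1 GU)) => w; rewrite !mul0r.
rewrite (_ : (fun w => hermite v a.+1 (X w)) = fun w => X w * hermite v a (X w) +
   (- (a%:R * v)) * hermite v a.-1 (X w)); last first.
  by apply/funext => w; rewrite hermiteS mulNr.
have d1 := gderivM (gderiv_id GU GX) (IH a ak).
have ak1 : (a.-1 < k)%N by exact: leq_ltn_trans (leq_pred a) ak.
have d2 := gderivZ (- (a%:R * v)) GU (IH a.-1 ak1).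
apply: (gderiv_eq (gderivD GU d1 d2)) => w /=.
case: a {ak ak1 d1 d2} => [|a]; first by rewrite /=; ring.
rewrite [a.+1.-1]/= hermiteS -(natr1 a.+1) -(natr1 a); ring.
Qed.

Definition hmoment (u u' X Z : T -> R) (a b p r : nat) : R :=
  E (fun w => hermite (cov u u) a (u w) * (hermite (cov u' u') b (u' w) *
     (X w ^+ p * Z w ^+ r))).

Lemma hermite_am v a X : G X -> am (fun w => hermite v a (X w)).
Proof. by move=> GX; case: (gderiv_hermite v a GX GX). Qed.

(** Integration by parts with respect to one factor [u] of He_(a+1)(u); the
    term that comes from the derivative of He_a(u) cancels against the recursion
    of Hermite polynomials. *)
Lemma hmoment_rec u u' X Z a b p r : G u -> G u' -> G X -> G Z ->
  hmoment u u' X Z a.+1 b p r =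
    b%:R * cov u u' * hmoment u u' X Z a b.-1 p r +
    p%:R * cov u X * hmoment u u' X Z a b p.-1 r +
    r%:R * cov u Z * hmoment u u' X Z a b p r.-1.
Proof.
move=> Gu Gu' GX GZ.
have aX n := all_momentsX n (G_am GX).
have aZ n := all_momentsX n (G_am GZ).
have au n := hermite_am (cov u u) n Gu.
have au' n := hermite_am (cov u' u') n Gu'.
have dF := gderivM (gderiv_hermite (cov u u) a Gu Gu)
  (gderivM (gderiv_hermite (cov u' u') b Gu Gu')
    (gderivM (gderivX p Gu GX) (gderivX r Gu GZ))).
have := Ex_by_parts Gu dF.
set h := hermite (cov u u); set h' := hermite (cov u' u').
have aM n m k l : am (fun w => h n (u w) * (h' m (u' w) * (X w ^+ k * Z w ^+ l))).
  by do 3 (apply: all_momentsM => //).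
rewrite (_ : (fun w => _ * _ + _ * (_ * _ + _)) = (fun w =>
  (a%:R * cov u u * (h a.-1 (u w) * (h' b (u' w) * (X w ^+ p * Z w ^+ r))) +
   b%:R * cov u u' * (h a (u w) * (h' b.-1 (u' w) * (X w ^+ p * Z w ^+ r)))) +
  (p%:R * cov u X * (h a (u w) * (h' b (u' w) * (X w ^+ p.-1 * Z w ^+ r))) +
   r%:R * cov u Z * (h a (u w) * (h' b (u' w) * (X w ^+ p * Z w ^+ r.-1)))))); last first.
  apply/funext => w; move: (h _ _) (h _ _) (h' _ _) (h' _ _) (X w ^+ _) (X w ^+ _)
    (Z w ^+ _) (Z w ^+ _) => x1 x2 x3 x4 x5 x6 x7 x8; ring.
rewrite !ExD; [|by do ?[apply: all_momentsD|exact: all_momentsZ]..].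
rewrite !ExZ// => H.
rewrite /hmoment -/h -/h'.
rewrite (_ : (fun w => h a.+1 (u w) * _) = (fun w =>
  u w * (h a (u w) * (h' b (u' w) * (X w ^+ p * Z w ^+ r))) -
  a%:R * cov u u * (h a.-1 (u w) * (h' b (u' w) * (X w ^+ p * Z w ^+ r))))); last first.
  apply/funext => w; rewrite /h hermiteS.
  move: (hermite _ _ _) (hermite _ _ _) (h' _ _) (X w ^+ _) (Z w ^+ _) => x1 x2 x3 x5 x7; ring.
rewrite ExB; last 2 first.
- by apply: all_momentsM => //; exact: G_am.
- exact: all_momentsZ.
by rewrite ExZ// H; ring.
Qed.

Lemma hmoment_sym u u' X Z a b p r :
  hmoment u u' X Z a b p r = hmoment u' u X Z b a p r.
Proof. by rewrite /hmoment; congr Ex; apply/funext => w; rewrite mulrCA. Qed.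

End GaussianSpace.

(** * Mixed Hermite moments *)

Section GaussianBounds.
Context d (T : measurableType d) {R : realType} (P : probability T R).
Local Notation E := (Ex P).
Local Notation am := (all_moments P).
Local Notation cov := (covar P).
Variable G : (T -> R) -> Prop.
Hypothesis GG : gaussian_space P G.
Implicit Types (X Y Z U : T -> R).

Lemma even_moment p : exists2 C : R, 0 <= C & forall X, G X ->
  E (fun w => X w ^+ p.*2) = C * E (fun w => X w ^+ 2) ^+ p.
Proof.
elim: p => [|p [C C0 IH]].
  by exists 1 => // X _; rewrite expr0 mulr1 (Ex_cst P 1).
exists (p.*2.+1%:R * C) => [|X GX]; first by rewrite mulr_ge0.
by rewrite doubleS (gs_rec GG)// IH// exprS; ring.
Qed.

Lemma moment_le p : exists2 C : R, 0 <= C & forall X, G X ->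
  E (fun w => X w ^+ 2) <= 1 -> E (fun w => X w ^+ p.*2) <= C.
Proof.
have [C C0 HC] := even_moment p; exists C => // X GX X1; rewrite HC//.
rewrite -[leRHS]mulr1 ler_wpM2l// exprn_ile1//.
by apply: Ex_ge0 => w; exact: sqr_ge0.
Qed.

Lemma mixed_moment_le p r : exists2 C : R, 0 <= C & forall X Z, G X -> G Z ->
  E (fun w => X w ^+ 2) <= 1 -> E (fun w => Z w ^+ 2) <= 1 ->
  `|E (fun w => X w ^+ p * Z w ^+ r)| <= C.
Proof.
have [C C0 HC] := moment_le p; have [D D0 HD] := moment_le r.
exists (C + D) => [|X Z GX GZ X1 Z1]; first exact: addr_ge0.
have aX n := all_momentsX n (gs_am GG GX).
have aZ n := all_momentsX n (gs_am GG GZ).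
apply: le_trans (Ex_norm _) _; first exact: all_momentsM.
apply: (@le_trans _ _ (E (fun w => X w ^+ p.*2 + Z w ^+ r.*2))).
  apply: Ex_le.
  - by apply: all_moments_norm; exact: all_momentsM.
  - exact: all_momentsD.
  - move=> w; rewrite normrM -!mul2n !(mulnC 2%N) !exprM.
    move: (X w ^+ p) (Z w ^+ r) => a b.
    rewrite -[a ^+ 2]real_normK ?num_real// -[b ^+ 2]real_normK ?num_real//.
    move: `|a| `|b| (normr_ge0 a) (normr_ge0 b) => {}a {}b a0 b0.
    have := sqr_ge0 (a - b); have := sqr_ge0 a; have := sqr_ge0 b; lra.
rewrite ExD//; apply: lerD; [exact: HC|exact: HD].
Qed.

(** The size of a mixed moment of He_a(u) He_b(u') when all covariances are at
    most of order [k].  Either each of the a + b factors is paired with [X] or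
    [Z], or a pairing of [u] with [u'] contributes [rho], and at least
    max(a, b) - 1 other covariances occur. *)
Definition hbound (k rho : R) (a b : nat) : R :=
  if a is 0 then k ^+ b else k ^+ (a + b) + `|rho| * k ^+ (maxn a b).-1.

Definition small_cov (k : R) u u' X Z :=
  [/\ 0 <= k <= 1, E (fun w => X w ^+ 2) <= 1, E (fun w => Z w ^+ 2) <= 1,
    `|cov u u'| <= k & [/\ `|cov u X| <= 2 * k, `|cov u Z| <= 2 * k,
    `|cov u' X| <= 2 * k & `|cov u' Z| <= 2 * k]].

Lemma scaled_term_le (p : nat) (e c x D h k : R) : `|c| <= e * k -> `|x| <= D * h ->
  `|p%:R * c * x| <= p%:R * (e * (D * (k * h))).
Proof.
move=> ck xD; rewrite !normrM normr_nat -mulrA ler_wpM2l//.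
have -> : e * (D * (k * h)) = (e * k) * (D * h) by ring.
exact: ler_pM.
Qed.

(** Induction on [a], and on [b] when [a = 0]: each term of [hmoment_rec] has
    one covariance and a moment of smaller degree. *)
Lemma hmoment_le a b p r : exists2 C : R, 0 <= C & forall k u u' X Z,
  G u -> G u' -> G X -> G Z -> small_cov k u u' X Z ->
  `|hmoment P u u' X Z a b p r| <= C * hbound k (cov u u') a b.
Proof.
elim: a b p r => [|a IHa] b p r.
  elim: b p r => [|b IHb] p r.
    have [C C0 HC] := mixed_moment_le p r.
    exists C => // k u u' X Z Gu Gu' GX GZ [_ X1 Z1 _ _].
    rewrite /hbound expr0 mulr1 /hmoment.
    rewrite (_ : (fun w => _) = fun w => X w ^+ p * Z w ^+ r); first exact: HC.
    by apply/funext => w; rewrite /= !mul1r.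
  have [C1 C10 HC1] := IHb p.-1 r; have [C2 C20 HC2] := IHb p r.-1.
  exists (p%:R * 2 * C1 + r%:R * 2 * C2).
    by rewrite addr_ge0// !mulr_ge0.
  move=> k u u' X Z Gu Gu' GX GZ sc.
  have [/andP[k0 k1] X1 Z1 uu' [uX uZ u'X u'Z]] := sc.
  rewrite hmoment_sym (hmoment_rec GG)// !mul0r add0r -!(hmoment_sym P u u').
  have {}HC1 := HC1 _ _ _ _ _ Gu Gu' GX GZ sc; have {}HC2 := HC2 _ _ _ _ _ Gu Gu' GX GZ sc.
  apply: le_trans (ler_normD _ _) _; rewrite mulrDl; apply: lerD.
    rewrite /hbound exprS -[leRHS]mulrA -[leRHS]mulrA; exact: scaled_term_le.
  rewrite /hbound exprS -[leRHS]mulrA -[leRHS]mulrA; exact: scaled_term_le.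
have [C1 C10 HC1] := IHa b.-1 p r; have [C2 C20 HC2] := IHa b p.-1 r.
have [C3 C30 HC3] := IHa b p r.-1.
exists (b%:R * (2 * C1) + p%:R * 2 * C2 + r%:R * 2 * C3).
  by rewrite !addr_ge0// !mulr_ge0.
move=> k u u' X Z Gu Gu' GX GZ sc.
have [/andP[k0 k1] X1 Z1 uu' [uX uZ u'X u'Z]] := sc.
rewrite (hmoment_rec GG)//.
have {}HC1 := HC1 _ _ _ _ _ Gu Gu' GX GZ sc; have {}HC2 := HC2 _ _ _ _ _ Gu Gu' GX GZ sc.
have {}HC3 := HC3 _ _ _ _ _ Gu Gu' GX GZ sc.
have kX m n : (n <= m)%N -> k ^+ m <= k ^+ n by move=> nm; rewrite ler_wiXn2l.
have kS n : k * k ^+ n = k ^+ n.+1 by rewrite exprS.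
have h2 : k * hbound k (cov u u') a b <= hbound k (cov u u') a.+1 b.
  case: {+}a => [|a'] /=; first by rewrite kS lerDl mulr_ge0// exprn_ge0.
  rewrite mulrDr; apply: lerD; first by rewrite kS; apply: kX; clear; lia.
  by rewrite mulrCA kS; apply: ler_wpM2l; [exact: normr_ge0|apply: kX; clear; lia].
have h1 : (0 < b)%N -> `|cov u u'| * hbound k (cov u u') a b.-1 <= 2 * hbound k (cov u u') a.+1 b.
  case: b {HC1 HC2 HC3 IHa h2} => // b' _ /=.
  have pn n : 0 <= k ^+ n by exact: exprn_ge0.
  case: {+}a => [|a'] /=.
    rewrite maxnSS max0n/=.
    have : 0 <= `|cov u u'| * k ^+ b' by rewrite mulr_ge0.
    by have := pn (1 + b'.+1)%N; lra.
  rewrite maxnSS/= mulrDr.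
  have i1 : `|cov u u'| * k ^+ (a'.+1 + b') <= `|cov u u'| * k ^+ (maxn a'.+1 b').
    by apply: ler_wpM2l; [exact: normr_ge0|apply: kX; clear; lia].
  have i2 : `|cov u u'| * (`|cov u u'| * k ^+ (maxn a'.+1 b').-1) <=
     `|cov u u'| * k ^+ (maxn a'.+1 b').
    apply: ler_wpM2l; first exact: normr_ge0.
    apply: le_trans (ler_wpM2r (pn _) uu') _.
    by rewrite kS; apply: kX; clear; lia.
  by have := pn (a'.+2 + b'.+1)%N; lra.
have -> (h : R) : (b%:R * (2 * C1) + p%:R * 2 * C2 + r%:R * 2 * C3) * h =
  b%:R * (2 * C1) * h + p%:R * 2 * C2 * h + r%:R * 2 * C3 * h by ring.
apply: le_trans (ler_normD _ _) _; apply: lerD.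
  apply: le_trans (ler_normD _ _) _; apply: lerD.
- case: (posnP b) => [->|b0]; first by rewrite !mul0r normr0.
  rewrite !normrM normr_nat -!mulrA ler_wpM2l//.
  apply: (@le_trans _ _ (`|cov u u'| * (C1 * hbound k (cov u u') a b.-1))).
    exact: ler_wpM2l.
  have {}h1 := ler_wpM2l C10 (h1 b0); apply: le_trans (le_trans _ h1) _.
    by rewrite mulrCA.
  by rewrite le_eqVlt; apply/orP; left; apply/eqP; ring.
- apply: le_trans (scaled_term_le p uX HC2) _.
  rewrite -[leRHS]mulrA -[leRHS]mulrA; do 3 (apply: ler_wpM2l => //).
- apply: le_trans (scaled_term_le r uZ HC3) _.
  rewrite -[leRHS]mulrA -[leRHS]mulrA; do 3 (apply: ler_wpM2l => //).
Qed.
End GaussianBounds.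

(** * Fractional powers *)

Section PowR.
Context {R : realType}.
Implicit Types (x y p : R).

(** For [z <= x + y], concavity gives [z / (x + y) <= (z / (x + y)) `^ p]; add
    the cases [z = x] and [z = y]. *)
Lemma powR_subadditive x y p : 0 <= x -> 0 <= y -> 0 < p <= 1 ->
  (x + y) `^ p <= x `^ p + y `^ p.
Proof.
move=> x0 y0 /andP[p0 p1].
have [xy0|xy] := eqVneq (x + y) 0.
  by rewrite xy0 powR0 ?gt_eqF// addr_ge0// powR_ge0.
have xy0 : 0 < x + y by rewrite lt_neqAle eq_sym xy addr_ge0.
have H z : 0 <= z -> z <= x + y -> z / (x + y) * (x + y) `^ p <= z `^ p.
  rewrite le_eqVlt => /predU1P[<-|z0 zxy].
    by rewrite !mul0r powR_ge0.
  have : z / (x + y) <= (z / (x + y)) `^ p.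
    by apply: ger1_powR => //; rewrite divr_gt0// ler_pdivrMr// mul1r.
  have -> : (z / (x + y)) `^ p = z `^ p / (x + y) `^ p.
    rewrite powRM ?invr_ge0 ?ltW//; congr (_ * _).
    by rewrite -powR_inv1 ?ltW// -powRrM mulN1r powRN.
  move=> h; apply: le_trans (ler_wpM2r (powR_ge0 _ _) h) _.
  by rewrite mulfVK// gt_eqF// powR_gt0.
have hx := H x x0; have hy := H y y0.
rewrite -[leLHS]mul1r -[X in X * _ <= _](divff xy) mulrDl mulrDl.
by apply: lerD; [apply: hx|apply: hy]; rewrite ?lerDl ?lerDr.
Qed.

Lemma powR_dist_le x y p : 0 <= x -> 0 <= y -> 0 < p <= 1 ->
  `|x `^ p - y `^ p| <= `|x - y| `^ p.
Proof.
move=> x0 y0 p01; wlog yx : x y x0 y0 / y <= x.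
  by move=> W; have [|/ltW] := leP y x; [exact: W|rewrite distrC (distrC x); exact: W].
have /andP[p0 _] := p01.
rewrite !ger0_norm ?subr_ge0//; last by rewrite ge0_ler_powR// ltW.
rewrite lerBlDr -{1}(subrK y x); apply: powR_subadditive => //.
by rewrite subr_ge0.
Qed.

Lemma powR_midpoint_concave x y p : 0 <= x -> 0 <= y -> 0 < p <= 1 ->
  x `^ p + y `^ p <= 2 * ((x + y) / 2) `^ p.
Proof.
move=> x0 y0 /andP[p0 p1].
have ip1 : 1 <= p^-1 by rewrite invf_ge1.
have h0 : 0 <= 2^-1 :> R by rewrite invr_ge0.
have h1 : 2^-1 <= 1 :> R by rewrite invf_le1// ler1n.
have h := @convex_powR R p^-1 ip1 (Itv01 h0 h1) (x `^ p) (y `^ p).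
have : ((x `^ p + y `^ p) / 2) `^ p^-1 <= (x + y) / 2.
  have xp : x `^ p \in (`[0, +oo[%classic : set R) by rewrite inE/= in_itv/= powR_ge0.
  have yp : y `^ p \in (`[0, +oo[%classic : set R) by rewrite inE/= in_itv/= powR_ge0.
  have := h xp yp.
  rewrite convRE [X in X `^ _ <= _ -> _]convRE/= -!powRrM !divff ?gt_eqF// !powRr1//.
  have -> : 2^-1 * x `^ p + unstable.onem 2^-1 * y `^ p = (x `^ p + y `^ p) / 2.
    by rewrite /unstable.onem; lra.
  by rewrite /unstable.onem => hh; apply: le_trans hh _; lra.
have s0 : 0 <= (x `^ p + y `^ p) / 2 by rewrite divr_ge0// addr_ge0// powR_ge0.
move=> /(fun h => ge0_ler_powR (ltW p0) (powR_ge0 _ _) (divr_ge0 (addr_ge0 x0 y0) (ler0n R 2)) h).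
rewrite -powRrM mulVf ?gt_eqF// powRr1// => h2.
by rewrite mulrC -ler_pdivrMr.
Qed.

End PowR.

(** * Covariances of fractional Brownian motion *)

Section CovBilinear.
Context d (T : measurableType d) {R : realType} (P : probability T R).
Local Notation cov := (covar P).
Implicit Types X Y Z : T -> R.

Lemma covC X Y : cov X Y = cov Y X.
Proof. by rewrite /covar; congr Ex; apply/funext => w; rewrite mulrC. Qed.

Lemma covBl X Y Z : all_moments P X -> all_moments P Y -> all_moments P Z ->
  cov (fun w => X w - Y w) Z = cov X Z - cov Y Z.
Proof.
move=> aX aY aZ; rewrite /covar -ExB; [|exact: all_momentsM..].
by congr Ex; apply/funext => w; rewrite mulrBl.
Qed.

Lemma covBr X Y Z : all_moments P X -> all_moments P Y -> all_moments P Z ->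
  cov X (fun w => Y w - Z w) = cov X Y - cov X Z.
Proof. by move=> aX aY aZ; rewrite covC covBl// !(covC X). Qed.

End CovBilinear.

Section FractionalBrownianMotion.
Context d (T : measurableType d) {R : realType} (P : probability T R) (H : R)
  (B : R -> {RV P >-> R}).
Hypothesis H0 : 0 < H.
Hypothesis H12 : H < 2^-1.
Hypothesis Bfbm : fractional_brownian_motion H B.
Local Notation E := (Ex P).
Local Notation cov := (covar P).

Lemma two_hurst_range : 0 < 2 * H <= 1.
Proof.
apply/andP; split; first by rewrite mulr_gt0.
by move: H12; lra.
Qed.

(** The Gaussian space generated by the process. *)
Definition gspan (X : T -> R) := exists2 s : seq (R * R),
  (forall p, p \in s -> p.2 \in `[0, 1]) & X = fun w => \sum_(p <- s) p.1 * B p.2 w.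

Lemma gspan_B t : t \in `[0, 1] -> gspan (B t).
Proof.
move=> t01; exists [:: (1, t)].
  by move=> p; rewrite inE => /eqP ->.
by apply/funext => w; rewrite big_seq1 mul1r.
Qed.

Lemma gspan_measurable X : gspan X -> measurable_fun setT X.
Proof.
move=> [s _ ->]; apply: measurable_sum => p.
by apply: measurable_funM.
Qed.

Lemma gspan_gaussian X : gspan X -> gaussian P X.
Proof.
move=> [s s01 ->]; have [gB _ _ _] := Bfbm.
have := gB (size s) (fun i => (tnth (in_tuple s) i).1) (fun i => (tnth (in_tuple s) i).2).
rewrite (_ : (fun w => \sum_(p <- s) _) = (fun w => \sum_(i < size s)
  (tnth (in_tuple s) i).1 * B (tnth (in_tuple s) i).2 w)).
  by apply => i; apply: s01; exact: mem_tnth.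
by apply/funext => w; rewrite big_tnth.
Qed.

Lemma gspan_am X : gspan X -> all_moments P X.
Proof.
by move=> gX; apply: gaussian_all_moments; [exact: gspan_measurable|exact: gspan_gaussian].
Qed.

Lemma fbm_mean t : t \in `[0, 1] -> E (B t) = 0.
Proof.
move=> t01; have [_ /(_ t t01) m _ _] := Bfbm.
by move: m; rewrite expectation_def => m; rewrite /Ex /Rintegral m.
Qed.

Lemma gspan_mean X : gspan X -> E X = 0.
Proof.
move=> [s s01 ->].
rewrite (_ : (fun w => _) = fun w => \sum_(p <- s | p \in s) p.1 * B p.2 w); last first.
  by apply/funext => w; rewrite [LHS]big_seq.
rewrite Ex_sum; last first.
  by move=> p ps; apply: all_momentsZ; apply: gspan_am; apply: gspan_B; exact: s01.
rewrite big1// => p ps; rewrite ExZ ?fbm_mean ?mulr0//; first exact: s01.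
by apply: gspan_am; apply: gspan_B; exact: s01.
Qed.

Lemma gspan_lin (t : R) X Y : gspan X -> gspan Y -> gspan (fun w => Y w + t * X w).
Proof.
move=> [s s01 ->] [s' s'01 ->].
exists (s' ++ [seq (t * p.1, p.2) | p <- s]).
  move=> p; rewrite mem_cat => /orP[/s'01//|/mapP[q qs ->]]; exact: s01 qs.
apply/funext => w; rewrite big_cat big_map/= mulr_sumr; congr (_ + _).
by apply: eq_bigr => p _; rewrite mulrA.
Qed.

Lemma gspan_space : gaussian_space P gspan.
Proof.
split.
- exact: gspan_lin.
- exact: gspan_am.
- exact: gspan_mean.
- move=> X N gX; apply: gaussian_Ex_rec.
  + exact: gspan_measurable.
  + exact: gspan_gaussian.
  + exact: gspan_mean.
Qed.

Lemma gspan_incr s t : s \in `[0, 1] -> t \in `[0, 1] ->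
  gspan (fun w => B t w - B s w).
Proof.
move=> s01 t01; have := gspan_lin (-1) (gspan_B s01) (gspan_B t01).
by rewrite (_ : (fun w => _) = fun w => B t w - B s w)//; apply/funext => w; rewrite mulN1r.
Qed.

Lemma am_B t : t \in `[0, 1] -> all_moments P (B t).
Proof. by move=> t01; apply: gspan_am; exact: gspan_B. Qed.

Lemma cov_B s t : s \in `[0, 1] -> t \in `[0, 1] -> cov (B s) (B t) = fbm_cov H s t.
Proof.
move=> s01 t01; have [_ m /(_ s t s01 t01) c _] := Bfbm.
apply: EFin_inj; rewrite -c unlock (m s s01) (m t t01)/= unlock.
rewrite -integral_Ex; last by apply: all_momentsM; exact: am_B.
by apply: eq_integral => w _ /=; rewrite !fctE/= !subr0.
Qed.

Lemma cov_incr s t r q : s \in `[0, 1] -> t \in `[0, 1] -> r \in `[0, 1] -> q \in `[0, 1] ->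
  cov (fun w => B t w - B s w) (fun w => B r w - B q w) =
  2^-1 * (`|t - q| `^ (2 * H) - `|t - r| `^ (2 * H) + `|s - r| `^ (2 * H) - `|s - q| `^ (2 * H)).
Proof.
move=> s01 t01 r01 q01.
have aB := am_B.
rewrite covBl; [|exact: aB|exact: aB|by apply: all_momentsB; exact: aB].
rewrite !covBr; [|exact: aB..].
rewrite !cov_B// /fbm_cov !(distrC q) !(distrC r); ring.
Qed.

Lemma incr_var s t : s \in `[0, 1] -> t \in `[0, 1] ->
  E (fun w => (B t w - B s w) ^+ 2) = `|t - s| `^ (2 * H).
Proof.
move=> s01 t01; have := cov_incr s01 t01 t01 s01.
rewrite !subrr !normr0 powR0; last by have /andP[/gt_eqF ->] := two_hurst_range.
rewrite (distrC s) /covar => h.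
rewrite (_ : (fun w => _) = fun w => (B t w - B s w) * (B t w - B s w)).
  by rewrite h; field.
by apply/funext => w; rewrite expr2.
Qed.

(** As x |-> x^(2H) is subadditive, the two differences of powers of distances
    to a fixed time in [cov_incr] are at most |t - s|^(2H). *)
Lemma cov_incr_le s t r q : s \in `[0, 1] -> t \in `[0, 1] -> r \in `[0, 1] -> q \in `[0, 1] ->
  `|cov (fun w => B t w - B s w) (fun w => B r w - B q w)| <= `|t - s| `^ (2 * H).
Proof.
move=> s01 t01 r01 q01; rewrite cov_incr//.
have h (x : R) : `| `|t - x| `^ (2 * H) - `|s - x| `^ (2 * H)| <= `|t - s| `^ (2 * H).
  apply: le_trans (powR_dist_le _ _ two_hurst_range) _ => //.
  have /andP[p0 _] := two_hurst_range.
  apply: (ge0_ler_powR (ltW p0)); rewrite ?nnegrE//.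
  have -> : t - s = (t - x) - (s - x) by ring.
  exact: ler_dist_dist.
have := h q; have := h r.
rewrite !ler_norml => /andP[a1 a2] /andP[b1 b2].
by apply/andP; split; lra.
Qed.

Section grid.
Definition step_variance (n : nat) : R := n%:R `^ (- (2 * H)).

Variables (n : nat).
Hypothesis n0 : (0 < n)%N.
Local Notation step_var := (step_variance n).

Lemma grid01 k : (k <= n)%N -> k%:R / n%:R \in (`[0, 1] : interval R).
Proof.
move=> kn; rewrite in_itv/= divr_ge0//= ler_pdivrMr ?ltr0n// mul1r ler_nat.
exact: kn.
Qed.

Lemma step_variance_gt0 : 0 < step_var.
Proof. by rewrite powR_gt0// ltr0n. Qed.

Lemma step_variance_le1 : step_var <= 1.
Proof.
have /andP[p0 _] := two_hurst_range.
by rewrite -(powRr0 (n%:R : R)); apply: ler_powR; rewrite ?ler1n ?oppr_le0 ?ltW.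
Qed.

Lemma grid_diff (i j : nat) : (j <= i)%N ->
  `|i%:R / n%:R - j%:R / n%:R| `^ (2 * H) = (i - j)%:R `^ (2 * H) * step_var.
Proof.
move=> ji; rewrite -mulrBl -natrB// ger0_norm ?divr_ge0//.
rewrite powRM ?invr_ge0//; congr (_ * _).
by rewrite -powR_inv1// -powRrM mulN1r.
Qed.

Local Notation u := (increment B n).

Lemma gspan_grid_incr k : (k < n)%N -> gspan (u k).
Proof. by move=> kn; apply: gspan_incr; apply: grid01 => //; exact: ltnW. Qed.

Lemma grid_incr_var k : (k < n)%N -> E (fun w => u k w ^+ 2) = step_var.
Proof.
move=> kn; rewrite /increment incr_var ?grid01//; last exact: ltnW.
by rewrite grid_diff// subSnn powR1 mul1r.
Qed.

Lemma cov_grid_incr_self k : (k < n)%N -> cov (u k) (u k) = step_var.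
Proof.
by move=> kn; rewrite -(grid_incr_var kn) /covar; congr Ex; apply/funext => w; rewrite expr2.
Qed.

Lemma cov_grid_incr_le k i j : (k < n)%N -> (i <= n)%N -> (j <= n)%N ->
  `|cov (u k) (fun w => B (i%:R / n%:R) w - B (j%:R / n%:R) w)| <= step_var.
Proof.
move=> kn ni nj; have := cov_incr_le (grid01 (ltnW kn)) (grid01 kn) (grid01 ni) (grid01 nj).
by rewrite grid_diff// subSnn powR1 mul1r.
Qed.

(** Negative correlation expresses that x |-> x^(2H) is midpoint concave. *)
Lemma cov_grid_incr_le0 i j : (i < n)%N -> (j < n)%N -> i != j -> cov (u i) (u j) <= 0.
Proof.
move=> iN jN; wlog ij : i j iN jN / (j < i)%N.
  move=> W; rewrite neq_ltn => /orP[ij|ji]; last by apply: W; rewrite // gt_eqF.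
  by rewrite covC; apply: W; rewrite // gt_eqF.
move=> _; rewrite /increment cov_incr ?grid01// 1?ltnW//.
rewrite !grid_diff//; try by [apply: ltnW|apply: ltnW; apply: ltnW].
have -> (a b c e : R) : 2^-1 * (a * step_var - b * step_var + c * step_var - e * step_var) =
  2^-1 * (a - b + c - e) * step_var by ring.
rewrite mulr_le0_ge0 ?(ltW step_variance_gt0)//.
rewrite mulr_ge0_le0 ?invr_ge0//.
have -> : (i.+1 - j.+1 = i - j)%N by [].
have e1 : (i.+1 - j = (i - j).+1)%N by rewrite subSn// ltnW.
have e2 : (i - j = (i - j.+1).+1)%N by rewrite subnSK.
rewrite e1 e2; set m := (i - j.+1)%N.
have := powR_midpoint_concave (ler0n R m.+2) (ler0n R m) two_hurst_range.
have -> : (m.+2%:R + m%:R) / 2 = m.+1%:R :> R by rewrite -(natr1 m.+1) -(natr1 m); field.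
lra.
Qed.

(** All covariances but the diagonal one are nonpositive, so the sum of their
    absolute values is twice the variance minus the covariance of [u i] with
    [B 1 - B 0]. *)
Lemma sum_cov_grid_incr_le i : (i < n)%N -> \sum_(j < n) `|cov (u i) (u j)| <= 3 * step_var.
Proof.
move=> iN.
have e (j : 'I_n) : `|cov (u i) (u j)| = (if j == Ordinal iN then 2 * step_var else 0) - cov (u i) (u j).
  case: eqP => [->|/eqP ji]; first by rewrite cov_grid_incr_self// (ger0_norm (ltW step_variance_gt0)); ring.
  rewrite sub0r ler0_norm//; apply: cov_grid_incr_le0 => //.
  by apply: contra ji => /eqP ij; apply/eqP/val_inj.
rewrite (eq_bigr _ (fun j _ => e j)) sumrB -big_mkcond/= big_pred1_eq.
have -> : \sum_(j < n) cov (u i) (u j) =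
   cov (u i) (fun w => B (n%:R / n%:R) w - B (0%:R / n%:R) w).
  have aB k : (k <= n)%N -> all_moments P (B (k%:R / n%:R)) by move=> kn; apply: am_B; exact: grid01.
  have aui : all_moments P (u i) by apply: gspan_am; exact: gspan_grid_incr.
  rewrite covBr//; [|exact: aB..].
  pose F k := cov (u i) (B (k%:R / n%:R)).
  rewrite -[RHS]/(F n - F 0%N) -telescope_sumr// big_mkord.
  apply: eq_bigr => j _; rewrite /F -covBr//; apply: aB => //; exact: ltnW.
have := cov_grid_incr_le iN (leqnn n) (leq0n n).
by rewrite ler_norml => /andP[h _]; lra.
Qed.

End grid.
End FractionalBrownianMotion.

(** * Block sums of Hermite polynomials of the increments *)

Lemma sqr_sum_le {R : realType} N (x : 'I_N -> R) :
  (\sum_i x i) ^+ 2 <= N%:R * \sum_i x i ^+ 2.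
Proof.
rewrite expr2 mulr_suml.
apply: (@le_trans _ _ (\sum_i \sum_j 2^-1 * (x i ^+ 2 + x j ^+ 2))).
  apply: ler_sum => i _; rewrite mulr_sumr; apply: ler_sum => j _.
  by have := sqr_ge0 (x i - x j); lra.
under eq_bigr do rewrite -mulr_sumr big_split/= sumr_const card_ord.
rewrite -mulr_sumr big_split/= sumr_const card_ord sumrMnl mulr_natl.
by move: (\sum_(i < N) _) => S; move: (S *+ N) => a; lra.
Qed.

Section BlockSums.
Context d (T : measurableType d) {R : realType} (P : probability T R) (H : R)
  (B : R -> {RV P >-> R}).
Hypothesis H0 : 0 < H.
Hypothesis H12 : H < 2^-1.
Hypothesis Bfbm : fractional_brownian_motion H B.
Local Notation E := (Ex P).
Local Notation cov := (covar P).
Local Notation am := (all_moments P).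
Local Notation kap n := (step_variance H n).

Definition incr_hermite3 n k (w : T) := hermite (kap n) 3 (increment B n k w).
Local Notation h3 := incr_hermite3.
Definition grid_value n k (w : T) := B (k%:R / n%:R) w.

Lemma hermite3E n k w : h3 n k w = increment B n k w ^+ 3 - 3 * kap n * increment B n k w.
Proof. by rewrite /incr_hermite3 /=; ring. Qed.

Lemma am_grid_incr n k : (0 < n)%N -> (k < n)%N -> am (increment B n k).
Proof. by move=> n0 kn; apply: (gspan_am Bfbm); exact: gspan_grid_incr. Qed.

Lemma am_grid_value n k : (0 < n)%N -> (k <= n)%N -> am (grid_value n k).
Proof. by move=> n0 kn; apply: (gspan_am Bfbm); apply: gspan_B; exact: grid01. Qed.

Lemma am_hermite3 n k : (0 < n)%N -> (k < n)%N -> am (h3 n k).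
Proof. move=> n0 kn; apply: (hermite_am (gspan_space Bfbm)); exact: gspan_grid_incr. Qed.

Lemma grid_incr_moment p : exists2 C : R, 0 <= C & forall n k, (0 < n)%N -> (k < n)%N ->
  E (fun w => increment B n k w ^+ p.*2) = C * kap n ^+ p.
Proof.
have [C C0 HC] := even_moment (gspan_space Bfbm) p; exists C => // n k n0 kn.
by rewrite HC; [rewrite (grid_incr_var H0 H12 Bfbm n0 kn)|exact: gspan_grid_incr].
Qed.

Lemma hermite3_moment4 : exists2 C : R, 0 <= C & forall n k, (0 < n)%N -> (k < n)%N ->
  E (fun w => h3 n k w ^+ 4) <= C * kap n ^+ 6.
Proof.
have [C6 C60 HC6] := grid_incr_moment 6; have [C2 C20 HC2] := grid_incr_moment 2.
exists (8 * (C6 + 81 * C2)); first by rewrite mulr_ge0// addr_ge0// mulr_ge0.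
move=> n k n0 kn; have au := am_grid_incr n0 kn; have ah := am_hermite3 n0 kn.
have k0 := step_variance_gt0 H n0.
apply: (@le_trans _ _ (E (fun w => 8 * (increment B n k w ^+ 12 +
    81 * kap n ^+ 4 * increment B n k w ^+ 4)))).
  apply: Ex_le; first exact: all_momentsX.
    apply: all_momentsZ; apply: all_momentsD; first exact: all_momentsX.
    by apply: all_momentsZ; exact: all_momentsX.
  move=> w; rewrite hermite3E; move: (increment B n k w) => u.
  have -> : u ^+ 12 = (u ^+ 3) ^+ 4 by rewrite -exprM.
  have -> : 81 * kap n ^+ 4 * u ^+ 4 = (3 * kap n * u) ^+ 4 by ring.
  move: (u ^+ 3) (3 * kap n * u) => a b.
  have h1 := sqr_ge0 (a + b); have h2 := sqr_ge0 (a - b).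
  have h3' : (a - b) ^+ 2 <= 2 * (a ^+ 2 + b ^+ 2) by lra.
  have -> : (a - b) ^+ 4 = ((a - b) ^+ 2) ^+ 2 by rewrite -exprM.
  apply: (@le_trans _ _ ((2 * (a ^+ 2 + b ^+ 2)) ^+ 2)).
    by rewrite lerXn2r// nnegrE ?mulr_ge0 ?addr_ge0 ?sqr_ge0.
  have := sqr_ge0 (a ^+ 2 - b ^+ 2); have -> : a ^+ 4 = (a ^+ 2) ^+ 2 by rewrite -exprM.
  have -> : b ^+ 4 = (b ^+ 2) ^+ 2 by rewrite -exprM.
  by lra.
rewrite ExZ; last first.
  apply: all_momentsD; first exact: all_momentsX.
  by apply: all_momentsZ; exact: all_momentsX.
rewrite ExD; [|exact: all_momentsX|by apply: all_momentsZ; exact: all_momentsX].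
rewrite ExZ; last exact: all_momentsX.
rewrite (HC6 n k)// (HC2 n k)//.
by rewrite le_eqVlt; apply/orP; left; apply/eqP; ring.
Qed.

Section block.
Variables (n k e L : nat).
Hypothesis n0 : (0 < n)%N.
Hypothesis kn : (k <= n)%N.
Hypothesis e1 : (e <= 1)%N.
Hypothesis L0 : (0 < L)%N.

(** The increment from the left end of the block of [L] steps to which [j]
    belongs.  The shift [e], 0 or 1, reaches both ends of the [j]-th step. *)
Definition block_incr (j : nat) (w : T) := grid_value n (j + e) w - grid_value n (j %/ L * L) w.

Lemma block_index_lt (j : 'I_k) : (j < n)%N.
Proof. exact: leq_trans (ltn_ord j) kn. Qed.

Lemma block_index_le (j : 'I_k) : (j + e <= n)%N.
Proof. by have := block_index_lt j; case: e e1 => [|[|]]// _; lia. Qed.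

Lemma block_left_le (j : 'I_k) : (j %/ L * L <= n)%N.
Proof. exact: leq_trans (leq_trunc_div _ _) (ltnW (block_index_lt j)). Qed.

Lemma gspan_block_incr (j : 'I_k) : gspan B (block_incr j).
Proof.
by apply: gspan_incr; apply: grid01 => //; [exact: block_left_le|exact: block_index_le].
Qed.

Lemma am_block_incr (j : 'I_k) : am (block_incr j).
Proof. exact: (gspan_am Bfbm (gspan_block_incr j)). Qed.

Lemma block_incr_var (j : 'I_k) : E (fun w => block_incr j w ^+ 2) =
  `|(j + e)%:R / n%:R - (j %/ L * L)%:R / n%:R| `^ (2 * H).
Proof.
rewrite /block_incr /grid_value (incr_var H0 H12 Bfbm)//; apply: grid01 => //;
  [exact: block_left_le|exact: block_index_le].
Qed.

Lemma block_incr_var_le (j : 'I_k) : E (fun w => block_incr j w ^+ 2) <= (L%:R / n%:R) `^ (2 * H).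
Proof.
have /andP[p0 _] := two_hurst_range H0 H12.
rewrite block_incr_var; apply: (ge0_ler_powR (ltW p0)); rewrite ?nnegrE//.
rewrite -mulrBl normrM (ger0_norm (_ : 0 <= n%:R^-1)) ?invr_ge0// ler_wpM2r ?invr_ge0//.
have h : (j %/ L * L <= j + e)%N by apply: leq_trans (leq_trunc_div _ _) (leq_addr _ _).
rewrite -natrB// ger0_norm// ler_nat.
have := ltn_pmod j L0; have := divn_eq j L.
move: e e1 (j %/ L * L)%N (j %% L)%N => e' e'1 a b; move: e'1; clear; lia.
Qed.

Lemma block_incr_var_le1 (j : 'I_k) : E (fun w => block_incr j w ^+ 2) <= 1.
Proof.
have /andP[p0 _] := two_hurst_range H0 H12.
have <- : (1 : R) `^ (2 * H) = 1 by rewrite powR1.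
rewrite block_incr_var; apply: (ge0_ler_powR (ltW p0)); rewrite ?nnegrE//.
have := @grid01 R n n0 _ (block_index_le j); have := @grid01 R n n0 _ (block_left_le j).
rewrite !in_itv/= => /andP[a1 a2] /andP[b1 b2].
by rewrite ler_norml; apply/andP; split; lra.
Qed.

Lemma block_small_cov (i j : 'I_k) :
  small_cov P (kap n) (increment B n i) (increment B n j) (block_incr i) (block_incr j).
Proof.
have k0 := step_variance_gt0 H n0.
have c1 (l m : 'I_k) : `|cov (increment B n l) (block_incr m)| <= 2 * kap n.
  have := cov_grid_incr_le H0 H12 Bfbm n0 (block_index_lt l) (block_index_le m) (block_left_le m).
  by move=> h; apply: le_trans h _; lra.
split; [|exact: block_incr_var_le1..| |by split].
- by rewrite (ltW k0)/=; exact: step_variance_le1.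
- exact: (cov_grid_incr_le H0 H12 Bfbm n0 (block_index_lt i) (block_index_lt j) (ltnW (block_index_lt j))).
Qed.

Definition block_sum p (m : nat) (w : T) := \sum_(j < k | (j %/ L)%N == m) block_incr j w ^+ p * h3 n j w.

Lemma am_block_sum p m : am (block_sum p m).
Proof.
apply: all_moments_sum => j _; apply: all_momentsM; first by apply: all_momentsX; exact: am_block_incr.
by apply: am_hermite3 => //; exact: block_index_lt.
Qed.

Let M := (n %/ L).+1.

Lemma block_lt (j : 'I_k) : (j %/ L < M)%N.
Proof. by rewrite ltnS leq_div2r// ltnW// block_index_lt. Qed.

Lemma sum_blocks (F : 'I_k -> R) :
  \sum_j F j = \sum_(m < M) \sum_(j < k | (j %/ L)%N == m) F j.
Proof.
rewrite (partition_big (fun j => Ordinal (block_lt j)) xpredT)//=.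
Qed.

Lemma block_sum_moment2 p m : E (fun w => block_sum p m w ^+ 2) =
  \sum_(i < k | (i %/ L)%N == m) \sum_(j < k | (j %/ L)%N == m)
    hmoment P (increment B n i) (increment B n j) (block_incr i) (block_incr j) 3 3 p p.
Proof.
have aXh (i : 'I_k) : am (fun w => block_incr i w ^+ p * h3 n i w).
  apply: all_momentsM; first by apply: all_momentsX; exact: am_block_incr.
  by apply: am_hermite3 => //; exact: block_index_lt.
rewrite (_ : (fun w => _) = (fun w => \sum_(i < k | (i %/ L)%N == m)
  \sum_(j < k | (j %/ L)%N == m) (block_incr i w ^+ p * h3 n i w) * (block_incr j w ^+ p * h3 n j w))); last first.
  apply/funext => w; rewrite expr2 /block_sum mulr_suml; apply: eq_bigr => i _.
  by rewrite mulr_sumr.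
rewrite Ex_sum; last first.
  by move=> i _; apply: all_moments_sum => j _; exact: all_momentsM.
apply: eq_bigr => i _; rewrite Ex_sum; last by move=> j _; exact: all_momentsM.
apply: eq_bigr => j _; rewrite /hmoment !(cov_grid_incr_self H0 H12 Bfbm n0) ?block_index_lt//.
congr Ex; apply/funext => w; rewrite /incr_hermite3.
by move: (hermite _ _ _) (hermite _ _ _) (block_incr i w ^+ p) (block_incr j w ^+ p) => a b c f; ring.
Qed.

End block.

(** The square of each block sum is a double sum of mixed Hermite moments with
    a = b = 3, which are of order kap^6 + |cov(u_i, u_j)| kap^2.  The first part
    is summed over all pairs, the second by [sum_cov_grid_incr_le]. *)
Lemma block_sums_le p : exists2 C : R, 0 <= C & forall n k e L,
  (0 < n)%N -> (k <= n)%N -> (e <= 1)%N -> (0 < L)%N ->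
  \sum_(m < (n %/ L).+1) E (fun w => block_sum n k e L p m w ^+ 2) <=
  C * (n%:R ^+ 2 * kap n ^+ 6 + n%:R * kap n ^+ 3).
Proof.
have [C C0 HC] := hmoment_le (gspan_space Bfbm) 3 3 p p.
exists (3 * C) => [|n k e L n0 kn e1 L0]; first by rewrite mulr_ge0.
have k0 := step_variance_gt0 H n0.
pose c (i j : 'I_k) := C * (kap n ^+ 6 + `|cov (increment B n i) (increment B n j)| * kap n ^+ 2).
have c0 i j : 0 <= c i j.
  by rewrite mulr_ge0// addr_ge0 ?mulr_ge0 ?exprn_ge0 ?(ltW k0).
apply: (@le_trans _ _ (\sum_(i < k) \sum_(j < k) c i j)).
  rewrite (@sum_blocks n k L)//; apply: ler_sum => m _.
  rewrite (block_sum_moment2 n0 kn e1 L0); apply: ler_sum => i _.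
  apply: (@le_trans _ _ (\sum_(j < k | (j %/ L)%N == m) c i j)).
    apply: ler_sum => j _; apply: le_trans (ler_norm _) _.
    have := HC (kap n) _ _ _ _ (gspan_grid_incr B n0 (block_index_lt kn i)) (gspan_grid_incr B n0 (block_index_lt kn j))
      (gspan_block_incr n0 kn e1 L0 i) (gspan_block_incr n0 kn e1 L0 j) (block_small_cov n0 kn e1 L0 i j).
    by [].
  by rewrite [leRHS](bigID (fun j : 'I_k => (j %/ L)%N == m))/= lerDl sumr_ge0.
apply: (@le_trans _ _ (\sum_(i < k) C * (n%:R * kap n ^+ 6 + 3 * kap n ^+ 3))).
  apply: ler_sum => i _; rewrite -mulr_sumr ler_wpM2l// big_split/= sumr_const card_ord.
  apply: lerD.
    by rewrite -(mulr_natl (kap n ^+ 6)) ler_wpM2r ?exprn_ge0 ?(ltW k0)// ler_nat.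
  rewrite -mulr_suml (exprS _ 2) mulrA ler_wpM2r ?exprn_ge0 ?(ltW k0)//.
  apply: le_trans (sum_cov_grid_incr_le H0 H12 Bfbm n0 (block_index_lt kn i)).
  rewrite (big_ord_widen n (fun j => `|cov (increment B n i) (increment B n j)|))//.
  by rewrite [leRHS](bigID (fun j : 'I_n => (j < k)%N))/= lerDl sumr_ge0.
rewrite sumr_const card_ord -(mulr_natl (C * _)).
apply: (@le_trans _ _ (n%:R * (C * (n%:R * kap n ^+ 6 + 3 * kap n ^+ 3)))).
  have k3 : 0 <= kap n ^+ 3 by rewrite exprn_ge0// ltW.
  have k6 : 0 <= kap n ^+ 6 by rewrite exprn_ge0// ltW.
  by rewrite ler_wpM2r ?ler_nat// mulr_ge0// addr_ge0// mulr_ge0.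
have : 0 <= C * n%:R ^+ 2 * kap n ^+ 6.
  by apply: mulr_ge0; [apply: mulr_ge0 => //; exact: sqr_ge0|rewrite exprn_ge0// ltW].
have -> : n%:R * (C * (n%:R * kap n ^+ 6 + 3 * kap n ^+ 3)) =
  C * n%:R ^+ 2 * kap n ^+ 6 + 3 * C * (n%:R * kap n ^+ 3) by ring.
have -> : 3 * C * (n%:R ^+ 2 * kap n ^+ 6 + n%:R * kap n ^+ 3) =
  3 * (C * n%:R ^+ 2 * kap n ^+ 6) + 3 * C * (n%:R * kap n ^+ 3) by ring.
lra.
Qed.

End BlockSums.

(** * Weighted cubic sums *)

Lemma young_half {R : realType} (l a b : R) : 0 < l ->
  a * b <= 2^-1 * (l * a ^+ 2 + l^-1 * b ^+ 2).
Proof.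
move=> l0; have : 0 <= l^-1 * (l * a - b) ^+ 2.
  by rewrite mulr_ge0 ?sqr_ge0// invr_ge0 ltW.
have -> : l^-1 * (l * a - b) ^+ 2 = l * a ^+ 2 - 2 * (a * b) + l^-1 * b ^+ 2.
  by field; rewrite gt_eqF.
lra.
Qed.

Section WeightedHermiteSums.
Context d (T : measurableType d) {R : realType} (P : probability T R) (H : R)
  (B : R -> {RV P >-> R}).
Hypothesis H0 : 0 < H.
Hypothesis H12 : H < 2^-1.
Hypothesis Bfbm : fractional_brownian_motion H B.
Local Notation E := (Ex P).
Local Notation am := (all_moments P).
Local Notation kap n := (step_variance H n).
Local Notation h3 := (incr_hermite3 H B).

(** Young's inequality with the weight [l] that balances the two terms replaces
    the Cauchy-Schwarz inequality. *)
Lemma remainder_moment q : exists2 C : R, 0 <= C & forall n k e L (j : 'I_k),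
  (0 < n)%N -> (k <= n)%N -> (e <= 1)%N -> (0 < L)%N ->
  E (fun w => block_incr B n e L j w ^+ q.*2 * h3 n j w ^+ 2) <=
  C * (kap n ^+ 3 * ((L%:R / n%:R) `^ (2 * H)) ^+ q).
Proof.
have [C C0 HC] := even_moment (gspan_space Bfbm) q.*2.
have [D D0 HD] := hermite3_moment4 H0 H12 Bfbm.
exists (2^-1 * (C + D)) => [|n k e L j n0 kn e1 L0]; first by rewrite mulr_ge0 ?invr_ge0// addr_ge0.
set dl := (L%:R / n%:R) `^ (2 * H).
have d0 : 0 < dl by rewrite powR_gt0// divr_gt0 ?ltr0n.
have k0 := step_variance_gt0 H n0.
have aX := am_block_incr H0 H12 Bfbm n0 kn e1 L0 j.
have ah := am_hermite3 Bfbm n0 (block_index_lt kn j).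
pose l := kap n ^+ 3 / dl ^+ q.
have l0 : 0 < l by rewrite divr_gt0// exprn_gt0.
apply: (@le_trans _ _ (E (fun w => 2^-1 * (l * block_incr B n e L j w ^+ q.*2.*2 +
   l^-1 * h3 n j w ^+ 4)))).
  apply: Ex_le.
  - by apply: all_momentsM; exact: all_momentsX.
  - by apply: all_momentsZ; apply: all_momentsD; apply: all_momentsZ; exact: all_momentsX.
  - move=> w; apply: le_trans (young_half _ _ l0) _.
    by rewrite -!exprM !muln2.
rewrite ExZ; last by apply: all_momentsD; apply: all_momentsZ; exact: all_momentsX.
rewrite ExD; [|by apply: all_momentsZ; exact: all_momentsX..].
rewrite !ExZ; [|exact: all_momentsX..].
rewrite -[leRHS]mulrA ler_wpM2l ?invr_ge0// mulrDl; apply: lerD.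
  rewrite (HC _ (gspan_block_incr B H0 H12 n0 kn e1 L0 j)).
  rewrite mulrCA ler_wpM2l//.
  have := block_incr_var_le H0 H12 Bfbm n0 kn e1 L0 j; rewrite -/dl => h.
  apply: (@le_trans _ _ (l * dl ^+ q.*2)).
    rewrite ler_wpM2l ?(ltW l0)// lerXn2r// nnegrE ?(ltW d0)//.
    by apply: Ex_ge0 => w; exact: sqr_ge0.
  rewrite /l -addnn exprD mulrA mulfVK//.
  by rewrite gt_eqF// exprn_gt0.
apply: (@le_trans _ _ (l^-1 * (D * kap n ^+ 6))).
  by rewrite ler_wpM2l ?invr_ge0 ?(ltW l0)//; apply: HD => //; exact: block_index_lt.
rewrite mulrCA ler_wpM2l// /l le_eqVlt; apply/orP; left; apply/eqP.
have -> : kap n ^+ 6 = kap n ^+ 3 * kap n ^+ 3 by rewrite -exprD.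
have : dl ^+ q != 0 by rewrite gt_eqF// exprn_gt0.
have : kap n ^+ 3 != 0 by rewrite gt_eqF// exprn_gt0.
by move: (kap n ^+ 3) (dl ^+ q) => a b a0 b0; field; rewrite a0 b0.
Qed.

Lemma am_comp_grid_value g n k : continuous g -> (exists2 C, 0 <= C & forall x : R, `|g x| <= C) ->
  am (fun w => g (grid_value B n k w)).
Proof.
move=> gc [C _ gC]; apply: (@all_moments_bounded _ _ _ _ _ C) => //.
by apply: measurableT_comp => //; exact: continuous_measurable_fun.
Qed.

(** Taylor expansion of [g] to order [q] at the left end of each block.  The
    term of order [p < q] is a sum over blocks of a bounded weight times a block
    sum, whose square is at most the number of blocks times the sum of the
    squares; the remainder is estimated term by term. *)
Lemma weighted_hermite_le (g : R -> R) q : smooth_bounded g ->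
  exists2 C : R, 0 <= C & forall n k e L,
  (0 < n)%N -> (k <= n)%N -> (e <= 1)%N -> (0 < L)%N ->
  E (fun w => (\sum_(j < k) g (grid_value B n (j + e) w) * h3 n j w) ^+ 2) <=
  C * ((n %/ L).+1%:R * (n%:R ^+ 2 * kap n ^+ 6 + n%:R * kap n ^+ 3) +
     n%:R ^+ 2 * kap n ^+ 3 * ((L%:R / n%:R) `^ (2 * H)) ^+ q).
Proof.
move=> gs; have [G [G0 Gd Gs]] := smooth_bounded_derivs gs.
have [K K0 GK] : exists2 K : nat -> R, (forall p, 0 <= K p) & forall p x, `|G p x| <= K p.
  have /choice[K HK] : forall p, exists K, 0 <= K /\ forall x, `|G p x| <= K.
    by move=> p; have [C C0 HC] := smooth_bounded_bound (Gs p); exists C.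
  by exists K => [p|p x]; have [? ?] := HK p.
have [Cr Cr0 HCr] := remainder_moment q.
have /choice[Cw HCw] : forall p, exists C : R, 0 <= C /\ forall n k e L,
  (0 < n)%N -> (k <= n)%N -> (e <= 1)%N -> (0 < L)%N ->
  \sum_(m < (n %/ L).+1) E (fun w => block_sum H B n k e L p m w ^+ 2) <=
  C * (n%:R ^+ 2 * kap n ^+ 6 + n%:R * kap n ^+ 3).
  by move=> p; have [C C0 HC] := block_sums_le H0 H12 Bfbm p; exists C.
pose C1 := q%:R * \sum_(p < q) K p ^+ 2 * Cw p.
pose C2 := K q ^+ 2 * Cr.
have C10 : 0 <= C1.
  rewrite mulr_ge0// sumr_ge0// => p _; rewrite mulr_ge0 ?sqr_ge0//.
  by have [] := HCw p.
have C20 : 0 <= C2 by rewrite mulr_ge0// sqr_ge0.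
exists (2 * (C1 + C2)) => [|n k e L n0 kn e1 L0]; first by rewrite mulr_ge0// addr_ge0.
set M := (n %/ L).+1.
have gG (p : nat) : continuous (G p) by exact: is_derive1_continuous (Gd p).
have aG p j : am (fun w => G p (grid_value B n j w)).
  by apply: am_comp_grid_value => //; exists (K p).
pose r (j : 'I_k) w := G 0%N (grid_value B n (j + e) w) -
  \sum_(p < q) G p (grid_value B n (j %/ L * L) w) * block_incr B n e L j w ^+ p / p`!%:R.
have rle (j : 'I_k) w : `|r j w| <= K q * `|block_incr B n e L j w| ^+ q.
  have := @taylor_le R q G (grid_value B n (j %/ L * L) w) (grid_value B n (j + e) w) (K q) (fun p _ x => Gd p x) (fun x _ => GK q x).
  by [].
pose Z p (m : nat) w := G p (grid_value B n (m * L) w) / p`!%:R * block_sum H B n k e L p m w.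
have Sdecomp w : \sum_(j < k) g (grid_value B n (j + e) w) * h3 n j w =
  \sum_(p < q) \sum_(m < M) Z p m w + \sum_(j < k) r j w * h3 n j w.
  have -> : \sum_(p < q) \sum_(m < M) Z p m w = \sum_(j < k) (\sum_(p < q)
      G p (grid_value B n (j %/ L * L) w) * block_incr B n e L j w ^+ p / p`!%:R) * h3 n j w.
    rewrite exchange_big/= [RHS](@sum_blocks _ n k L)//; apply: eq_bigr => m _.
    under [RHS]eq_bigr => j jm do rewrite (eqP jm) mulr_suml.
    rewrite [RHS]exchange_big/=; apply: eq_bigr => p _.
    rewrite /Z /block_sum mulr_sumr; apply: eq_bigr => j _; ring.
  rewrite -big_split/=; apply: eq_bigr => j _.
  by rewrite -mulrDl /r addrC subrK G0.
have aXb (j : 'I_k) := am_block_incr H0 H12 Bfbm n0 kn e1 L0 j.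
have ah (j : 'I_k) := am_hermite3 Bfbm n0 (block_index_lt kn j).
have aW p m := am_block_sum H0 H12 Bfbm n0 kn e1 L0 p m.
pose U w := 2 * (q%:R * (\sum_(p < q) M%:R * (\sum_(m < M) K p ^+ 2 * block_sum H B n k e L p m w ^+ 2)) +
   n%:R * \sum_(j < k) K q ^+ 2 * (block_incr B n e L j w ^+ q.*2 * h3 n j w ^+ 2)).
have aU1 : am (fun w => \sum_(p < q) M%:R * (\sum_(m < M) K p ^+ 2 * block_sum H B n k e L p m w ^+ 2)).
  apply: all_moments_sum => p _; apply: all_momentsZ; apply: all_moments_sum => m _.
  by apply: all_momentsZ; apply: all_momentsX; exact: aW.
have aU2 : am (fun w => \sum_(j < k) K q ^+ 2 * (block_incr B n e L j w ^+ q.*2 * h3 n j w ^+ 2)).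
  apply: all_moments_sum => j _; apply: all_momentsZ.
  by apply: all_momentsM; apply: all_momentsX.
have aU : am U by apply: all_momentsZ; apply: all_momentsD; apply: all_momentsZ.
apply: (@le_trans _ _ (E U)).
  apply: Ex_le => //.
    apply: all_momentsX; apply: all_moments_sum => j _; apply: all_momentsM => //.
    by rewrite -G0; exact: aG.
  move=> w; rewrite Sdecomp.
  set a := (X in (X + _) ^+ 2); set b := (X in (_ + X) ^+ 2).
  apply: (@le_trans _ _ (2 * (a ^+ 2 + b ^+ 2))).
    by have := sqr_ge0 (a - b); lra.
  rewrite /U ler_wpM2l//; apply: lerD.
    apply: le_trans (sqr_sum_le _) _; rewrite ler_wpM2l//; apply: ler_sum => p _.
    apply: le_trans (sqr_sum_le _) _; rewrite ler_wpM2l//; apply: ler_sum => m _.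
    rewrite /Z exprMn ler_wpM2r ?sqr_ge0// -real_normK ?num_real// lerXn2r ?nnegrE//.
    rewrite normrM normfV normr_nat -[leRHS]mulr1; apply: ler_pM => //.
    by rewrite invf_le1 ?ltr0n ?fact_gt0// ler1n fact_gt0.
  apply: le_trans (sqr_sum_le _) _.
  apply: (@le_trans _ _ (k%:R * \sum_(j < k) K q ^+ 2 * (block_incr B n e L j w ^+ q.*2 * h3 n j w ^+ 2))).
    rewrite ler_wpM2l//; apply: ler_sum => j _.
    rewrite exprMn mulrA ler_wpM2r ?sqr_ge0//.
    rewrite -muln2 mulnC exprM -[r j w ^+ 2]real_normK ?num_real//.
    have -> : K q ^+ 2 * (block_incr B n e L j w ^+ 2) ^+ q = (K q * `|block_incr B n e L j w| ^+ q) ^+ 2.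
      by rewrite [RHS]exprMn -(real_normK (num_real (block_incr B n e L j w))) exprAC.
    by rewrite lerXn2r// nnegrE// mulr_ge0// exprn_ge0.
  rewrite ler_wpM2r ?ler_nat//; apply: sumr_ge0 => j _.
  apply: mulr_ge0; first exact: sqr_ge0.
  by apply: mulr_ge0; [rewrite -muln2 exprM sqr_ge0|exact: sqr_ge0].
rewrite /U ExZ; last by apply: all_momentsD; apply: all_momentsZ.
rewrite -mulrA ler_wpM2l// ExD; [|exact: all_momentsZ..].
rewrite !ExZ//.
set V := n%:R ^+ 2 * kap n ^+ 6 + n%:R * kap n ^+ 3.
set D := ((L%:R / n%:R) `^ (2 * H)) ^+ q.
have kp : 0 <= kap n ^+ 3 by rewrite exprn_ge0// ltW// step_variance_gt0.
have kp6 : 0 <= kap n ^+ 6 by rewrite exprn_ge0// ltW// step_variance_gt0.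
have V0 : 0 <= V by rewrite addr_ge0// mulr_ge0// sqr_ge0.
have D0 : 0 <= D by rewrite exprn_ge0// powR_ge0.
have i1 : q%:R * E (fun w => \sum_(p < q) M%:R * (\sum_(m < M) K p ^+ 2 * block_sum H B n k e L p m w ^+ 2))
   <= C1 * (M%:R * V).
  rewrite /C1 -mulrA ler_wpM2l// Ex_sum; last first.
    move=> p _; apply: all_momentsZ; apply: all_moments_sum => m _.
    by apply: all_momentsZ; apply: all_momentsX; exact: aW.
  rewrite mulr_suml; apply: ler_sum => p _; rewrite ExZ; last first.
    apply: all_moments_sum => m _.
    by apply: all_momentsZ; apply: all_momentsX; exact: aW.
  rewrite (mulrCA _ M%:R) ler_wpM2l// Ex_sum; last first.
    by move=> m _; apply: all_momentsZ; apply: all_momentsX; exact: aW.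
  rewrite -mulrA (eq_bigr (fun m : 'I_M => K p ^+ 2 * E (fun w => block_sum H B n k e L p m w ^+ 2))); last first.
    by move=> m _; rewrite ExZ//; apply: all_momentsX; exact: aW.
  rewrite -mulr_sumr ler_wpM2l ?sqr_ge0//.
  by have [_] := HCw p; apply.
have i2 : n%:R * E (fun w => \sum_(j < k) K q ^+ 2 * (block_incr B n e L j w ^+ q.*2 * h3 n j w ^+ 2)) <=
   C2 * (n%:R ^+ 2 * kap n ^+ 3 * D).
  have -> : C2 * (n%:R ^+ 2 * kap n ^+ 3 * D) = n%:R * (n%:R * (C2 * (kap n ^+ 3 * D))) by ring.
  rewrite ler_wpM2l// Ex_sum; last first.
    by move=> j _; apply: all_momentsZ; apply: all_momentsM; apply: all_momentsX.
  apply: (@le_trans _ _ (\sum_(j < k) C2 * (kap n ^+ 3 * D))).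
    apply: ler_sum => j _; rewrite ExZ; last by apply: all_momentsM; apply: all_momentsX.
    by rewrite /C2 -mulrA ler_wpM2l ?sqr_ge0//; apply: HCr.
  rewrite sumr_const card_ord -(mulr_natl (C2 * _)) ler_wpM2r ?ler_nat//.
  by apply: mulr_ge0 => //; apply: mulr_ge0.
apply: le_trans (lerD i1 i2) _.
have q1 : 0 <= C1 * (n%:R ^+ 2 * kap n ^+ 3 * D) by do 3 (apply: mulr_ge0 => //); exact: sqr_ge0.
have q2 : 0 <= C2 * (M%:R * V) by do 2 (apply: mulr_ge0 => //).
move: (M%:R * V) (n%:R ^+ 2 * kap n ^+ 3 * D) q1 q2 => a b q1 q2.
have -> : (C1 + C2) * (a + b) = C1 * a + C2 * b + (C1 * b + C2 * a) by ring.
by rewrite lerDl addr_ge0.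
Qed.

End WeightedHermiteSums.

Section CubicSums.
Context d (T : measurableType d) {R : realType} (P : probability T R) (H : R)
  (B : R -> {RV P >-> R}).
Hypothesis H13 : 3^-1 < H.
Hypothesis H12 : H < 2^-1.
Hypothesis Bfbm : fractional_brownian_motion H B.
Local Notation E := (Ex P).
Local Notation am := (all_moments P).
Local Notation kap n := (step_variance H n).
Local Notation h3 := (incr_hermite3 H B).
Local Notation u := (increment B).

Lemma hurst_gt0 : 0 < H.
Proof. by apply: lt_trans H13; rewrite invr_gt0. Qed.
Let H0 := hurst_gt0.

Lemma natpow_le n (a b : R) : (0 < n)%N -> a <= b -> n%:R `^ a <= n%:R `^ b.
Proof. by move=> n0 ab; apply: ler_powR => //; rewrite ler1n. Qed.

Lemma step_varianceX n p : (0 < n)%N -> kap n ^+ p = n%:R `^ (- (2 * H * p%:R)).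
Proof. by move=> n0; rewrite -powR_mulrn ?powR_ge0// -powRrM mulNr. Qed.

Lemma natpowM n (a b : R) : (0 < n)%N -> n%:R `^ a * n%:R `^ b = n%:R `^ (a + b).
Proof. by move=> n0; rewrite powRD//; apply/implyP => _; rewrite pnatr_eq0 -lt0n. Qed.

Lemma n2_step_variance3_le1 n : (0 < n)%N -> n%:R ^+ 2 * kap n ^+ 3 <= 1.
Proof.
move=> n0; rewrite step_varianceX// -powR_mulrn// natpowM// -[leRHS](powRr0 (n%:R : R)).
by apply: natpow_le => //; move: H13; lra.
Qed.

Lemma n_step_variance3_le1 n : (0 < n)%N -> n%:R * kap n ^+ 3 <= 1.
Proof.
move=> n0; apply: le_trans (n2_step_variance3_le1 n0); rewrite ler_wpM2r//.
  by rewrite exprn_ge0// ltW// step_variance_gt0.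
by rewrite expr2 ler_peMl// ler1n.
Qed.

Lemma step_variance2_le n : (0 < n)%N -> kap n ^+ 2 <= n%:R * kap n ^+ 3.
Proof.
move=> n0; have k0 := step_variance_gt0 H n0.
rewrite (exprS _ 2) mulrA ler_peMl ?exprn_ge0 ?(ltW k0)//.
rewrite -{1}(powRr1 (ler0n R n)) /step_variance natpowM// -[leLHS](powRr0 (n%:R : R)).
by apply: natpow_le => //; move: H12; lra.
Qed.

(** Blocks of L ~ n^(1-dl) steps, so about n^dl blocks, and an expansion of
    order [q] with 2 H dl q >= 1: an increment inside a block has variance at
    most of order n^(- 2 H dl), whose power [q] makes up for a factor n. *)
Lemma hermite_sum_le (g : R -> R) (dl : R) : smooth_bounded g -> 0 < dl <= 1 ->
  exists2 C : R, 0 <= C & forall n k e, (0 < n)%N -> (k <= n)%N -> (e <= 1)%N ->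
  E (fun w => (\sum_(j < k) g (grid_value B n (j + e) w) * h3 n j w) ^+ 2) <=
  C * (n%:R `^ dl * (n%:R * kap n ^+ 3)).
Proof.
move=> gs /andP[d0 d1].
pose q := (Num.trunc (2 * H * dl)^-1).+1.
have Hd0 : 0 < 2 * H * dl by rewrite !mulr_gt0.
have qH : 1 <= 2 * H * dl * q%:R.
  by rewrite mulrC -ler_pdivrMr// div1r ltW// truncnS_gt.
have [C C0 HC] := weighted_hermite_le H0 H12 Bfbm q gs.
pose D := (2 `^ (2 * H) : R) ^+ q.
have D0 : 0 <= D by rewrite exprn_ge0// powR_ge0.
exists (C * (4 + D)) => [|n k e n0 kn e1]; first by rewrite mulr_ge0// addr_ge0.
have n1 : 1 <= n%:R :> R by rewrite ler1n.
have n0R : 0 < n%:R :> R by rewrite ltr0n.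
pose L := (Num.trunc (n%:R `^ (1 - dl) : R)).+1.
have Lge : n%:R `^ (1 - dl) <= L%:R by rewrite ltW// truncnS_gt.
have Lle : L%:R <= n%:R `^ (1 - dl) + 1 :> R.
  by rewrite -natr1 lerD2r truncn_le ?powR_ge0.
have L0 : 0 < L%:R :> R by rewrite ltr0n.
have nd1 : 1 <= n%:R `^ dl by rewrite -[leLHS](powRr0 (n%:R : R)); apply: natpow_le => //; exact: ltW.
have Mle : (n %/ L).+1%:R <= 2 * n%:R `^ dl :> R.
  rewrite -natr1 mulr_natl mulr2n; apply: lerD => //.
  apply: (@le_trans _ _ (n%:R / L%:R)).
    by rewrite ler_pdivlMr// -natrM ler_nat leq_trunc_div.
  rewrite ler_pdivrMr//; apply: le_trans (ler_wpM2l (powR_ge0 _ _) Lge).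
  by rewrite natpowM// addrC subrK powRr1.
have LN : L%:R / n%:R <= 2 * n%:R `^ (- dl) :> R.
  rewrite ler_pdivrMr// -mulrA.
  have -> : n%:R `^ (- dl) * n%:R = n%:R `^ (1 - dl).
    by rewrite -{2}(powRr1 (ler0n R n)) natpowM// addrC.
  apply: le_trans Lle _; rewrite mulr_natl mulr2n lerD2l.
  by rewrite -[leLHS](powRr0 (n%:R : R)); apply: natpow_le => //; rewrite subr_ge0.
have DN : ((L%:R / n%:R) `^ (2 * H)) ^+ q <= D * n%:R^-1.
  apply: (@le_trans _ _ (((2 * n%:R `^ (- dl)) `^ (2 * H)) ^+ q)).
    rewrite lerXn2r ?nnegrE ?powR_ge0//; apply: ge0_ler_powR => //.
    - by rewrite mulr_ge0// ltW.
    - by rewrite nnegrE divr_ge0.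
    - by rewrite nnegrE mulr_ge0// powR_ge0.
  rewrite powRM ?powR_ge0// exprMn /D ler_wpM2l//.
  rewrite -powR_mulrn ?powR_ge0// -!powRrM -powR_inv1//; apply: natpow_le => //.
  by move: qH; lra.
apply: le_trans (HC n k e L n0 kn e1 _) _ => //.
rewrite -[leRHS]mulrA ler_wpM2l//.
set a := n%:R * kap n ^+ 3.
have a0 : 0 <= a by rewrite mulr_ge0// exprn_ge0// ltW// step_variance_gt0.
have -> : n%:R ^+ 2 * kap n ^+ 6 = a * a.
  have -> : kap n ^+ 6 = kap n ^+ 3 * kap n ^+ 3 by rewrite -exprD.
  by rewrite /a; move: (kap n ^+ 3) => k3; ring.
have aa : a * a <= a by rewrite ler_piMl// n_step_variance3_le1.
rewrite [leRHS]mulrDl; apply: lerD.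
  apply: (@le_trans _ _ ((2 * n%:R `^ dl) * (2 * a))).
    by apply: ler_pM => //; [rewrite addr_ge0// mulr_ge0|lra].
  by rewrite le_eqVlt; apply/orP; left; apply/eqP; ring.
have -> : n%:R ^+ 2 * kap n ^+ 3 = n%:R * a by rewrite /a mulrA -expr2.
apply: (@le_trans _ _ (n%:R * a * (D * n%:R^-1))).
  by rewrite ler_wpM2l// mulr_ge0.
have -> : n%:R * a * (D * n%:R^-1) = D * (1 * a) by field; rewrite gt_eqF.
by rewrite ler_wpM2l// ler_wpM2r.
Qed.

Definition trap (g : R -> R) n j w : R := 2^-1 * (g (grid_value B n j w) + g (grid_value B n j.+1 w)).
Definition cubic_sum g n k w := \sum_(j < k) trap g n j w * u n j w ^+ 3.

Lemma am_trap g n j : smooth_bounded g -> (0 < n)%N -> am (trap g n j).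
Proof.
move=> gs n0; have [gd _] := smooth_bounded_derive gs.
have gb := smooth_bounded_bound gs.
apply: all_momentsZ; apply: all_momentsD; apply: am_comp_grid_value => //;
  exact: is_derive1_continuous gd.
Qed.

Lemma am_cubic_sum g n k : smooth_bounded g -> (0 < n)%N -> (k <= n)%N -> am (cubic_sum g n k).
Proof.
move=> gs n0 kn; apply: all_moments_sum => j _; apply: all_momentsM; first exact: am_trap.
by apply: all_momentsX; apply: (am_grid_incr Bfbm) => //; exact: block_index_lt.
Qed.

(** The sum is a trapezoidal approximation of [G (B (k / n)) - G (B 0)]; the
    mean square of its error is at most of order n^2 kap^3 = n^(2-6H). *)
Lemma linear_sum_le (g : R -> R) : smooth_bounded g ->
  exists2 C : R, 0 <= C & forall n k, (0 < n)%N -> (k <= n)%N ->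
  E (fun w => (\sum_(j < k) trap g n j w * u n j w) ^+ 2) <= C.
Proof.
move=> gs; have [gd g1s] := smooth_bounded_derive gs; have [g1d g2s] := smooth_bounded_derive g1s.
have [G Gd] := antiderivative_exists (is_derive1_continuous gd).
have [K K0 gK] := smooth_bounded_bound gs; have [K2 K20 g2K] := smooth_bounded_bound g2s.
have [C6 C60 HC6] := grid_incr_moment H0 H12 Bfbm 3.
exists (2 * (K ^+ 2 + 4 * K2 ^+ 2 * C6)) => [|n k n0 kn].
  by rewrite mulr_ge0// addr_ge0 ?sqr_ge0// !mulr_ge0// sqr_ge0.
have au (j : 'I_k) : am (u n j) by apply: (am_grid_incr Bfbm) => //; exact: block_index_lt.
have aB : am (fun w => grid_value B n k w - grid_value B n 0 w).
  by apply: all_momentsB; apply: (am_grid_value Bfbm).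
have a1 : am (fun w => K ^+ 2 * (grid_value B n k w - grid_value B n 0 w) ^+ 2).
  by apply: all_momentsZ; exact: all_momentsX.
have a2 : am (fun w => (2 * K2) ^+ 2 * (n%:R * \sum_(j < k) u n j w ^+ 6)).
  by do 2 apply: all_momentsZ; apply: all_moments_sum => j _; exact: all_momentsX.
apply: (@le_trans _ _ (E (fun w => 2 * (K ^+ 2 * (grid_value B n k w - grid_value B n 0 w) ^+ 2 +
   (2 * K2) ^+ 2 * (n%:R * \sum_(j < k) u n j w ^+ 6))))).
  apply: Ex_le.
  - apply: all_momentsX; apply: all_moments_sum => j _.
    by apply: all_momentsM => //; exact: am_trap.
  - by apply: all_momentsZ; exact: all_momentsD.
  move=> w; pose rr (j : 'I_k) := G (grid_value B n j.+1 w) - G (grid_value B n j w) - trap g n j w * u n j w.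
  have rle j : `|rr j| <= 2 * K2 * `|u n j w| ^+ 3.
    by apply: (@trapezoid_le _ G g (derive1 g) (derive1 (derive1 g))) => // x _; exact: g2K.
  have e : \sum_(j < k) trap g n j w * u n j w =
      (G (grid_value B n k w) - G (grid_value B n 0 w)) - \sum_(j < k) rr j.
    rewrite /rr sumrB opprB addrC.
    have -> : \sum_(i < k) (G (grid_value B n i.+1 w) - G (grid_value B n i w)) = G (grid_value B n k w) - G (grid_value B n 0 w).
      by rewrite -(telescope_sumr (fun i => G (grid_value B n i w)) (leq0n k)) big_mkord.
    by rewrite subrK.
  rewrite e; set a := G _ - G _; set b := \sum_(j < k) rr j.
  apply: (@le_trans _ _ (2 * (a ^+ 2 + b ^+ 2))).
    by have := sqr_ge0 (a + b); lra.
  rewrite ler_wpM2l//; apply: lerD.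
    rewrite -exprMn -real_normK ?num_real// -[leRHS]real_normK ?num_real//.
    rewrite lerXn2r ?nnegrE// normrM (ger0_norm K0).
    by apply: (@mean_value_le _ G g) => // x _; exact: gK.
  apply: le_trans (sqr_sum_le _) _.
  have nn : \sum_(i < k) rr i ^+ 2 <= \sum_(i < k) (2 * K2) ^+ 2 * u n i w ^+ 6.
    apply: ler_sum => j _; have -> : u n j w ^+ 6 = (`|u n j w| ^+ 3) ^+ 2.
      by rewrite -normrX real_normK ?num_real// -exprM.
    rewrite -exprMn -real_normK ?num_real// lerXn2r ?nnegrE//.
    by rewrite !mulr_ge0// exprn_ge0.
  apply: le_trans (ler_wpM2l (ler0n R k) nn) _.
  rewrite -mulr_sumr mulrCA ler_wpM2l ?sqr_ge0// ler_wpM2r ?ler_nat//.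
  by apply: sumr_ge0 => j _; rewrite exprn_even_ge0.
rewrite ExZ; last exact: all_momentsD.
rewrite ler_wpM2l// ExD// !ExZ; [|by apply: all_moments_sum => j _; exact: all_momentsX
  |by apply: all_momentsZ; apply: all_moments_sum => j _; exact: all_momentsX|exact: all_momentsX].
apply: lerD.
  rewrite -[leRHS]mulr1 ler_wpM2l ?sqr_ge0//.
  have /andP[p0 _] := two_hurst_range H0 H12.
  rewrite /grid_value (incr_var H0 H12 Bfbm); [|exact: (@grid01 R n n0 0)|exact: grid01].
  apply: (@le_trans _ _ (1 `^ (2 * H))); last by rewrite powR1.
  apply: (ge0_ler_powR (ltW p0)); rewrite ?nnegrE//.
  have := @grid01 R n n0 _ kn; rewrite in_itv/= mul0r subr0 => /andP[x0 x1].
  by rewrite ger0_norm.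
rewrite Ex_sum; last by move=> j _; exact: all_momentsX.
rewrite (eq_bigr (fun=> C6 * kap n ^+ 3)); last first.
  by move=> j _; rewrite (HC6 n j)//; exact: block_index_lt.
rewrite sumr_const card_ord -(mulr_natl (C6 * _)).
have -> : 4 * K2 ^+ 2 * C6 = (2 * K2) ^+ 2 * (C6 * 1) by ring.
rewrite ler_wpM2l ?sqr_ge0//.
apply: (@le_trans _ _ (n%:R * (n%:R * (C6 * kap n ^+ 3)))).
  have k3 : 0 <= kap n ^+ 3 by rewrite exprn_ge0// ltW// step_variance_gt0.
  by rewrite ler_wpM2l// ler_wpM2r ?ler_nat// mulr_ge0.
have -> : n%:R * (n%:R * (C6 * kap n ^+ 3)) = C6 * (n%:R ^+ 2 * kap n ^+ 3) by ring.
by rewrite ler_wpM2l// n2_step_variance3_le1.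
Qed.

(** u^3 = He_3(u) + 3 kap u splits the sum into two weighted Hermite sums, one
    for each end of the steps, and a linear sum. *)
Lemma cubic_sum_le (g : R -> R) (dl : R) : smooth_bounded g -> 0 < dl <= 1 ->
  exists2 C : R, 0 <= C & forall n k, (0 < n)%N -> (k <= n)%N ->
  E (fun w => cubic_sum g n k w ^+ 2) <= C * (n%:R `^ dl * (n%:R * kap n ^+ 3)).
Proof.
move=> gs dl01; have [C C0 HC] := hermite_sum_le gs dl01; have [D D0 HD] := linear_sum_le gs.
exists (3 * (2^-1 * C + 9 * D)) => [|n k n0 kn].
  by rewrite mulr_ge0// addr_ge0// mulr_ge0// invr_ge0.
have n1 : 1 <= n%:R :> R by rewrite ler1n.
have k0 := step_variance_gt0 H n0.
pose S e w := \sum_(j < k) g (grid_value B n (j + e) w) * h3 n j w.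
pose A w := \sum_(j < k) trap g n j w * u n j w.
have [gd _] := smooth_bounded_derive gs.
have gb := smooth_bounded_bound gs.
have au (j : 'I_k) : am (u n j) by apply: (am_grid_incr Bfbm) => //; exact: block_index_lt.
have aS e : am (S e).
  apply: all_moments_sum => j _; apply: all_momentsM.
    by apply: am_comp_grid_value => //; exact: is_derive1_continuous gd.
  by apply: (am_hermite3 Bfbm) => //; exact: block_index_lt.
have aA : am A by apply: all_moments_sum => j _; apply: all_momentsM => //; exact: am_trap.
have dec w : cubic_sum g n k w = 2^-1 * S 0%N w + 2^-1 * S 1%N w + 3 * kap n * A w.
  rewrite /cubic_sum /S /A !mulr_sumr -!big_split/=; apply: eq_bigr => j _.
  by rewrite hermite3E /trap addn0 addn1; field.
apply: (@le_trans _ _ (E (fun w => 3 * (4^-1 * S 0%N w ^+ 2 + 4^-1 * S 1%N w ^+ 2 +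
    9 * kap n ^+ 2 * A w ^+ 2)))).
  apply: Ex_le.
  - by apply: all_momentsX; exact: am_cubic_sum.
  - by apply: all_momentsZ; do !apply: all_momentsD; apply: all_momentsZ; exact: all_momentsX.
  move=> w; rewrite dec; move: (S 0%N w) (S 1%N w) (A w) (kap n) => a b c f.
  have -> : 9 * f ^+ 2 * c ^+ 2 = (3 * f * c) ^+ 2 by ring.
  move: (3 * f * c) => {c f}c.
  have := sqr_ge0 (2^-1 * a - 2^-1 * b); have := sqr_ge0 (2^-1 * a - c).
  have := sqr_ge0 (2^-1 * b - c); lra.
have a0 : am (fun w => 4^-1 * S 0%N w ^+ 2) by apply: all_momentsZ; exact: all_momentsX.
have a1 : am (fun w => 4^-1 * S 1%N w ^+ 2) by apply: all_momentsZ; exact: all_momentsX.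
have a2 : am (fun w => 9 * kap n ^+ 2 * A w ^+ 2) by apply: all_momentsZ; exact: all_momentsX.
rewrite ExZ; last by do ?apply: all_momentsD.
rewrite -[leRHS]mulrA ler_wpM2l// ExD//; last exact: all_momentsD.
rewrite ExD// !ExZ; [|exact: all_momentsX..].
have h0 := HC n k 0%N n0 kn isT; have h1 := HC n k 1%N n0 kn isT.
have hA := HD n k n0 kn.
set Q := n%:R `^ dl * (n%:R * kap n ^+ 3) in h0 h1 *.
have kQ : kap n ^+ 2 <= Q.
  apply: le_trans (step_variance2_le n0) _; rewrite ler_peMl//.
    by rewrite mulr_ge0// exprn_ge0// ltW.
  rewrite -[leLHS](powRr0 (n%:R : R)); apply: natpow_le => //.
  by have /andP[/ltW] := dl01.
have kD : 9 * kap n ^+ 2 * E (fun w => A w ^+ 2) <= 9 * D * Q.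
  have -> : 9 * D * Q = 9 * Q * D by ring.
  apply: ler_pM => //; first by rewrite mulr_ge0// sqr_ge0.
    by apply: Ex_ge0 => w; exact: sqr_ge0.
  by rewrite ler_wpM2l.
by move: h0 h1; rewrite -/(S 0%N) -/(S 1%N); lra.
Qed.

End CubicSums.

(** * One step of the implicit scheme *)

Section TaylorSums.
Context {R : realType}.
Implicit Types (G : nat -> R) (v : R).
Lemma taylor_sum1 G v : \sum_(i < 1) G i * v ^+ i / i`!%:R = G 0%N.
Proof. by rewrite big_ord1 expr0 fact0; field. Qed.
Lemma taylor_sum2 G v : \sum_(i < 2) G i * v ^+ i / i`!%:R = G 0%N + G 1%N * v.
Proof. by rewrite big_ord_recr/= taylor_sum1 expr1 divr1. Qed.
Lemma taylor_sum4 G v : \sum_(i < 4) G i * v ^+ i / i`!%:R =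
  G 0%N + G 1%N * v + G 2%N * v ^+ 2 / 2 + G 3%N * v ^+ 3 / 6.
Proof. by rewrite 2!big_ord_recr/= taylor_sum2. Qed.
Lemma taylor_sum5 G v : \sum_(i < 5) G i * v ^+ i / i`!%:R =
  G 0%N + G 1%N * v + G 2%N * v ^+ 2 / 2 + G 3%N * v ^+ 3 / 6 + G 4%N * v ^+ 4 / 24.
Proof. by rewrite big_ord_recr/= taylor_sum4. Qed.
End TaylorSums.

Section OneStep.
Context {R : realType}.
Implicit Types (x y u v : R).

Lemma smooth_boundedD (f g : R -> R) : smooth_bounded f -> smooth_bounded g ->
  smooth_bounded (fun x => f x + g x).
Proof. by move=> fs gs k; apply: bounded_derivsD. Qed.

Lemma smooth_boundedM (f g : R -> R) : smooth_bounded f -> smooth_bounded g ->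
  smooth_bounded (fun x => f x * g x).
Proof. by move=> fs gs k; apply: bounded_derivsM. Qed.

(** Up to the constant factor [sigma (f 0) / r 0], which may be 0, and to an
    additive constant for [F], these are the flow [f], [sigma \o f] and, for
    [a1], [derive1 sigma \o f] itself.  Working with [r > 0] makes estimates
    relative to [r y] possible, whether or not sigma vanishes at the initial
    point. *)
Variables (F r a1 : R -> R).
Hypothesis Fr : forall x, is_derive x 1 F (r x).
Hypothesis rd : forall x, is_derive x 1 r (r x * a1 x).
Hypothesis r0 : forall x, 0 < r x.
Hypothesis a1s : smooth_bounded a1.

(** The k-th derivative of [r] is [r * logder k]. *)
Fixpoint logder k : R -> R := if k is k'.+1 then
  fun x => derive1 (logder k') x + logder k' x * a1 x else fun=> 1.

Lemma logder_smooth k : smooth_bounded (logder k).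
Proof.
elim: k => [|k IH] /=; first by move=> j; exact: bounded_derivs_cst.
apply: smooth_boundedD; first by have [] := smooth_bounded_derive IH.
exact: smooth_boundedM.
Qed.

Lemma logderP k x : is_derive x 1 (fun x => r x * logder k x) (r x * logder k.+1 x).
Proof.
have [ld _] := smooth_bounded_derive (logder_smooth k).
apply: (is_derive_eq (is_deriveM (rd x) (ld x))).
by rewrite /GRing.scale/=; ring.
Qed.

Definition flow_der k : R -> R := if k is k'.+1 then fun x => r x * logder k' x else F.

Lemma flow_derP k x : is_derive x 1 (flow_der k) (flow_der k.+1 x).
Proof.
case: k => [|k]; last exact: logderP.
by apply: (is_derive_eq (Fr x)); rewrite /= mulr1.
Qed.

(** [r] is the exponential of a Lipschitz function. *)
Lemma flow_derivative_le : exists2 K, 1 <= K & forall y z, `|z - y| <= 1 -> r z <= K * r y.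
Proof.
have [C C0 aC] := smooth_bounded_bound a1s.
have [A Ad] := antiderivative_exists (is_derive1_continuous (smooth_bounded_derive a1s).1).
exists (expR C); first by rewrite -[leLHS]expR0 ler_expR.
move=> y z zy.
have e x : is_derive x 1 (fun x => r x * expR (- A x)) 0.
  have d1 : is_derive x 1 (fun x => - A x) (- a1 x) by apply: is_deriveN.
  have d2 := is_derive1_comp_eq (is_derive_expR _) d1.
  by apply: (is_derive_eq (is_deriveM (rd x) d2)); rewrite /GRing.scale/=; ring.
have := is_derive_0_is_cst z y e.
have Az : A z - A y <= C.
  apply: le_trans (ler_norm _) _; apply: le_trans (mean_value_le Ad (fun x _ => aC x)) _.
  by rewrite ler_piMr.
move=> H; have -> : r z = r y * expR (A z - A y).
  by rewrite expRD mulrCA -H -mulrCA -expRD subrr expR0 mulr1.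
by rewrite mulrC ler_wpM2r ?ler_expR// ltW.
Qed.

Lemma flow_der_bound k : exists2 C, 0 <= C & forall y z, `|z - y| <= 1 ->
  `|flow_der k.+1 z| <= C * r y.
Proof.
have [C C0 lC] := smooth_bounded_bound (logder_smooth k).
have [K K1 rK] := flow_derivative_le.
have K0 : 0 <= K by apply: le_trans K1.
exists (K * C) => [|y z zy /=]; first by rewrite mulr_ge0.
rewrite normrM mulrAC (ger0_norm (ltW (r0 z))); apply: ler_pM => //; first exact: ltW.
exact: rK.
Qed.

Lemma flow_der_taylor k q : exists2 C, 0 <= C & forall y v, `|v| <= 1 ->
  `|flow_der k (y + v) - \sum_(i < q.+1) flow_der (k + i) y * v ^+ i / i`!%:R| <= C * r y * `|v| ^+ q.+1.
Proof.
have [C C0 FC] := flow_der_bound (k + q); exists C => // y v v1.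
have := @taylor_le R q.+1 (fun i => flow_der (k + i)) y (y + v) (C * r y).
rewrite addn0 addrC addKr; apply.
  by move=> i _ x; rewrite addnS; exact: flow_derP.
by move=> x xy; rewrite addnS; apply: FC; apply: le_trans v1.
Qed.

Definition cubic_coef x := 12^-1 * logder 2 x.

Lemma cubic_coef_smooth : smooth_bounded cubic_coef.
Proof.
apply: smooth_boundedM; last exact: logder_smooth.
by move=> j; exact: bounded_derivs_cst.
Qed.

(** The difference of the two sides changes sign between [v = 0] and
    [v = 2 u]. *)
Lemma step_exists : exists2 rho, 0 < rho <= 2^-1 & forall y u, `|u| <= rho ->
  exists2 v, `|v| <= 2 * `|u| & F (y + v) - F y = 2^-1 * (r y + r (y + v)) * u.
Proof.
have [C C0 HC] := flow_der_taylor 0 1; have [D D0 HD] := flow_der_taylor 1 0.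
pose K := 2 * (4 * C + D) + 1.
have K1 : 1 <= K by rewrite lerDr mulr_ge0// addr_ge0// mulr_ge0.
have K0 : 0 < K by apply: lt_le_trans K1.
exists (2^-1 * K^-1).
  rewrite mulr_gt0 ?invr_gt0//= ler_piMr ?invr_ge0// invf_le1//.
move=> y u uK.
have uK1 : K * `|u| <= 2^-1 by rewrite mulrC -ler_pdivlMr// .
pose h v := F (y + v) - F y - 2^-1 * (r y + r (y + v)) * u.
have shiftc (g : R -> R) : continuous g -> continuous (fun v => g (y + v)).
  move=> gc x; apply: (cvg_comp (fun v => y + v) g); last exact: gc.
  by apply: (@cvgD _ R^o); [exact: cvg_cst|exact: cvg_id].
have hc : continuous h.
  have Fc := shiftc _ (is_derive1_continuous Fr); have rc := shiftc _ (is_derive1_continuous rd).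
  move=> x; apply: (@cvgB _ R^o).
    by apply: (@cvgB _ R^o); [exact: Fc|exact: cvg_cst].
  apply: cvgM; last exact: cvg_cst.
  apply: cvgM; first exact: cvg_cst.
  by apply: (@cvgD _ R^o); [exact: cvg_cst|exact: rc].
have h0 : h 0 = - (r y * u) by rewrite /h addr0 subrr; field.
have ry0 := r0 y.
have h2u : `|h (2 * u) - r y * u| <= 2^-1 * r y * `|u|.
  have u1 : `|2 * u| <= 1.
    rewrite normrM ger0_norm//; have : `|u| <= K * `|u| by rewrite ler_peMl.
    by move: uK1; lra.
  have := HC y _ u1; have := HD y _ u1.
  rewrite !big_ord_recr !big_ord0/= !(fact0, factS, expr0, expr1, mulr1, divr1, add0r, muln1, expr1).
  rewrite ?mulr1.
  rewrite !normrM (ger0_norm (_ : 0 <= 2))// => i1 i2.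
  have -> : h (2 * u) - r y * u = (F (y + 2 * u) - (F y + r y * (2 * u))) -
     2^-1 * u * (r (y + 2 * u) - r y) by rewrite /h; field.
  apply: le_trans (ler_normB _ _) _.
  rewrite !normrM (ger0_norm (_ : 0 <= 2^-1)) ?invr_ge0//.
  have i3 : 2^-1 * `|u| * `|r (y + 2 * u) - r y| <= 2^-1 * `|u| * (D * r y * (2 * `|u|)).
    by rewrite ler_wpM2l// mulr_ge0// invr_ge0.
  apply: le_trans (lerD i2 i3) _.
  have -> : C * r y * (2 * `|u|) ^+ 2 + 2^-1 * `|u| * (D * r y * (2 * `|u|)) =
     r y * `|u| * ((4 * C + D) * `|u|) by field.
  have -> : 2^-1 * r y * `|u| = r y * `|u| * 2^-1 by ring.
  rewrite ler_wpM2l ?mulr_ge0 ?(ltW ry0)//.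
  apply: le_trans uK1; rewrite ler_wpM2r// /K.
  have : 0 <= 4 * C + D by rewrite addr_ge0// mulr_ge0.
  by lra.
move: h2u; rewrite ler_norml => /andP[h2a h2b].
have [u0|u0] := leP 0 u.
  move: h2a h2b; rewrite (ger0_norm u0) => h2a h2b.
  have ru : 0 <= r y * u by rewrite mulr_ge0// ltW.
  have le2 : 0 <= 2 * u by rewrite mulr_ge0.
  have [||v] := @IVT R h 0 (2 * u) 0 le2.
  - exact: continuous_subspaceT.
  - by rewrite h0 ge_min le_max; apply/andP; split; apply/orP; [left|right]; lra.
  rewrite in_itv/= => /andP[v0 v2] hv; exists v; first by rewrite !ger0_norm.
  by apply/eqP; rewrite -subr_eq0; apply/eqP.
move: h2a h2b; rewrite (ltr0_norm u0) => h2a h2b.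
have ru : 0 <= - (r y * u) by rewrite -mulrN mulr_ge0 ?oppr_ge0 ?ltW.
have le2 : 2 * u <= 0 by lra.
have [||v] := @IVT R h (2 * u) 0 0 le2.
- exact: continuous_subspaceT.
- by rewrite h0 ge_min le_max; apply/andP; split; apply/orP; [left|right]; lra.
rewrite in_itv/= => /andP[v0 v2] hv; exists v; first by rewrite !ler0_norm//; lra.
by apply/eqP; rewrite -subr_eq0; apply/eqP.
Qed.

(** The expansions of [F], [r] and [r * logder 2] about [y] are combined with
    symmetric weights: with w = r y + r (y + v), the trapezoidal error of
    [F (y + v) - F y] is v^3 / 24 times the sum of the values of [r * logder 2]
    at the two ends, up to order 5 in [v].  Dividing by w, the weights r y / w and
    r (y + v) / w can be replaced by 1/2, since logder 2 and [r] both
    change by O(|v|) only. *)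
Lemma step_expansion : exists2 C, 0 <= C & forall y u v, `|v| <= 1 -> `|v| <= 2 * `|u| ->
  F (y + v) - F y = 2^-1 * (r y + r (y + v)) * u ->
  `|v - u - 2^-1 * (cubic_coef y + cubic_coef (y + v)) * u ^+ 3| <= C * `|u| ^+ 5.
Proof.
have [C0 C00 HC0] := flow_der_taylor 0 4; have [C1 C10 HC1] := flow_der_taylor 1 3.
have [C2 C20 HC2] := flow_der_taylor 3 1; have [C3 C30 HC3] := flow_der_taylor 1 0.
have [L L0 HL] := smooth_bounded_bound (logder_smooth 2).
have [ld2 ls2] := smooth_bounded_derive (logder_smooth 2).
have [L' L'0 HL'] := smooth_bounded_bound ls2.
pose E1 := 2 * (C0 + C1 + C2) + L' * C3.
have E10 : 0 <= E1 by rewrite addr_ge0 ?mulr_ge0// !addr_ge0.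
pose E2 := L + E1.
have E20 : 0 <= E2 by rewrite addr_ge0.
exists (32 * E1 + 56 * (L * E2)) => [|y u v v1 vu eq].
  by rewrite addr_ge0 ?mulr_ge0.
have ry0 := r0 y; have rv0 := r0 (y + v).
set a := logder 2 y; set b := logder 2 (y + v).
set w := r y + r (y + v).
have w0 : 0 < w by rewrite addr_gt0.
have wry : r y <= w by rewrite lerDl ltW.
pose s := r y; pose t := r (y + v).
pose p1 := flow_der 2 y; pose p3 := flow_der 4 y.
pose e0 := F (y + v) - (F y + s * v + p1 * v ^+ 2 / 2 + s * a * v ^+ 3 / 6 + p3 * v ^+ 4 / 24).
pose e1 := t - (s + p1 * v + s * a * v ^+ 2 / 2 + p3 * v ^+ 3 / 6).
pose e2 := t * b - (s * a + p3 * v).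
have s1 : flow_der 1 y = s by rewrite /s /= mulr1.
have t1 : flow_der 1 (y + v) = t by rewrite /t /= mulr1.
have b0 : `|e0| <= C0 * s * `|v| ^+ 5.
  by have := HC0 y v v1; rewrite (taylor_sum5 (fun i => flow_der (0 + i) y)) [X in _ + X * v]s1.
have b1 : `|e1| <= C1 * s * `|v| ^+ 4.
  by have := HC1 y v v1; rewrite (taylor_sum4 (fun i => flow_der (1 + i) y)) [X in `|_ - (X + _ + _ + _)|]s1 t1.
have b2 : `|e2| <= C2 * s * `|v| ^+ 2.
  by have := HC2 y v v1; rewrite (taylor_sum2 (fun i => flow_der (3 + i) y)).
have b3 : `|t - s| <= C3 * s * `|v|.
  by have := HC3 y v v1; rewrite t1 (taylor_sum1 (fun i => flow_der (1 + i) y)) [X in `|_ - X|]s1 expr1.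
pose E5 := e0 - 2^-1 * e1 * v + v ^+ 3 / 24 * e2.
have v0 := normr_ge0 v; have u0 := normr_ge0 u.
have s0 : 0 < s by [].
have vn n : 0 <= `|v| ^+ n by exact: exprn_ge0.
have E5b : `|E5| <= (C0 + C1 + C2) * s * `|v| ^+ 5.
  apply: le_trans (ler_normD _ _) _; apply: le_trans (lerD (ler_normB _ _) (lexx _)) _.
  rewrite (normrM _ v) (normrM _ e1) (ger0_norm (_ : 0 <= 2^-1)) ?invr_ge0//.
  rewrite (normrM _ e2) (normrM (v ^+ 3)) normfV normrX (ger0_norm (_ : 0 <= 24))//.
  have c1 : 2^-1 * `|e1| * `|v| <= 2^-1 * (C1 * s * `|v| ^+ 4) * `|v|.
    by rewrite ler_wpM2r// ler_wpM2l// invr_ge0.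
  have c2 : `|v| ^+ 3 / 24 * `|e2| <= `|v| ^+ 3 / 24 * (C2 * s * `|v| ^+ 2).
    by rewrite ler_wpM2l// mulr_ge0// invr_ge0.
  have z1 : 0 <= C1 * s * `|v| ^+ 5 by rewrite !mulr_ge0// ltW.
  have z2 : 0 <= C2 * s * `|v| ^+ 5 by rewrite !mulr_ge0// ltW.
  apply: le_trans (lerD (lerD b0 c1) c2) _.
  have -> : 2^-1 * (C1 * s * `|v| ^+ 4) * `|v| = 2^-1 * (C1 * s * `|v| ^+ 5) by ring.
  have -> : `|v| ^+ 3 / 24 * (C2 * s * `|v| ^+ 2) = 24^-1 * (C2 * s * `|v| ^+ 5) by ring.
  by rewrite !mulrDl; lra.
(* The weights are such that the coefficients of even order, [p1] and [p3],
   drop out. *)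
have key : 2^-1 * w * (v - u) = v ^+ 3 / 24 * (s * a + t * b) - E5.
  have eq' : 2^-1 * w * u = F (y + v) - F y by rewrite eq.
  by rewrite mulrBr eq' /E5 /e0 /e1 /e2 /w -/s -/t; field.
have wn0 : w != 0 by rewrite gt_eqF.
have st : s + t = w by [].
have vu24 : v - u - (a + b) / 24 * v ^+ 3 = v ^+ 3 / 24 * ((b - a) * ((t - s) / w)) - 2 * (E5 / w).
  have -> : v - u = 2 / w * (2^-1 * w * (v - u)) by field; rewrite wn0.
  by rewrite key -st; field; rewrite st wn0.
have ba : `|b - a| <= L' * `|v|.
  have := mean_value_le (a := y) (b := y + v) ld2 (fun x _ => HL' x).
  by have -> : y + v - y = v by ring.
have tw : `|(t - s) / w| <= C3 * `|v|.
  rewrite normrM normfV (gtr0_norm w0) ler_pdivrMr//; apply: le_trans b3 _.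
  by rewrite mulrAC ler_wpM2l// mulr_ge0.
have Ew : `|E5 / w| <= (C0 + C1 + C2) * `|v| ^+ 5.
  rewrite normrM normfV (gtr0_norm w0) ler_pdivrMr//; apply: le_trans E5b _.
  by rewrite mulrAC ler_wpM2l// mulr_ge0// !addr_ge0.
have d1 : `|v - u - (a + b) / 24 * v ^+ 3| <= E1 * `|v| ^+ 5.
  rewrite vu24; apply: le_trans (ler_normB _ _) _.
  rewrite (normrM 2) (ger0_norm (_ : 0 <= 2))//.
  have c1 : `|v ^+ 3 / 24 * ((b - a) * ((t - s) / w))| <= `|v| ^+ 3 * (L' * `|v| * (C3 * `|v|)).
    rewrite (normrM _ ((b - a) * _)) (normrM (b - a)) (normrM (v ^+ 3)) normfV normrX (ger0_norm (_ : 0 <= 24))//.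
    apply: ler_pM; rewrite ?mulr_ge0 ?invr_ge0//.
      by rewrite ler_piMr// invf_le1// ler1n.
    exact: ler_pM.
  have -> : E1 * `|v| ^+ 5 = `|v| ^+ 3 * (L' * `|v| * (C3 * `|v|)) + 2 * ((C0 + C1 + C2) * `|v| ^+ 5).
    by rewrite /E1; ring.
  by apply: lerD => //; rewrite ler_wpM2l.
have abL : `|(a + b) / 24| <= L.
  rewrite normrM normfV (ger0_norm (_ : 0 <= 24))// ler_pdivrMr//.
  apply: le_trans (ler_normD _ _) _; apply: le_trans (lerD (HL _) (HL _)) _.
  by move: L0; lra.
have v5 : `|v| ^+ 5 <= `|v| ^+ 3 by apply: ler_wiXn2l.
have d2 : `|v - u| <= E2 * `|v| ^+ 3.
  have -> : v - u = (v - u - (a + b) / 24 * v ^+ 3) + (a + b) / 24 * v ^+ 3 by ring.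
  apply: le_trans (ler_normD _ _) _; apply: le_trans (lerD d1 (lexx _)) _.
  rewrite (normrM _ (v ^+ 3)) normrX.
  have -> : E2 * `|v| ^+ 3 = E1 * `|v| ^+ 3 + L * `|v| ^+ 3 by rewrite /E2; ring.
  by apply: lerD; [rewrite ler_wpM2l|rewrite ler_wpM2r].
have vu3 : `|v| ^+ 3 <= 8 * `|u| ^+ 3.
  have -> : 8 * `|u| ^+ 3 = (2 * `|u|) ^+ 3 by ring.
  by rewrite lerXn2r// nnegrE mulr_ge0.
have vu5 : `|v| ^+ 5 <= 32 * `|u| ^+ 5.
  have -> : 32 * `|u| ^+ 5 = (2 * `|u|) ^+ 5 by ring.
  by rewrite lerXn2r// nnegrE mulr_ge0.
have d3 : `|v ^+ 3 - u ^+ 3| <= 56 * E2 * `|u| ^+ 5.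
  have -> : v ^+ 3 - u ^+ 3 = (v - u) * (v * v + v * u + u * u) by ring.
  rewrite (normrM (v - u)); have -> : 56 * E2 * `|u| ^+ 5 = E2 * (8 * `|u| ^+ 3) * (7 * `|u| ^+ 2) by ring.
  apply: ler_pM => //.
    by apply: le_trans d2 _; rewrite ler_wpM2l.
  apply: le_trans (ler_normD _ _) _; apply: le_trans (lerD (ler_normD _ _) (lexx _)) _.
  rewrite !normrM.
  have q1 : `|v| * `|v| <= (2 * `|u|) * (2 * `|u|) by apply: ler_pM.
  have q2 : `|v| * `|u| <= (2 * `|u|) * `|u| by rewrite ler_wpM2r.
  by rewrite expr2; lra.
have -> : 2^-1 * (cubic_coef y + cubic_coef (y + v)) = (a + b) / 24.
  by rewrite /cubic_coef -/a -/b; field.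
have -> : v - u - (a + b) / 24 * u ^+ 3 = (v - u - (a + b) / 24 * v ^+ 3) +
  (a + b) / 24 * (v ^+ 3 - u ^+ 3) by ring.
apply: le_trans (ler_normD _ _) _; rewrite [leRHS]mulrDl; apply: lerD.
  apply: le_trans d1 _; have -> : 32 * E1 * `|u| ^+ 5 = E1 * (32 * `|u| ^+ 5) by ring.
  by rewrite ler_wpM2l.
rewrite normrM; have -> : 56 * (L * E2) * `|u| ^+ 5 = L * (56 * E2 * `|u| ^+ 5) by ring.
exact: ler_pM.
Qed.

End OneStep.

(** * Error of the scheme along a path *)

Section Gronwall.
Context {R : realType}.
Variables (g : R -> R) (La C : R).
Hypothesis La0 : 0 <= La.
Hypothesis C0 : 0 <= C.
Hypothesis g_lip : forall x y, `|g y - g x| <= La * `|y - x|.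

Definition trap_term (b u : nat -> R) j := 2^-1 * (g (b j) + g (b j.+1)) * u j ^+ 3.
Definition trap_sum b u k := \sum_(j < k) trap_term b u j.

(** With [D k = Y k - b k], the sum [A] of (|D_j| + |D_(j+1)|) |u_j|^3 is bounded
    in terms of itself with a factor [La * V <= 1/2], hence absorbed. *)
Lemma gronwall (n : nat) (u b Y : nat -> R) :
  b 0%N = 0 -> Y 0%N = 0 ->
  (forall k, b k.+1 = b k + u k) ->
  (forall k, (k < n)%N -> `|Y k.+1 - Y k - u k - trap_term Y u k| <= C * `|u k| ^+ 5) ->
  La * (\sum_(j < n) `|u j| ^+ 3) <= 2^-1 ->
  `|Y n - b n| <= `|trap_sum b u n| + 2 * C * (\sum_(j < n) `|u j| ^+ 5) +
    La * (\sum_(j < n) (`|trap_sum b u j| + `|trap_sum b u j.+1|) * `|u j| ^+ 3).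
Proof.
move=> b0 Y0 bS YS V4.
set V := \sum_(j < n) `|u j| ^+ 3 in V4.
set E5 := \sum_(j < n) `|u j| ^+ 5.
set Z := \sum_(j < n) _ * _.
pose D k := Y k - b k.
pose A := \sum_(j < n) (`|D j| + `|D j.+1|) * `|u j| ^+ 3.
have E50 : 0 <= E5 by apply: sumr_ge0 => j _; exact: exprn_ge0.
have V0 : 0 <= V by apply: sumr_ge0 => j _; exact: exprn_ge0.
have D1 k : (k < n)%N -> `|D k.+1 - D k - trap_term b u k| <=
    C * `|u k| ^+ 5 + 2^-1 * La * ((`|D k| + `|D k.+1|) * `|u k| ^+ 3).
  move=> kn.
  have -> : D k.+1 - D k - trap_term b u k = (Y k.+1 - Y k - u k - trap_term Y u k) +
    2^-1 * ((g (Y k) - g (b k)) + (g (Y k.+1) - g (b k.+1))) * u k ^+ 3.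
    by rewrite /D /trap_term bS; ring.
  apply: le_trans (ler_normD _ _) _; apply: lerD; first exact: YS.
  rewrite (normrM _ (u k ^+ 3)) normrX (normrM 2^-1) (ger0_norm (_ : 0 <= 2^-1)) ?invr_ge0//.
  have -> (z p : R) : 2^-1 * La * (z * p) = 2^-1 * (La * z) * p by ring.
  rewrite ler_wpM2r ?exprn_ge0// ler_wpM2l ?invr_ge0//.
  by apply: le_trans (ler_normD _ _) _; rewrite mulrDr; apply: lerD; exact: g_lip.
have Dk k : (k <= n)%N -> `|D k - trap_sum b u k| <= C * E5 + 2^-1 * La * A.
  move=> kn.
  have -> : D k - trap_sum b u k = \sum_(j < k) (D j.+1 - D j - trap_term b u j).
    rewrite sumrB /trap_sum; congr (_ - _).
    rewrite -(big_mkord xpredT (fun j => D j.+1 - D j)) telescope_sumr//.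
    by rewrite {3}/D b0 Y0 !subr0.
  apply: le_trans (ler_norm_sum _ _ _) _.
  apply: (@le_trans _ _ (\sum_(j < k) (C * `|u j| ^+ 5 + 2^-1 * La * ((`|D j| + `|D j.+1|) * `|u j| ^+ 3)))).
    by apply: ler_sum => j _; apply: D1; exact: leq_trans (ltn_ord j) kn.
  rewrite big_split/= -!mulr_sumr.
  have sub (F : nat -> R) : (forall j, 0 <= F j) -> \sum_(j < k) F j <= \sum_(j < n) F j.
    move=> F0; rewrite (big_ord_widen n F)//.
    by rewrite [leRHS](bigID (fun j : 'I_n => (j < k)%N))/= lerDl sumr_ge0.
  apply: lerD.
    by apply: ler_wpM2l => //; apply: (sub (fun j => `|u j| ^+ 5)) => j; exact: exprn_ge0.
  apply: ler_wpM2l; first by rewrite mulr_ge0 ?invr_ge0.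
  apply: (sub (fun j => (`|D j| + `|D j.+1|) * `|u j| ^+ 3)) => j.
  by rewrite mulr_ge0 ?addr_ge0 ?exprn_ge0.
set Q := C * E5 + 2^-1 * La * A in Dk.
have Dn k : (k <= n)%N -> `|D k| <= `|trap_sum b u k| + Q.
  move=> kn; have := Dk k kn; have := ler_normD (trap_sum b u k) (D k - trap_sum b u k).
  have -> : trap_sum b u k + (D k - trap_sum b u k) = D k by ring.
  lra.
have AQ : A <= Z + 2 * Q * V.
  rewrite /A /Z /V mulr_sumr -big_split/=; apply: ler_sum => j _.
  rewrite -mulrDl ler_wpM2r ?exprn_ge0//.
  have := Dn j (ltnW (ltn_ord j)); have := Dn j.+1 (ltn_ord j).
  lra.
have A0 : 0 <= A by apply: sumr_ge0 => j _; rewrite mulr_ge0 ?addr_ge0 ?exprn_ge0.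
have LA : La * A <= 2 * La * Z + 2 * C * E5.
  have h1 := ler_wpM2l La0 AQ.
  have e : La * (Z + 2 * Q * V) = La * Z + 2 * C * E5 * (La * V) + La * A * (La * V).
    by rewrite /Q; field.
  rewrite e in h1.
  have h2 : 2 * C * E5 * (La * V) <= 2 * C * E5 * 2^-1 by rewrite ler_wpM2l// !mulr_ge0.
  have h3 : La * A * (La * V) <= La * A * 2^-1 by rewrite ler_wpM2l// mulr_ge0.
  by move: h1 h2 h3; lra.
have := Dn n (leqnn n); rewrite /Q -/(D n) -mulrA; move: LA; rewrite -/(D n); lra.
Qed.

End Gronwall.

Section Scheme.
Context {R : realType}.
Variables (sigma f : R -> R).
Hypothesis sigma_s : smooth_bounded sigma.
Hypothesis fd : forall x : R, is_derive x 1 f (sigma (f x)).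

Lemma implicit_map_mono (u K : R) : (forall x, `|derive1 sigma x| <= K) ->
  K * `|u| <= 1 -> forall x y, x < y ->
  x - 2^-1 * u * sigma x < y - 2^-1 * u * sigma y.
Proof.
move=> sK Ku x y xy; have [sd _] := smooth_bounded_derive sigma_s.
have h := mean_value_le (a := x) (b := y) sd (fun z _ => sK z).
have yx : 0 < y - x by rewrite subr_gt0.
rewrite (gtr0_norm yx) in h.
have h2 : `|u * (sigma y - sigma x)| <= y - x.
  rewrite normrM; apply: le_trans (ler_wpM2l (normr_ge0 u) h) _.
  by rewrite mulrA (mulrC `|u|) ler_piMl// ltW.
move: h2; rewrite ler_norml => /andP[_]; rewrite mulrBr => h2.
have -> : y - 2^-1 * u * sigma y = x - 2^-1 * u * sigma x + ((y - x) - 2^-1 * (u * sigma y - u * sigma x)) by ring.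
by rewrite ltrDl; lra.
Qed.

Lemma implicit_map_bijective (u K : R) : (forall x, `|derive1 sigma x| <= K) ->
  K * `|u| <= 1 -> bijective (fun x => x - 2^-1 * u * sigma x).
Proof.
move=> sK Ku; have mono := implicit_map_mono sK Ku.
have [M M0 sM] := smooth_bounded_bound sigma_s.
have [sd _] := smooth_bounded_derive sigma_s.
set h := fun x => _.
have inj : injective h.
  move=> x y hxy; case: (ltgtP x y) => // [/mono|/mono]; rewrite -/(h x) -/(h y) hxy ltxx//.
have surj y : exists x, h x = y.
  pose c := 2^-1 * `|u| * M.
  have c0 : 0 <= c by rewrite !mulr_ge0// invr_ge0.
  have hb x : `|2^-1 * u * sigma x| <= c.
    rewrite !normrM (ger0_norm (_ : 0 <= 2^-1)) ?invr_ge0//.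
    by apply: ler_wpM2l => //; rewrite mulr_ge0// invr_ge0.
  have hc : continuous h.
    move=> x; apply: (@cvgB _ R^o); first exact: cvg_id.
    by apply: cvgM; [exact: cvg_cst|exact: (is_derive1_continuous sd)].
  have le2 : y - c <= y + c by lra.
  have [||x _ hx] := @IVT R h (y - c) (y + c) y le2.
  - exact: continuous_subspaceT.
  - have := hb (y - c); have := hb (y + c); rewrite !ler_norml => /andP[a1 a2] /andP[b1 b2].
    rewrite ge_min le_max /h; apply/andP; split; apply/orP; [left|right]; lra.
  - by exists x.
have [k hk] := choice surj.
by apply: (@Bijective _ _ h k) => // x; apply: inj; rewrite hk.
Qed.

(** [Y] is built step by step from [step_exists]; uniqueness of the solution of
    the implicit equation shows that the scheme is [f] along [Y]. *)
Lemma scheme_error : exists g : R -> R, smooth_bounded g /\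
  exists rho C : R, [/\ 0 < rho, 0 <= C &
  forall n (u b x : nat -> R), b 0%N = 0 -> x 0%N = f 0 ->
    (forall k, b k.+1 = b k + u k) ->
    (forall k, (k < n)%N -> x k.+1 = x k + 2^-1 * (sigma (x k) + sigma (x k.+1)) * u k) ->
    \sum_(j < n) `|u j| ^+ 3 <= rho ->
    `|x n - f (b n)| <= C * (`|trap_sum g b u n| + \sum_(j < n) `|u j| ^+ 5 +
      \sum_(j < n) (`|trap_sum g b u j| + `|trap_sum g b u j.+1|) * `|u j| ^+ 3)].
Proof.
have [sd s1s] := smooth_bounded_derive sigma_s.
pose a1 := derive1 sigma \o f.
have a1s : smooth_bounded a1 by move=> k; apply: (bounded_derivs_comp fd).
have [A Ad] := antiderivative_exists (is_derive1_continuous (smooth_bounded_derive a1s).1).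
pose r x := expR (A x).
have rd (x : R) : is_derive x 1 r (r x * a1 x).
  exact: (is_derive1_comp_eq (is_derive_expR _) (Ad x)).
have r0 (x : R) : 0 < r x by exact: expR_gt0.
have [F Fd] := antiderivative_exists (is_derive1_continuous rd).
have sfd (x : R) : is_derive x 1 (sigma \o f) (a1 x * sigma (f x)) by exact: is_derive1_comp_eq.
pose c := sigma (f 0) / r 0.
have sc x : sigma (f x) = c * r x.
  have e (y : R) : is_derive y 1 (fun x => sigma (f x) * expR (- A x)) 0.
    have d1 : is_derive y 1 (fun x => - A x) (- a1 y) by apply: is_deriveN.
    have d2 := is_derive1_comp_eq (is_derive_expR _) d1.
    by apply: (is_derive_eq (is_deriveM (sfd y) d2)); rewrite /GRing.scale/=; ring.
  have := is_derive_0_is_cst x 0 e.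
  rewrite /c /r !expRN => /(congr1 ( *%R^~ (expR (A x)))).
  by rewrite mulfVK ?gt_eqF ?expR_gt0.
have fF y v : f (y + v) - f y = c * (F (y + v) - F y).
  have e (z : R) : is_derive z 1 (fun x => f x - c * F x) 0.
    apply: (is_derive_eq (is_deriveB (fd z) (is_deriveZ c (Fd z)))).
    by rewrite sc /GRing.scale/= subrr.
  have := is_derive_0_is_cst (y + v) y e => /eqP; rewrite -subr_eq0 => /eqP h.
  apply/eqP; rewrite -subr_eq0; apply/eqP; rewrite -h; ring.
pose g := cubic_coef a1.
have gs : smooth_bounded g by exact: cubic_coef_smooth.
have [gd g1s] := smooth_bounded_derive gs.
have [La La0 gLa] := smooth_bounded_bound g1s.
have [M M0 sM] := smooth_bounded_bound sigma_s.
have [K K0 sK] := smooth_bounded_bound s1s.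
have [p /andP[p0 p1] step] := step_exists Fd rd r0 a1s.
have [C C0 HC] := step_expansion Fd rd r0 a1s.
(* A bound on the increments under which the step exists and is unique. *)
pose q := Num.min p (K + 1)^-1.
have K10 : 0 < K + 1 by rewrite ltr_wpDl.
have q0 : 0 < q by rewrite lt_min p0 invr_gt0.
pose rho := Num.min (q ^+ 3) (2^-1 / (La + 1)).
have La10 : 0 < La + 1 by rewrite ltr_wpDl.
have rho0 : 0 < rho by rewrite lt_min exprn_gt0//= divr_gt0// invr_gt0.
exists g; split => //; exists rho, (M * (1 + 2 * C + La)); split => //.
  by rewrite mulr_ge0// addr_ge0// addr_ge0// mulr_ge0.
move=> n u b x b0 x0 bS xS Vrho.
have uq k : (k < n)%N -> `|u k| <= q.
  move=> kn; have : `|u k| ^+ 3 <= q ^+ 3.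
    apply: le_trans (le_trans Vrho _); last by rewrite ge_min lexx.
    rewrite (bigD1 (Ordinal kn))//= lerDl sumr_ge0// => j _; exact: exprn_ge0.
  by rewrite ler_pXn2r// nnegrE// ltW.
(* The step has to be chosen as a function of the position and the increment
   to define [Y] by recursion. *)
have /choice[vv Hvv] : forall yu : R * R, exists v, `|yu.2| <= p -> `|v| <= 2 * `|yu.2| /\
    F (yu.1 + v) - F yu.1 = 2^-1 * (r yu.1 + r (yu.1 + v)) * yu.2.
  move=> [y w] /=; have [wp|_] := boolP (`|w| <= p); last by exists 0.
  by have [v v1 v2] := step y w wp; exists v.
pose Y := fix Y k := if k is k'.+1 then Y k' + vv (Y k', u k') else 0.
have Hv k : (k < n)%N -> `|vv (Y k, u k)| <= 2 * `|u k| /\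
    F (Y k.+1) - F (Y k) = 2^-1 * (r (Y k) + r (Y k.+1)) * u k.
  move=> kn; apply: (Hvv (Y k, u k)) => /=; apply: le_trans (uq k kn) _.
  by rewrite ge_min lexx.
have xY k : (k <= n)%N -> x k = f (Y k).
  elim: k => [|k IH] kn; first exact: x0.
  have [_ e] := Hv k kn.
  have Ku : K * `|u k| <= 1.
    apply: (@le_trans _ _ ((K + 1) * (K + 1)^-1)); last by rewrite divff// gt_eqF.
    apply: ler_pM => //; first by rewrite lerDl.
    by apply: le_trans (uq k kn) _; rewrite ge_min lexx orbT.
  have inj : injective (fun x => x - 2^-1 * u k * sigma x).
    exact: bij_inj (implicit_map_bijective sK Ku).
  apply: inj; have -> : x k.+1 - 2^-1 * u k * sigma (x k.+1) = x k + 2^-1 * u k * sigma (x k).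
    by rewrite {1}(xS k kn); ring.
  rewrite IH ?(ltnW kn)//; apply/eqP; rewrite -subr_eq0; apply/eqP.
  have e2 := fF (Y k) (vv (Y k, u k)); rewrite -[Y k + _]/(Y k.+1) in e2.
  rewrite e in e2; rewrite !sc.
  have -> : f (Y k.+1) = f (Y k) + c * (2^-1 * (r (Y k) + r (Y k.+1)) * u k) by rewrite -e2; ring.
  by ring.
have v1 k : (k < n)%N -> `|vv (Y k, u k)| <= 1.
  move=> kn; have [h _] := Hv k kn; have h2 : `|u k| <= p.
    by apply: le_trans (uq k kn) _; rewrite ge_min lexx.
  lra.
have YS k : (k < n)%N -> `|Y k.+1 - Y k - u k - trap_term g Y u k| <= C * `|u k| ^+ 5.
  move=> kn; have [h1 h2] := Hv k kn.
  have e : Y k.+1 - Y k = vv (Y k, u k) by rewrite [Y k.+1]/(Y k + vv (Y k, u k)) addrAC subrr add0r.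
  by rewrite /trap_term e; exact: HC (v1 k kn) h1 h2.
have g_lip y z : `|g z - g y| <= La * `|z - y| by apply: mean_value_le => // w _.
have V4 : La * (\sum_(j < n) `|u j| ^+ 3) <= 2^-1.
  apply: (@le_trans _ _ ((La + 1) * (2^-1 / (La + 1)))).
    apply: ler_pM => //; first by apply: sumr_ge0 => j _; exact: exprn_ge0.
      by rewrite lerDl.
    by apply: le_trans Vrho _; rewrite ge_min lexx orbT.
  by rewrite mulrCA divff ?mulr1// gt_eqF.
have := gronwall La0 C0 g_lip b0 (erefl : Y 0%N = 0) bS YS V4.
set t := `|trap_sum g b u n|; set E5 := \sum_(j < n) `|u j| ^+ 5.
set Z := \sum_(j < n) _ * _ => G.
have t0 : 0 <= t by exact: normr_ge0.
have E50 : 0 <= E5 by apply: sumr_ge0 => j _; exact: exprn_ge0.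
have Z0 : 0 <= Z by apply: sumr_ge0 => j _; rewrite mulr_ge0 ?addr_ge0 ?exprn_ge0.
rewrite (xY n)//; apply: le_trans (mean_value_le (a := b n) fd (fun z _ => sM _)) _.
rewrite -[leRHS]mulrA ler_wpM2l//; apply: le_trans G _.
have -> : (1 + 2 * C + La) * (t + E5 + Z) = t + 2 * C * E5 + La * Z +
  (E5 + Z + 2 * C * (t + Z) + La * (t + E5)) by ring.
by rewrite lerDl !addr_ge0// mulr_ge0 ?addr_ge0// mulr_ge0.
Qed.

End Scheme.

(** * Measurability of integrals of paths *)

Section Caratheodory.
Context d (T : measurableType d) {R : realType}.
Local Notation mu := (@lebesgue_measure R).

(** Projection of the time axis onto [0, 1]: it turns a path on [0, 1] into a
    path on the line, constant outside [0, 1]. *)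
Definition clamp (s : R) : R := Num.max 0 (Num.min s 1).

Lemma clamp01 s : clamp s \in `[0, 1].
Proof. by rewrite in_itv/= /clamp le_max lexx/= ge_max ler01/= ge_min lexx orbT. Qed.

Lemma clamp_id s : s \in `[0, 1] -> clamp s = s.
Proof.
rewrite in_itv/= => /andP[s0 s1].
by rewrite /clamp (min_idPl s1); apply/max_idPr.
Qed.

Lemma clamp_lip s t : `|clamp s - clamp t| <= `|s - t|.
Proof.
have h (a b : R) : a <= b -> 0 <= clamp b - clamp a <= b - a.
  move=> ab; rewrite /clamp; case: (leP a 1) => a1; case: (leP b 1) => b1;
  case: (leP 0 a) => a0; case: (leP 0 b) => b0; case: (leP (0 : R) 1) => ?;
  apply/andP; split; lra.
have [ts|/ltW st] := leP t s.
  have /andP[h1 h2] := h _ _ ts; by rewrite !ger0_norm// subr_ge0.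
by have /andP[h1 h2] := h _ _ st; rewrite distrC (distrC s) !ger0_norm// subr_ge0.
Qed.

Lemma clamp_continuous : continuous clamp.
Proof.
move=> s; apply/(@cvgrPdist_le _ R^o) => e e0; near=> t.
apply: le_trans (clamp_lip _ _) _; near: t.
exact: (@cvgr_dist_le _ R^o _ _ _ id s cvg_id).
Unshelve. all: end_near. Qed.

Variable phi : R -> T -> R.
Hypothesis phi_c : forall w, continuous (phi ^~ w).
Hypothesis phi_m : forall s, measurable_fun setT (phi s).

(** A function continuous in [s] and measurable in [w] is the limit of its
    discretizations in [s]. *)
Lemma joint_measurable : measurable_fun setT (fun z : T * R => phi (clamp z.2) z.1).
Proof.
(* The discretization replaces [clamp s] by tr n s / (n + 1). *)
pose tr n (s : R) : nat := Num.trunc (n.+1%:R * clamp s).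
pose phin n (z : T * R) := phi ((tr n z.2)%:R / n.+1%:R) z.1.
have trb n s : (tr n s)%:R <= n.+1%:R * clamp s < (tr n s)%:R + 1.
  have /andP[c0 _] : 0 <= clamp s <= 1 by have := clamp01 s; rewrite in_itv.
  rewrite natr1 /tr truncnS_gt andbT truncn_le// mulr_ge0//.
apply: (@measurable_fun_cvg _ _ _ _ phin).
- move=> n; pose E (k : nat) := [set z : T * R | tr n z.2 = k].
  have mE k : measurable (E k).
    have mc : measurable_fun setT (fun s : R => n.+1%:R * clamp s).
      apply: measurable_funM => //; exact: continuous_measurable_fun clamp_continuous.
    have -> : E k = setT `&` (fun z : T * R => n.+1%:R * clamp z.2) @^-1` `[k%:R, k%:R + 1[.
      rewrite setTI; apply/seteqP; split => z /=; rewrite in_itv/=.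
        by move=> <-; exact: trb.
      move=> /andP[h1 h2]; have /andP[h3 h4] := trb n z.2.
      apply/eqP; rewrite eqn_leq; apply/andP; split; rewrite -ltnS -(ltr_nat R) -natr1.
        by apply: le_lt_trans h3 _.
      by apply: le_lt_trans h1 _.
    apply: (measurableT_comp mc measurable_snd) => //; exact: measurable_itv.
  have -> : setT = \bigcup_k E k by apply/seteqP; split => // z _; exists (tr n z.2).
  apply/measurable_fun_bigcup => // k.
  apply: (@eq_measurable_fun _ _ _ _ _ (fun z : T * R => phi (k%:R / n.+1%:R) z.1)).
    by move=> z; rewrite inE /E /phin /= => ->.
  apply: measurable_funTS; exact: (measurableT_comp (phi_m _) measurable_fst).
- move=> [w s] _; rewrite /phin/=.
  apply: (cvg_comp (fun n => (tr n s)%:R / n.+1%:R : R) (phi ^~ w)); last exact: phi_c.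
  apply/(@cvgrPdist_le _ R^o) => e e0; near=> n.
  have n0 : 0 < n.+1%:R :> R by rewrite ltr0n.
  have /andP[h1 h2] := trb n s.
  have -> : clamp s - (tr n s)%:R / n.+1%:R = (n.+1%:R * clamp s - (tr n s)%:R) / n.+1%:R.
    by field; rewrite gt_eqF.
  rewrite normrM ger0_norm ?subr_ge0// normfV (gtr0_norm n0) ler_pdivrMr//.
  apply: (@le_trans _ _ 1); first by rewrite lerBlDr addrC ltW.
  rewrite -ler_pdivrMl// mulr1 -natr1.
  apply: (@le_trans _ _ n%:R); last by rewrite lerDl.
  near: n; exact: nbhs_infty_ger.
Unshelve. all: end_near. Qed.

Lemma joint_measurable_indic (t : R) (psi : R -> R) : measurable_fun setT psi ->
  measurable_fun setT (fun z : T * R => (psi (phi (clamp z.2) z.1) * \1_(`[0, t]%classic) z.2)%:E).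
Proof.
move=> mpsi; apply/measurable_EFinP; apply: measurable_funM.
  exact: (measurableT_comp mpsi joint_measurable).
apply: (measurableT_comp _ measurable_snd); exact: measurable_indic.
Qed.

Lemma integral_clampE (t : R) w (psi : R -> R) : t \in `[0, 1] ->
  (\int[mu]_(s in `[0%R, t]) (psi (phi s w))%:E =
   \int[mu]_s (psi (phi (clamp s) w) * \1_(`[0, t]%classic) s)%:E)%E.
Proof.
move=> t01; rewrite integral_mkcond; apply: eq_integral => s _.
rewrite patchE indicE; case: ifPn => [|_]; last by rewrite mulr0.
rewrite inE/= => st; rewrite mulr1 clamp_id//.
move: st t01; rewrite !in_itv/= => /andP[a b] /andP[c e].
by rewrite a (le_trans b).
Qed.

Lemma ge0_integral_measurable (t : R) (psi : R -> R) : t \in `[0, 1] ->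
  measurable_fun setT psi -> (forall x, 0 <= psi x) ->
  measurable_fun setT (fun w => (\int[mu]_(s in `[0%R, t]) (psi (phi s w))%:E)%E).
Proof.
move=> t01 mpsi psi0.
rewrite (_ : (fun w => _) = fun w => (\int[mu]_s
  (psi (phi (clamp s) w) * \1_(`[0, t]%classic) s)%:E)%E); last first.
  by apply/funext => w; exact: integral_clampE.
have := @measurable_fun_fubini_tonelli_F _ _ T (measurableTypeR R) R mu _
  (joint_measurable_indic t mpsi).
apply => z; rewrite lee_fin mulr_ge0//.
Qed.

Lemma Rintegral_measurable (t : R) : t \in `[0, 1] ->
  measurable_fun setT (fun w => (\int[mu]_(s in `[0, t]) phi s w)%R).
Proof.
move=> t01.
have mx : measurable_fun setT (fun x : R => Num.max x 0).
  exact: measurable_maxr.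
have mxN : measurable_fun setT (fun x : R => Num.max (- x) 0).
  by apply: measurable_maxr => //; exact: oppr_measurable.
have x0 (x : R) : 0 <= Num.max x 0 by rewrite le_max lexx orbT.
have m1 := ge0_integral_measurable t01 mx x0.
have m2 := ge0_integral_measurable t01 mxN (fun x => x0 (- x)).
apply: (measurableT_comp (fine_measurable measurableT)).
rewrite (_ : (fun w => _) = (fun w => \int[mu]_(s in `[0%R, t]) (Num.max (phi s w) 0)%:E -
   \int[mu]_(s in `[0%R, t]) (Num.max (- phi s w) 0)%:E)%E).
  exact: emeasurable_funB m1 m2.
apply/funext => w; rewrite integralE; congr (_ - _)%E; apply: eq_integral => s _.
  by rewrite funeposE -EFin_max.
by rewrite funenegE -EFinN -EFin_max.
Qed.

End Caratheodory.

(** * Symmetric integrals along a path *)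

Section PathIntegral.
Context {R : realType}.
Local Notation mu := (@lebesgue_measure R).
Implicit Types (h A b : R -> R).

Lemma continuous_integrable h (x y : R) : continuous h ->
  mu.-integrable `[x, y] (EFin \o h).
Proof.
move=> hc; apply: continuous_compact_integrable; first exact: segment_compact.
exact: continuous_subspaceT.
Qed.

Lemma integral_antiderivative h A (x y : R) : continuous h ->
  (forall z : R, is_derive z 1 A (h z)) -> x <= y ->
  (\int[mu]_(s in `[x, y]) h s)%R = A y - A x.
Proof.
move=> hc Ah; rewrite le_eqVlt => /predU1P[->|xy].
  by rewrite set_itv1 Rintegral_set1 subrr.
have Ac : continuous A by exact: is_derive1_continuous Ah.
rewrite /Rintegral (@continuous_FTC2 _ h A x y xy)//.
- exact: continuous_subspaceT.
- split; first by move=> z _; exact: (@ex_derive _ _ _ _ _ _ _ (Ah z)).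
  + by apply: cvg_at_right_filter; exact: Ac.
  + by apply: cvg_at_left_filter; exact: Ac.
by move=> z _; rewrite derive1E (@derive_val _ _ _ _ _ _ _ (Ah z)).
Qed.

Lemma is_derive_shift h A (e : R) : (forall z : R, is_derive z 1 A (h z)) ->
  forall z : R, is_derive z 1 (fun s => A (s + e)) (h (z + e)).
Proof.
move=> Ah z; rewrite -[h _]mulr1.
apply: (@is_derive1_comp_eq _ (fun s => s + e) A) => //.
by rewrite -[1 in X in is_derive _ _ _ X]addr0; apply: is_deriveD.
Qed.

Lemma continuous_shift h (e : R) : continuous h -> continuous (fun s => h (s + e)).
Proof.
move=> hc s; apply: (@continuous_comp _ _ _ (fun s => s + e) h); last exact: hc.
by apply: cvgD; [exact: cvg_id|exact: cvg_cst].
Qed.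

Lemma forward_quotient h A (x eps : R) : {for x, continuous h} ->
  (forall z : R, is_derive z 1 A (h z)) -> 0 < eps ->
  exists2 dl : R, 0 < dl & forall e, 0 < e <= dl ->
    `|e^-1 * (A (x + e) - A x) - h x| <= eps.
Proof.
move=> /(@cvgrPdist_le _ R^o) hc Ah e0.
have [dl /= dl0 dlP] := hc _ e0.
exists (dl / 2); first by rewrite divr_gt0.
move=> e /andP[e0' edl].
have := @mean_value_le _ (fun z => A z - z * h x) (fun z => h z - h x) x (x + e) eps.
have -> : A (x + e) - (x + e) * h x - (A x - x * h x) = A (x + e) - A x - e * h x by ring.
have -> : x + e - x = e by ring.
rewrite (gtr0_norm e0') => H.
have -> : e^-1 * (A (x + e) - A x) - h x = e^-1 * (A (x + e) - A x - e * h x).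
  by field; rewrite gt_eqF.
rewrite normrM normfV (gtr0_norm e0') ler_pdivrMl// [e * eps]mulrC; apply: H.
  move=> z; apply: is_deriveB; rewrite -[X in is_derive _ _ _ X]mul1r.
  have -> : (fun z : R => z * h x) = h x \*: id by apply/funext => t; rewrite mulrC.
  by rewrite mul1r -[X in is_derive _ _ _ X]mulr1; apply: is_deriveZ.
move=> z zx; rewrite distrC; apply: dlP => /=; rewrite distrC.
by apply: (le_lt_trans zx); apply: (le_lt_trans edl); rewrite ltr_pdivrMr//; lra.
Qed.

(** With an antiderivative [A] of [h], the integral is a difference of two
    increments of [A] over intervals of length [e], at 1 and at 0. *)
Lemma mean_increment h (eps : R) : continuous h -> 0 < eps ->
  exists2 dl : R, 0 < dl & forall e, 0 < e <= dl ->
    `|e^-1 * (\int[mu]_(s in `[0%R, 1%R]) (h (s + e) - h s))%R - (h 1 - h 0)| <= eps.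
Proof.
move=> hc e0; have [A Ah] := antiderivative_exists hc.
have e2 : 0 < eps / 2 by rewrite divr_gt0.
have [d1 d10 P1] := forward_quotient (hc 1) Ah e2.
have [d0 d00 P0] := forward_quotient (hc 0) Ah e2.
exists (Num.min d0 d1); first by rewrite lt_min d00.
move=> e; rewrite le_min => /andP[e0' /andP[ed0 ed1]].
rewrite RintegralB//; last 2 first.
- exact: (continuous_integrable _ _ ((@continuous_shift _ e hc))).
- exact: continuous_integrable.
rewrite (integral_antiderivative ((@continuous_shift _ e hc)) (is_derive_shift e Ah))//.
rewrite (integral_antiderivative hc Ah)//.
have := P1 e; have := P0 e; rewrite e0' ed0 ed1 => /(_ isT) H0 /(_ isT) H1.
have -> : e^-1 * (A (1 + e) - A (0 + e) - (A 1 - A 0)) - (h 1 - h 0) =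
  (e^-1 * (A (1 + e) - A 1) - h 1) - (e^-1 * (A (0 + e) - A 0) - h 0) by ring.
by apply: le_trans (ler_normB _ _) _; lra.
Qed.

Lemma continuousM_fun h A : continuous h -> continuous A -> continuous (fun s => h s * A s).
Proof. by move=> hc Ac s; apply: cvgM; [exact: hc|exact: Ac]. Qed.

(** The trapezoidal rule applied to [G] between [b s] and [b (s + e)], integrated
    over [s]. *)
Lemma symmetric_path b (G g g1 g2 : R -> R) (M eps : R) : continuous b ->
  (forall s, `|b s| <= M) -> continuous g2 ->
  (forall x : R, is_derive x 1 G (g x)) -> (forall x : R, is_derive x 1 g (g1 x)) ->
  (forall x : R, is_derive x 1 g1 (g2 x)) -> 0 < eps ->
  exists C dl, [/\ 0 <= C, 0 < dl & forall e, 0 < e <= dl ->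
   `|(2 * e)^-1 * (\int[mu]_(s in `[0%R, 1%R]) ((g (b (s + e)) + g (b s)) * (b (s + e) - b s)))%R
     - (G (b 1) - G (b 0))| <=
   eps + C * (e^-1 * (\int[mu]_(s in `[0%R, 1%R]) (`|b (s + e) - b s| ^+ 3))%R)].
Proof.
move=> bc bM g2c Gd gd g1d eps0.
have Gc := is_derive1_continuous Gd; have gc := is_derive1_continuous gd.
have M0 : 0 <= M := le_trans (normr_ge0 _) (bM 0).
have g2nc : continuous (fun x => `|g2 x|) by move=> x; apply: cvg_norm; exact: g2c.
have [c _ cP] : exists2 c, c \in `[(- (3 * M)), 3 * M] & forall x, x \in `[(- (3 * M)), 3 * M] ->
    `|g2 x| <= `|g2 c|.
  apply: EVT_max; first by lra.
  exact: continuous_subspaceT.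
set C := `|g2 c| in cP.
have hc : continuous (fun s => G (b s)) by move=> s; apply: continuous_comp; [exact: bc|exact: Gc].
have [dl dl0 dlP] := mean_increment hc eps0.
exists (2 * C), dl; split; [by apply: mulr_ge0 => //; exact: normr_ge0|exact: dl0|move=> e e0].
have {dlP} := dlP e e0; case/andP: e0 => e0 _.
have bec : continuous (fun s => b (s + e) - b s).
  by move=> s; apply: cvgB; [exact: @continuous_shift _ e bc _|exact: bc].
have gbc : continuous (fun s => g (b s)) by move=> s; apply: continuous_comp; [exact: bc|exact: gc].
have trc : continuous (fun s => (g (b (s + e)) + g (b s)) * (b (s + e) - b s)).
  apply: continuousM_fun => // s.
  by apply: cvgD; [exact: ((@continuous_shift _ e gbc))|exact: gbc].
have c3 : continuous (fun s => `|b (s + e) - b s| ^+ 3).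
  have c1 : continuous (fun s => `|b (s + e) - b s|) by move=> s; apply: cvg_norm; exact: bec.
  rewrite (_ : (fun s => _) = fun s => `|b (s + e) - b s| * (`|b (s + e) - b s| * `|b (s + e) - b s|)).
    by do 2?[apply: continuousM_fun => //].
  by apply/funext => s; rewrite !exprS expr0 mulr1.
have dGc : continuous (fun s => G (b (s + e)) - G (b s)).
  by move=> s; apply: cvgB; [exact: ((@continuous_shift _ e hc))|exact: hc].
set I3 := (\int[mu]_(s in _) (_ ^+ 3))%R.
set I1 := (\int[mu]_(s in _) (_ * _))%R.
set IG := (\int[mu]_(s in _) (G _ - _))%R => HG.
suff H : `|IG - 2^-1 * I1| <= 2 * C * I3.
  have -> : (2 * e)^-1 * I1 - (G (b 1) - G (b 0)) =
    (e^-1 * IG - (G (b 1) - G (b 0))) - e^-1 * (IG - 2^-1 * I1) by field; rewrite gt_eqF.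
  apply: le_trans (ler_normB _ _) _; apply: lerD => //.
  rewrite normrM normfV (gtr0_norm e0) mulrCA ler_wpM2l//.
  by rewrite invr_ge0 ltW.
rewrite /IG /I1 -RintegralZl//; last exact: continuous_integrable.
rewrite -RintegralB//; last 2 first.
- exact: continuous_integrable.
- exact: (continuous_integrable _ _ (@continuousM_fun (fun=> 2^-1) _ (fun=> cvg_cst _) trc)).
rewrite /I3 -RintegralZl//; last exact: continuous_integrable.
have dc : continuous (fun s => G (b (s + e)) - G (b s) -
   2^-1 * ((g (b (s + e)) + g (b s)) * (b (s + e) - b s))).
  move=> s; apply: cvgB; first exact: dGc.
  exact: (continuousM_fun (fun=> cvg_cst _) trc).
apply: le_trans (le_normr_Rintegral _ _) _ => //.
  exact: continuous_integrable.
apply: le_Rintegral => //.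
- by apply: (continuous_integrable 0 1) => s; apply: cvg_norm; exact: dc.
- exact: (continuous_integrable _ _ (continuousM_fun (fun=> cvg_cst _) c3)).
move=> s _; rewrite mulrA [g _ + _]addrC.
apply: (trapezoid_le Gd gd g1d) => x xs; apply: cP.
rewrite in_itv/= -ler_norml.
have := ler_normD (x - b s) (b s); rewrite subrK => h1; apply: le_trans h1 _.
have := ler_normB (b (s + e)) (b s); have := bM s; have := bM (s + e); lra.
Qed.

End PathIntegral.

(** * Identification of the solution *)

Section InfinitelyOften.
Context d (T : measurableType d) {R : realType} (P : probability T R).

(** Otherwise [N] would be covered by the sets where all [A n] with [n >= m]
    occur, which are negligible. *)
Lemma exists_infinitely_often (A : nat -> set T) (N : set T) :
  (forall n, measurable (A n)) -> measurable N ->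
  (P (A n) @[n --> \oo] --> 0)%E -> (0 < P N)%E ->
  exists2 w, N w & forall m, exists2 n, (m <= n)%N & ~ A n w.
Proof.
move=> mA mN PA PN; apply: contrapT => /forall2NP nw.
pose D m := \bigcap_(n in [set n | (m <= n)%N]) A n.
have mD m : measurable (D m).
  by apply: bigcap_measurable => //; exists m => /=.
have D0 m : P (D m) = 0%E.
  apply/eqP; rewrite eq_le measure_ge0 andbT.
  apply: (cvge_ge _ PA); near=> n.
  apply: le_measure; rewrite ?inE//.
  by move=> w; apply => /=; near: n; exact: nbhs_infty_ge.
suff : P N = 0%E by move=> PN0; move: PN; rewrite PN0 ltxx.
apply: (@subset_measure0 _ _ _ P N (\bigcup_m D m)) => //.
- exact: bigcup_measurable.
- move=> w Nw; have [//|/existsNP[m wm]] := nw w.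
  exists m => // n /= mn; apply: contrapT => An; apply: wm.
  by exists n.
apply/negligibleP; first exact: bigcup_measurable.
by apply: negligible_bigcup => k; exists (D k); split; [exact: mD|exact: D0|].
Unshelve. all: end_near. Qed.
End InfinitelyOften.

Section Paths.
Context d (T : measurableType d) {R : realType} (P : probability T R) (H : R)
  (B : R -> {RV P >-> R}).
Local Notation mu := (@lebesgue_measure R).
Hypothesis H13 : 3^-1 < H.
Hypothesis H12 : H < 2^-1.
Hypothesis Bfbm : fractional_brownian_motion H B.

Definition clamped_path (s : R) (w : T) : R := B (clamp s) w.
Local Notation path := clamped_path.

Lemma path_id s w : s \in `[0, 1] -> path s w = B s w.
Proof. by move=> s01; rewrite /clamped_path clamp_id. Qed.

Lemma path_continuous w : continuous (path ^~ w).
Proof.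
have [_ _ _ /(_ w) /subspace_continuousP Bc] := Bfbm.
move=> s; apply: (@cvg_comp _ _ _ clamp (fun t => B t w) (nbhs s)
  (within `[0, 1] (nbhs (clamp s))) (nbhs (B (clamp s) w))); last first.
  by apply: Bc; exact: clamp01.
move=> A nA.
have : nbhs s (clamp @^-1` [set x | `[0, 1]%classic x -> A x]) := clamp_continuous nA.
by apply: filterS => t /= At; apply: At; exact: clamp01.
Qed.

Lemma path_bounded w : exists M, forall s, `|path s w| <= M.
Proof.
have nc : continuous (fun s => `|path s w|).
  by move=> s; apply: cvg_norm; exact: path_continuous.
have [c _ cP] := EVT_max ler01 (continuous_subspaceT nc).
exists `|path c w| => s; have := cP _ (clamp01 s).
by rewrite /clamped_path (clamp_id (clamp01 s)).
Qed.

Lemma path_measurable s : measurable_fun setT (path s).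
Proof. exact: measurable_funPT. Qed.

Lemma path_incr_cube s e : 0 < e ->
  (\int[P]_w (`|path (s + e) w - path s w| ^+ 3)%:E <= (2 * (e `^ H) ^+ 3)%:E)%E.
Proof.
move=> e0; have H0 : 0 < H by apply: lt_trans H13; rewrite invr_gt0.
have l0 : 0 < e `^ H by exact: powR_gt0.
pose X w := B (clamp (s + e)) w - B (clamp s) w.
have gX : gspan B X := gspan_incr B (clamp01 s) (clamp01 (s + e)).
have aX : all_moments P X := gspan_am Bfbm gX.
have v0 : 0 <= Ex P (fun w => X w ^+ 2) by apply: Ex_ge0 => w; exact: sqr_ge0.
have vl : Ex P (fun w => X w ^+ 2) <= (e `^ H) ^+ 2.
  rewrite (incr_var H0 H12 Bfbm (clamp01 _) (clamp01 _)) mulrC powRrM.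
  rewrite powR_mulrn ?powR_ge0//.
  apply: lerXn2r; rewrite ?nnegrE ?powR_ge0//.
  apply: ge0_ler_powR; rewrite ?nnegrE//; first exact: ltW.
    exact: ltW.
  by apply: le_trans (clamp_lip _ _) _; rewrite addrAC subrr add0r gtr0_norm.
have EX4 : Ex P (fun w => X w ^+ 4) = 3 * Ex P (fun w => X w ^+ 2) ^+ 2.
  by rewrite (gs_rec (gspan_space Bfbm) 2 gX) -mulrA -expr2.
rewrite (integral_Ex (all_momentsX 3 (all_moments_norm aX))) lee_fin.
apply: (@le_trans _ _ (2^-1 * (e `^ H * Ex P (fun w => X w ^+ 2) +
    (e `^ H)^-1 * Ex P (fun w => X w ^+ 4)))).
  rewrite -!ExZ; [|by repeat first [exact: aX|apply: all_momentsX|apply: all_momentsD|apply: all_momentsZ]..].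
  rewrite -ExD; [|by repeat first [exact: aX|apply: all_momentsX|apply: all_momentsD|apply: all_momentsZ]..].
  rewrite -ExZ; last by repeat first [exact: aX|apply: all_momentsX|apply: all_momentsD|apply: all_momentsZ].
  apply: Ex_le => [||w].
  - by apply: all_momentsX; exact: all_moments_norm.
  - by repeat first [exact: aX|apply: all_momentsX|apply: all_momentsD|apply: all_momentsZ].
  have := @young_half _ (e `^ H) `|X w| (X w ^+ 2) l0.
  have -> : `|X w| * X w ^+ 2 = `|X w| ^+ 3 by rewrite -real_normK ?num_real// -exprS.
  by rewrite real_normK ?num_real// -exprM.
rewrite EX4; set v := Ex _ _ in v0 vl *; set l := e `^ H in l0 vl *.
apply: (@le_trans _ _ (2^-1 * (l * l ^+ 2 + l^-1 * (3 * (l ^+ 2) ^+ 2)))); last first.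
  by rewrite le_eqVlt; apply/orP; left; apply/eqP; field; rewrite gt_eqF.
rewrite ler_pM2l ?invr_gt0//; apply: lerD; rewrite ler_pM2l ?invr_gt0//.
by rewrite ler_pM2l//; apply: lerXn2r; rewrite ?nnegrE// sqr_ge0.
Qed.

Let phi (e s : R) w := path (s + e) w - path s w.

Lemma path_incr_continuous e w : continuous (phi e ^~ w).
Proof.
move=> s; apply: cvgB; last exact: path_continuous.
exact: (@continuous_shift _ (path ^~ w) e (@path_continuous w) s).
Qed.

Lemma path_incr_measurable e s : measurable_fun setT (phi e s).
Proof. by apply: measurable_funB; exact: path_measurable. Qed.

(** The scale-[e] cubic variation, which bounds the error of the trapezoidal
    rule in [symmetric_path]. *)
Definition roughness (e : R) (w : T) : R :=
  e^-1 * (\int[mu]_(s in `[0%R, 1%R]) (`|path (s + e) w - path s w| ^+ 3))%R.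

Lemma cube_continuous e w : continuous (fun s => `|phi e s w| ^+ 3).
Proof.
have c1 : continuous (fun s => `|phi e s w|) by move=> s; apply: cvg_norm; exact: path_incr_continuous.
rewrite (_ : (fun s => _) = fun s => `|phi e s w| * (`|phi e s w| * `|phi e s w|)).
  by do 2?[apply: continuousM_fun => //].
by apply/funext => s; rewrite !exprS expr0 mulr1.
Qed.

Lemma cube_measurable e s : measurable_fun setT (fun w => `|phi e s w| ^+ 3).
Proof. by apply: measurable_normX; exact: path_incr_measurable. Qed.

Lemma roughness_measurable e : measurable_fun setT (roughness e).
Proof.
apply: measurable_funM => //.
apply: (@Rintegral_measurable _ _ _ (fun s w => `|phi e s w| ^+ 3)).
- exact: cube_continuous.
- exact: cube_measurable.
- by rewrite in_itv/= ler01 lexx.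
Qed.

Lemma roughness_ge0 e w : 0 < e -> 0 <= roughness e w.
Proof.
move=> e0; rewrite /roughness; apply: mulr_ge0; first by rewrite invr_ge0 ltW.
by apply: Rintegral_ge0 => s _; rewrite exprn_ge0.
Qed.

Lemma roughness_mean e : 0 < e ->
  (\int[P]_w (roughness e w)%:E <= (e^-1 * (2 * (e `^ H) ^+ 3))%:E)%E.
Proof.
move=> e0; have i01 : (1 : R) \in `[0, 1] by rewrite in_itv/= ler01 lexx.
rewrite (_ : (fun w => _) = fun w => ((e^-1)%:E * \int[mu]_s
  (`|phi e (clamp s) w| ^+ 3 * \1_(`[0, 1]%classic) s)%:E)%E); last first.
  apply/funext => w.
  rewrite -(@integral_clampE _ T R (fun s w => `|phi e s w| ^+ 3) 1 w id i01).
  rewrite /roughness EFinM /Rintegral fineK//.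
  apply: integrable_fin_num => //.
  exact: (continuous_integrable _ _ (@cube_continuous e w)).
have mj := @joint_measurable_indic _ T R (fun s w => `|phi e s w| ^+ 3)
  (@cube_continuous e) (cube_measurable e) 1 id (@measurable_id _ _ _).
have j0 (z : T * R) : (0 <= (`|phi e (clamp z.2) z.1| ^+ 3 * \1_(`[0%R, 1%R]%classic) z.2)%:E)%E.
  by rewrite lee_fin mulr_ge0// exprn_ge0.
rewrite ge0_integralZl//; last 3 first.
- exact: (@measurable_fun_fubini_tonelli_F _ _ T (measurableTypeR R) R mu _ mj j0).
- by move=> w _; apply: integral_ge0 => s _; exact: (j0 (w, s)).
- by rewrite lee_fin invr_ge0 ltW.
rewrite EFinM lee_wpmul2l ?lee_fin ?invr_ge0 ?(ltW e0)//.
rewrite (@fubini_tonelli _ _ T (measurableTypeR R) R P mu _ mj j0).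
apply: (@le_trans _ _ (\int[mu]_s ((2 * (e `^ H) ^+ 3) * \1_(`[0%R, 1%R]%classic) s)%:E)%E).
  apply: ge0_le_integral => //.
  - by move=> s _; apply: integral_ge0 => w _; exact: (j0 (w, s)).
  - exact: (@measurable_fun_fubini_tonelli_G _ _ T (measurableTypeR R) R P _ mj j0).
  - apply/measurable_EFinP; apply: measurable_funM => //; exact: measurable_indic.
  - move=> s _ /=.
    rewrite indicE; case: (boolP (s \in _)) => s01.
      under eq_integral do rewrite mulr1.
      by rewrite mulr1; exact: path_incr_cube.
    under eq_integral do rewrite mulr0.
    by rewrite mulr0 integral0.
under eq_integral do rewrite EFinM.
rewrite ge0_integralZl//; last 2 first.
- by apply/measurable_EFinP; exact: measurable_indic.
- by rewrite lee_fin; apply: mulr_ge0 => //; rewrite exprn_ge0// powR_ge0.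
rewrite integral_indic// setIT.
have E : mu `[0%R, 1%R]%classic = 1%E.
  by rewrite lebesgue_measure_itv/= lte_fin ltr01 -EFinD subr0.
have := lexx ((2 * (e `^ H) ^+ 3)%:E * 1)%E; rewrite -{1}E mule1; exact.
Qed.

End Paths.

Section ToZero.
Context d (T : measurableType d) {R : realType} (P : probability T R).

Lemma probability_cvg0 (A : nat -> set T) : (forall n, measurable (A n)) ->
  (forall e : R, 0 < e -> \forall n \near \oo, (P (A n) <= e%:E)%E) ->
  (P (A n) @[n --> \oo] --> 0)%E.
Proof.
move=> mA PA; apply/fine_cvgP; split.
  by apply: nearW => n; exact: fin_num_measure.
apply/(@cvgrPdist_le _ R^o) => e e0; have := PA e e0; apply: filterS => n PAn /=.
rewrite sub0r normrN ger0_norm ?fine_ge0//.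
by rewrite -lee_fin fineK// fin_num_measure.
Qed.

Lemma probability_near (A : nat -> set T) : (P (A n) @[n --> \oo] --> 0)%E ->
  forall e : R, 0 < e -> \forall n \near \oo, (P (A n) <= e%:E)%E.
Proof.
move=> PA e e0; have /fine_cvgP[fA] := PA.
move/(@cvgrPdist_le _ R^o) => /(_ e e0) h; near=> n.
have An : P (A n) \is a fin_num by near: n.
rewrite -(fineK An) lee_fin.
have : `|0 - fine (P (A n))| <= e by near: n.
by rewrite sub0r normrN; apply: le_trans; exact: ler_norm.
Unshelve. all: end_near. Qed.

Lemma powR_small (g eps : R) : 0 < g -> 0 < eps ->
  exists2 dl : R, 0 < dl & forall e, 0 < e <= dl -> e `^ g <= eps.
Proof.
move=> g0 e0; exists (eps `^ g^-1); first exact: powR_gt0.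
move=> e /andP[e00 eg]; apply: le_trans (_ : (eps `^ g^-1) `^ g <= _).
  by apply: ge0_ler_powR; rewrite ?nnegrE ?powR_ge0//; exact: ltW.
by rewrite -powRrM mulVf ?gt_eqF// powRr1// ltW.
Qed.

Lemma harmonic_small (dl : R) : 0 < dl -> \forall n \near \oo, n.+1%:R^-1 <= dl.
Proof.
move=> dl0; near=> n; rewrite invf_ple ?posrE ?ltr0n//.
apply: (@le_trans _ _ n%:R); last by rewrite ler_nat.
by near: n; exact: nbhs_infty_ger.
Unshelve. all: end_near. Qed.

Lemma harmonic_at_right : n.+1%:R^-1 @[n --> \oo] --> (0 : R)^'+.
Proof.
move=> A [e /= e0 eA]; have e2 : 0 < e / 2 by rewrite divr_gt0.
have := harmonic_small e2; apply: filterS => n ne; apply: eA => /=.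
  rewrite sub0r normrN gtr0_norm; last by rewrite invr_gt0.
  by apply: le_lt_trans ne _; rewrite ltr_pdivrMr//; lra.
by rewrite invr_gt0.
Qed.

End ToZero.

Section Identification.
Context d (T : measurableType d) {R : realType} (P : probability T R) (H : R)
  (B : R -> {RV P >-> R}).
Local Notation mu := (@lebesgue_measure R).
Hypothesis H13 : 3^-1 < H.
Hypothesis H12 : H < 2^-1.
Hypothesis Bfbm : fractional_brownian_motion H B.
Local Notation path := (clamped_path B).

Let i01 : (1 : R) \in `[0, 1]. Proof. by rewrite in_itv/= ler01 lexx. Qed.
Let i00 : (0 : R) \in `[0, 1]. Proof. by rewrite in_itv/= lexx ler01. Qed.

Lemma fbm_start : P [set w | B 0 w != 0] = 0%E.
Proof.
have aB := am_B Bfbm i00.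
have : Ex P (fun w => B 0 w * B 0 w) = 0.
  have := cov_B Bfbm i00 i00; rewrite /covar /fbm_cov => ->.
  by rewrite !subrr normr0 powR0 ?mulf_neq0 ?addr0 ?subr0 ?mulr0// gt_eqF// (lt_trans _ H13)// invr_gt0.
move=> E0; have mB : measurable_fun setT (fun w => B 0 w * B 0 w) by apply: measurable_funM.
have B20 w : 0 <= B 0 w * B 0 w by rewrite -expr2 sqr_ge0.
have -> : [set w | B 0 w != 0] = \bigcup_k [set w | k.+1%:R^-1 < B 0 w * B 0 w].
  apply/seteqP; split => w /=.
    move=> Bw; have Bw0 : 0 < (B 0 w * B 0 w) / 2 by rewrite divr_gt0// lt_neqAle B20 eq_sym mulf_neq0.
    have [m _ mP] := harmonic_small Bw0; exists m => //=.
    by apply: le_lt_trans (mP m (leqnn m)) _; rewrite ltr_pdivrMr//; lra.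
  move=> [k _ /=]; apply: contraTneq => ->; rewrite mulr0 -leNgt.
  by rewrite invr_ge0.
have mA k : measurable [set w | k.+1%:R^-1 < B 0 w * B 0 w] by exact: measurable_lt.
apply/negligibleP; first exact: bigcup_measurable.
apply: negligible_bigcup => k; exists [set w | k.+1%:R^-1 < B 0 w * B 0 w]; split => //.
apply/eqP; rewrite eq_le measure_ge0 andbT.
have k0 : 0 < k.+1%:R^-1 :> R by rewrite invr_gt0.
apply: le_trans (markov_integral P mB B20 k0) _.
by rewrite integral_Ex ?E0 ?mule0//; exact: all_momentsM.
Qed.

Lemma symmetric_approxE (Z : R -> T -> R) (sg : R -> R) e t w :
  (forall t, t \in `[0, 1] -> Z t w = sg (B t w)) -> 0 < e -> t \in `[0, 1] ->
  symmetric_approx Z (fun t => B t) e t w = (2 * e)^-1 * (\int[mu]_(s in `[0%R, t])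
    ((sg (path (s + e) w) + sg (path s w)) * (path (s + e) w - path s w)))%R.
Proof.
move=> ZE e0 t01; rewrite /symmetric_approx; congr (_ * _).
apply: eq_Rintegral => s; rewrite inE/= in_itv/= => /andP[s0 st].
have s01 : s \in `[0, 1].
  by rewrite in_itv/= s0 (le_trans st)//; move: t01; rewrite in_itv/= => /andP[].
have E : Num.min (s + e) 1 = clamp (s + e).
  by rewrite /clamp; apply/esym/max_idPr; rewrite le_min ler01 addr_ge0// ltW.
by rewrite E !ZE ?clamp01// /clamped_path (clamp_id s01).
Qed.

Let F sg (e s : R) w := (sg (path (s + e) w) + sg (path s w)) * (path (s + e) w - path s w).

Lemma symmetric_integrand_continuous sg e w : continuous sg -> continuous (F sg e ^~ w).
Proof.
move=> sgc.
have c1 : continuous (fun s => sg (path s w)).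
  by move=> s; apply: continuous_comp; [exact: (path_continuous Bfbm)|exact: sgc].
apply: continuousM_fun => s.
  by apply: cvgD; [exact: (@continuous_shift _ _ e c1)|exact: c1].
by apply: cvgB; [exact: (@continuous_shift _ _ e (@path_continuous _ _ _ _ _ _ Bfbm w))|exact: (path_continuous Bfbm)].
Qed.

Lemma symmetric_integrand_measurable sg e s : continuous sg -> measurable_fun setT (F sg e s).
Proof.
move=> sgc; have msg := continuous_measurable_fun sgc.
by apply: measurable_funM; [apply: measurable_funD; apply: (measurableT_comp msg)
  |apply: measurable_funB]; exact: path_measurable.
Qed.

(** The error is continuous in the time [t], so that rational times suffice. *)
Lemma error_event_measurable (Z J : R -> T -> R) sg j e eta :
  (forall t w, t \in `[0, 1] -> Z t w = sg (B t w)) -> continuous sg ->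
  (forall t w, t \in `[0, 1] -> J t w = j (B t w)) -> continuous j -> 0 < e ->
  measurable [set w | exists2 t : R, t \in `[0, 1] &
         eta < `|symmetric_approx Z (fun t => B t) e t w - J t w| ].
Proof.
move=> ZE sgc JE jc e0.
pose L t w := (2 * e)^-1 * (\int[mu]_(s in `[0%R, clamp t]) F sg e s w)%R - j (path t w).
have LE t w : t \in `[0, 1] -> symmetric_approx Z (fun t => B t) e t w - J t w = L t w.
  move=> t01; rewrite (@symmetric_approxE _ sg)//; last by move=> *; exact: ZE.
  by rewrite /L (clamp_id t01) JE// /clamped_path (clamp_id t01).
have Lm t : measurable_fun setT (L t).
  apply: measurable_funB.
    apply: measurable_funM => //; apply: (@Rintegral_measurable _ _ _ (F sg e)).
    - by move=> w; exact: symmetric_integrand_continuous.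
    - by move=> s; exact: symmetric_integrand_measurable.
    - exact: clamp01.
  by apply: measurableT_comp; [exact: continuous_measurable_fun|exact: path_measurable].
have Lc w : continuous (L ^~ w).
  have [A Ah] := antiderivative_exists (@symmetric_integrand_continuous sg e w sgc).
  rewrite (_ : (L ^~ w) = fun t => (2 * e)^-1 * (A (clamp t) - A 0) - j (path t w)); last first.
    apply/funext => t; rewrite /L (integral_antiderivative (@symmetric_integrand_continuous sg e w sgc) Ah)//.
    by have := clamp01 t; rewrite in_itv/= => /andP[].
  move=> t; apply: cvgB.
    apply: cvgM; first exact: cvg_cst.
    apply: cvgB; last exact: cvg_cst.
    apply: continuous_comp; [exact: clamp_continuous|exact: (is_derive1_continuous Ah)].
  by apply: continuous_comp; [exact: (path_continuous Bfbm)|exact: jc].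
rewrite (_ : [set w | _] = \bigcup_(q : rat) [set w | eta < `|L (ratr q) w| ]).
  apply: countable_bigcupT_measurable; first exact: countableP.
  by move=> q; apply: measurable_lt; exact: measurableT_comp.
apply/seteqP; split => w /=.
  move=> [t t01]; rewrite LE// => tP.
  have nc : continuous (fun s => `|L s w|) by move=> s; apply: cvg_norm; exact: Lc.
  have oU : open [set s : R | eta < `|L s w| ].
    by apply: (open_comp _ (@open_gt _ eta)) => s _; exact: nc.
  have [x [/= xP [q _ qx]]] := @dense_rat R _ (ex_intro _ t tP) oU.
  by exists q; rewrite //= qx.
move=> [q _ /= qP]; exists (clamp (ratr q)); first exact: clamp01.
rewrite LE ?clamp01//; move: qP.
by rewrite /L /clamped_path (clamp_id (clamp01 _)).
Qed.

(** Half of the exponent 3H - 1 of the mean roughness, so that e^rough_exponent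
    tends to 0 and yet dominates the mean roughness. *)
Let rough_exponent := (3 * H - 1) / 2.

Lemma rough_exponent_gt0 : 0 < rough_exponent.
Proof. by rewrite divr_gt0// subr_gt0 mulrC -ltr_pdivrMr// mul1r. Qed.

(** Markov's inequality leaves (mean roughness) / e^rough_exponent, of order
    e^rough_exponent. *)
Lemma rough_event_small : (P [set w | (n.+1%:R^-1 `^ rough_exponent < roughness B n.+1%:R^-1 w)%R]
  @[n --> \oo] --> 0)%E.
Proof.
apply: probability_cvg0 => [n|eps eps0].
  by apply: measurable_lt; exact: (roughness_measurable Bfbm).
have eps2 : 0 < eps / 2 by rewrite divr_gt0.
have [dl dl0 dlP] := powR_small rough_exponent_gt0 eps2.
have := harmonic_small dl0; apply: filterS => n ndl.
set e := n.+1%:R^-1 in ndl *; have e0 : 0 < e by rewrite invr_gt0.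
apply: le_trans (markov_integral P (roughness_measurable Bfbm e) (fun w => roughness_ge0 B w e0) (powR_gt0 rough_exponent e0)) _.
apply: (@le_trans _ _ ((e `^ rough_exponent)^-1%:E * (e^-1 * (2 * (e `^ H) ^+ 3))%:E)%E).
  rewrite lee_wpmul2l//; first by rewrite lee_fin invr_ge0 powR_ge0.
  exact: (roughness_mean H13 H12 Bfbm).
rewrite -EFinM lee_fin.
have -> : (e `^ H) ^+ 3 = e `^ rough_exponent * e `^ rough_exponent * e.
  rewrite -[X in _ * X]powRr1 ?ltW// -!powRD ?(gt_eqF e0) ?implybT//.
  by rewrite -powR_mulrn ?powR_ge0// -powRrM; congr (_ `^ _); rewrite /rough_exponent; lra.
have g0 := powR_gt0 rough_exponent e0.
have := dlP e; rewrite e0 ndl => /(_ isT) eg.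
apply: le_trans (_ : 2 * e `^ rough_exponent <= _); last by lra.
by rewrite le_eqVlt; apply/orP; left; apply/eqP; field; rewrite !gt_eqF.
Qed.

(** Let [Phi y = f y - x0 - (G y - G 0)] with [G' = sigma \o f].  If [Phi] did not
    vanish at [y], there would be an event of positive probability on which
    [B 0 = 0] and [Phi (B 1)] stays away from 0.  Along e = 1/(n+1), some outcome
    of this event satisfies, for infinitely many n, both the closeness to the
    symmetric integral and the smallness of the roughness, which makes
    [Phi (B 1)] small. *)
Lemma solution_flow (sigma f : R -> R) (x0 : R) (X : R -> T -> R) :
  smooth_bounded sigma -> class_C 5 f ->
  (forall (t : R) (w : T), t \in `[0, 1] -> X t w = f (B t w)) ->
  is_symmetric_integral P (fun t w => sigma (X t w)) B (fun t w => X t w - x0) ->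
  (forall x : R, is_derive x 1 f (sigma (f x))) /\ f 0 = x0.
Proof.
move=> sm [fd _] XE Xint.
have D j (x : R) : (j < 5)%N -> is_derive x 1 (derive1n j f) (derive1n j.+1 f x).
  by move=> j5; apply: DeriveDef; [exact: fd|rewrite -derive1E].
have f0 (x : R) : is_derive x 1 f (derive1n 1 f x) := D 0%N x isT.
have fc : continuous f := is_derive1_continuous f0.
have [sd sm1] := smooth_bounded_derive sm.
have [sd1 sm2] := smooth_bounded_derive sm1.
have [sd2 _] := smooth_bounded_derive sm2.
pose sg x := sigma (f x).
pose sg1 x := derive1 sigma (f x) * derive1n 1 f x.
pose sg2 x := derive1 sigma (f x) * derive1n 2 f x +
  derive1n 1 f x * (derive1 (derive1 sigma) (f x) * derive1n 1 f x).
have sgd (x : R) : is_derive x 1 sg (sg1 x) by apply: is_derive1_comp_eq.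
have sgd1 (x : R) : is_derive x 1 sg1 (sg2 x).
  apply: (@is_deriveM _ _ (fun x => derive1 sigma (f x)) (derive1n 1 f)).
  exact: (D 1%N).
have sgc : continuous sg := is_derive1_continuous sgd.
have s1c : continuous (fun x => derive1 sigma (f x)).
  by apply: (@is_derive1_continuous _ _ _) => x; exact: (is_derive1_comp_eq (sd1 _) (f0 x)).
have s2c : continuous (fun x => derive1 (derive1 sigma) (f x)).
  by apply: (@is_derive1_continuous _ _ _) => x; exact: (is_derive1_comp_eq (sd2 _) (f0 x)).
have f1c : continuous (derive1n 1 f).
  by apply: (@is_derive1_continuous _ _ _) => x; exact: (D 1%N).
have f2c : continuous (derive1n 2 f).
  by apply: (@is_derive1_continuous _ _ _) => x; exact: (D 2%N).
have sg2c : continuous sg2.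
  move=> x; apply: cvgD; first exact: (continuousM_fun s1c f2c).
  exact: (continuousM_fun f1c (continuousM_fun s2c f1c)).
have [G Gd] := antiderivative_exists sgc.
have Gc : continuous G := is_derive1_continuous Gd.
pose Phi y := f y - x0 - (G y - G 0).
have Phic : continuous Phi.
  move=> y; apply: cvgB; first by apply: cvgB; [exact: fc|exact: cvg_cst].
  by apply: cvgB; [exact: Gc|exact: cvg_cst].
suff Phi0 y : Phi y = 0.
  have fE : f = fun y => x0 + (G y - G 0).
    by apply/funext => y; have := Phi0 y; rewrite /Phi; lra.
  split; last by rewrite fE subrr addr0.
  move=> x; rewrite -[sigma (f x)]/(sg x) {1}fE.
  have -> : sg x = 0 + (sg x - 0) by rewrite add0r subr0.
  by apply: is_deriveD; apply: is_deriveB.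
apply/eqP; apply: contrapT => /negP Phiy.
pose eta := `|Phi y| / 2.
have eta0 : 0 < eta by rewrite divr_gt0// normr_gt0.
have eta4 : 0 < eta / 4 by rewrite divr_gt0.
pose N := [set w | B 0 w == 0] `&` [set w | eta < `|Phi (B 1 w)| ].
have mB0 : measurable [set w | B 0 w != 0].
  rewrite (_ : [set w | _] = [set w | 0 < `|B 0 w| ]).
    by apply: measurable_lt; exact: measurableT_comp.
  by apply/seteqP; split => w /=; rewrite normr_gt0.
have mPhi : measurable [set w | eta < `|Phi (B 1 w)| ].
  apply: measurable_lt; apply: measurableT_comp => //.
  by apply: measurableT_comp => //; exact: continuous_measurable_fun.
have mN : measurable N.
  apply: measurableI => //; rewrite (_ : [set w | _] = ~` [set w | B 0 w != 0]).
    exact: measurableC.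
  by apply/seteqP; split => w /=; [move=> ->|move=> /negP; rewrite negbK].
have PN : (0 < P N)%E.
  have nc : continuous (fun z => `|Phi z|) by move=> s; apply: cvg_norm; exact: Phic.
  have : \forall z \near y, eta < `|Phi z|.
    apply: (cvgr_gt _ (nc y)); rewrite /eta.
    by rewrite ltr_pdivrMr// mulr_natr mulr2n ltrDl normr_gt0.
  move=> [dl /= dl0 dlP].
  have gB := gspan_B B i01.
  have PI : (0 < P (B 1%R @^-1` `](y - dl)%R, (y + dl)%R[%classic))%E.
    apply: gaussian_support.
    - exact: (gspan_measurable gB).
    - exact: (gspan_gaussian Bfbm gB).
    - exact: (fbm_mean Bfbm i01).
    - have := cov_B Bfbm i01 i01; rewrite /covar /fbm_cov => E.
      rewrite (_ : (fun w => _) = fun w => B 1 w * B 1 w) ?E; last by apply/funext => w; rewrite expr2.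
      have H2 : 2 * H != 0 by rewrite mulf_neq0// gt_eqF// (lt_trans _ H13)// invr_gt0.
      by rewrite subrr normr0 powR1 (powR0 H2) subr0 mulf_neq0// gt_eqF.
    - by rewrite ltrD2l gtrN.
  have mI : measurable (B 1 @^-1` `](y - dl), (y + dl)[%classic).
    rewrite -[X in measurable X]setTI; apply: measurable_funPT => //.
  apply: lt_le_trans PI _.
  apply: (@le_trans _ _ (P (N `|` [set w | B 0 w != 0]))).
    apply: le_measure; rewrite ?inE//; first exact: measurableU.
    move=> w /=; rewrite in_itv/= => Bw; case: (boolP (B 0 w == 0)) => B0; last by right.
    left; split => //=; apply: dlP => /=.
    by rewrite ltr_distlC; move: Bw => /andP[? ?]; apply/andP; split; lra.
  apply: le_trans (measureU2 _ mN mB0) _.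
  rewrite -[leRHS]adde0; apply: leeD => //.
  rewrite le_eqVlt; apply/orP; left; apply/eqP; exact: fbm_start.
pose e_ n : R := n.+1%:R^-1.
have e0 n : 0 < e_ n by rewrite invr_gt0.
pose bad n := [set w | exists2 t : R, t \in `[0, 1] & eta / 4 <
  `|symmetric_approx (fun t w => sigma (X t w)) (fun t => B t) (e_ n) t w - (X t w - x0)| ].
pose rough n := [set w | e_ n `^ rough_exponent < roughness B (e_ n) w].
have mbad n : measurable (bad n).
  apply: (@error_event_measurable _ (fun t w => X t w - x0) sg (fun y => f y - x0)) => //.
  - by move=> t w t01; rewrite XE.
  - by move=> t w t01; rewrite XE.
  - by move=> z; apply: cvgB; [exact: fc|exact: cvg_cst].
have mrough n : measurable (rough n) by apply: measurable_lt; exact: (roughness_measurable Bfbm).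
have PA : (P (bad n `|` rough n) @[n --> \oo] --> 0)%E.
  apply: probability_cvg0 => [n|eps eps0]; first exact: measurableU.
  have eps2 : 0 < eps / 2 by rewrite divr_gt0.
  have Pbad : (P (bad n) @[n --> \oo] --> 0)%E.
    exact: (cvg_comp _ _ (@harmonic_at_right R) (Xint _ eta4)).
  near=> n; apply: le_trans (measureU2 _ (mbad n) (mrough n)) _.
  have h1 : (P (bad n) <= (eps / 2)%:E)%E by near: n; exact: probability_near.
  have h2 : (P (rough n) <= (eps / 2)%:E)%E.
    by near: n; apply: probability_near => //; exact: rough_event_small.
  by apply: le_trans (leeD h1 h2) _; rewrite -EFinD lee_fin; lra.
have [w [/= /eqP B0 PhiB] io] :=
  exists_infinitely_often (fun n => measurableU _ _ (mbad n) (mrough n)) mN PA PN.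
have [M bM] := path_bounded Bfbm w.
have [C [dl [C0 dl0 dlP]]] := symmetric_path (@path_continuous _ _ _ _ _ _ Bfbm w) bM sg2c Gd sgd sgd1 eta4.
have Ceta : 0 < eta / 4 / (C + 1) by rewrite divr_gt0// ltr_wpDl.
have [dl' dl'0 dl'P] := powR_small rough_exponent_gt0 Ceta.
have [m _ mP] : \forall n \near \oo, e_ n <= Num.min dl dl'.
  by apply: harmonic_small; rewrite lt_min dl0.
have [n mn] := io m; rewrite not_orP => -[nbad /negP nrough].
have := mP n mn; rewrite le_min => /andP[ndl ndl'].
have := dl'P (e_ n); rewrite e0 ndl' => /(_ isT) eg.
have := dlP (e_ n); rewrite e0 ndl => /(_ isT).
move: nrough; rewrite -leNgt /roughness => nrough.
have : `|symmetric_approx (fun t w => sigma (X t w)) (fun t => B t) (e_ n) 1 w - (X 1 w - x0)| <= eta / 4.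
  by rewrite leNgt; apply/negP => h; apply: nbad; exists 1.
rewrite (@symmetric_approxE _ sg)//; last by move=> t t01; rewrite XE.
rewrite (path_id B w i01) (path_id B w i00) B0 XE//.
move=> h1 h2.
have h3 : C * (e_ n `^ rough_exponent) <= eta / 4.
  apply: (@le_trans _ _ (C * (eta / 4 / (C + 1)))); first by rewrite ler_wpM2l.
  rewrite mulrA ler_pdivrMr ?ltr_wpDl// [leLHS]mulrC.
  by rewrite ler_pM2l// lerDl.
have h4 := le_trans h2 (lerD (lexx _) (le_trans (ler_wpM2l C0 nrough) h3)).
move: PhiB; rewrite ltNge => /negP; apply.
move: h1 h4; rewrite /Phi; move: (_ * Rintegral _ _ _) => a h1 h4.
have -> : f (B 1 w) - x0 - (G (B 1 w) - G 0) =
  (a - (G (B 1 w) - G 0)) - (a - (f (B 1 w) - x0)) by ring.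
by apply: le_trans (ler_normB _ _) _; lra.
Unshelve. all: end_near. Qed.

End Identification.

(** * Mean of the error bound *)

Lemma natpow_small {R : realType} (a eps : R) : 0 < a -> 0 < eps ->
  \forall n \near \oo, n%:R `^ (- a) <= eps.
Proof.
move=> a0 e0; near=> n.
have n0 : 0 < n%:R :> R by rewrite ltr0n; near: n; exact: nbhs_infty_gt.
rewrite powRN invf_ple ?posrE ?powR_gt0//.
have -> : eps^-1 = (eps^-1 `^ a^-1) `^ a.
  by rewrite -powRrM mulVf ?gt_eqF// powRr1// invr_ge0 ltW.
apply: ge0_ler_powR; rewrite ?nnegrE ?powR_ge0//; first exact: ltW.
by near: n; exact: nbhs_infty_ger.
Unshelve. all: end_near. Qed.

Section Remainder.
Context d (T : measurableType d) {R : realType} (P : probability T R) (H : R)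
  (B : R -> {RV P >-> R}).
Hypothesis H13 : 3^-1 < H.
Hypothesis H12 : H < 2^-1.
Hypothesis Bfbm : fractional_brownian_motion H B.
Local Notation E := (Ex P).
Local Notation am := (all_moments P).
Local Notation u := (increment B).
Local Notation S := (cubic_sum B).
Let H0 := hurst_gt0 H13.

(** The standard deviation of an increment of the grid. *)
Definition mesh_dev (n : nat) : R := n%:R `^ (- H).
Local Notation l := mesh_dev.

Lemma mesh_dev_gt0 n : (0 < n)%N -> 0 < l n.
Proof. by move=> n0; apply: powR_gt0; rewrite ltr0n. Qed.

Lemma step_varianceE n : step_variance H n = l n ^+ 2.
Proof. by rewrite -powR_mulrn ?powR_ge0// -powRrM /step_variance; congr (_ `^ _); ring. Qed.

Lemma even_norm (x : R) p : `|x| ^+ p.*2 = x ^+ p.*2.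
Proof. by rewrite -normrX ger0_norm// -muln2 exprM sqr_ge0. Qed.

Lemma grid_incr_odd_moment p : exists2 C : R, 0 <= C & forall n k, (0 < n)%N -> (k < n)%N ->
  E (fun w => `|u n k w| ^+ p.*2.+1) <= C * l n ^+ p.*2.+1.
Proof.
have [C C0 CE] := grid_incr_moment H0 H12 Bfbm p.
have [D D0 DE] := grid_incr_moment H0 H12 Bfbm p.+1.
exists (2^-1 * (C + D)) => [|n k n0 kn]; first by apply: mulr_ge0 => //; exact: addr_ge0.
have l0 := mesh_dev_gt0 n0.
have au := am_grid_incr Bfbm n0 kn.
have a1 : am (fun w => l n * u n k w ^+ p.*2) by apply: all_momentsZ; exact: all_momentsX.
have a2 : am (fun w => (l n)^-1 * u n k w ^+ p.+1.*2) by apply: all_momentsZ; exact: all_momentsX.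
apply: (@le_trans _ _ (E (fun w => 2^-1 * (l n * u n k w ^+ p.*2 + (l n)^-1 * u n k w ^+ p.+1.*2)))).
  apply: Ex_le => [||w].
  - by apply: all_momentsX; exact: all_moments_norm.
  - by apply: all_momentsZ; exact: all_momentsD.
  have := young_half (`|u n k w| ^+ p) (`|u n k w| ^+ p.+1) l0.
  by rewrite -exprD addnS addnn -!exprM !muln2 !even_norm.
rewrite ExZ; last exact: all_momentsD.
rewrite ExD// ExZ; last exact: all_momentsX.
rewrite ExZ; last exact: all_momentsX.
rewrite CE// DE// step_varianceE -!exprM !mul2n -mulrA ler_pM2l ?invr_gt0//.
rewrite le_eqVlt; apply/orP; left; apply/eqP.
by rewrite doubleS !exprS; move: (l n ^+ _) => a; field; rewrite gt_eqF.
Qed.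

Lemma n_dev3 n : (0 < n)%N -> n%:R * l n ^+ 3 = n%:R `^ (1 - 3 * H).
Proof.
move=> n0; rewrite -{1}(powRr1 (ler0n R n)) -powR_mulrn ?powR_ge0// -powRrM natpowM//.
by congr (_ `^ _); ring.
Qed.

Lemma n_dev3_le1 n : (0 < n)%N -> n%:R * l n ^+ 3 <= 1.
Proof.
move=> n0; rewrite n_dev3// -[leRHS](powRr0 (n%:R : R)); apply: natpow_le => //.
by move: H13; lra.
Qed.

Definition cubic_variation n (w : T) := \sum_(j < n) `|u n j w| ^+ 3.

Lemma am_norm_grid_incr n k p : (0 < n)%N -> (k < n)%N -> am (fun w => `|u n k w| ^+ p).
Proof. by move=> n0 kn; exact: all_momentsX p (all_moments_norm (am_grid_incr Bfbm n0 kn)). Qed.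

Lemma am_cubic_variation n : (0 < n)%N -> am (cubic_variation n).
Proof. by move=> n0; apply: all_moments_sum => j _; exact: am_norm_grid_incr. Qed.

Lemma cubic_variation_mean : exists2 C : R, 0 <= C & forall n, (0 < n)%N ->
  E (cubic_variation n) <= C * n%:R `^ (1 - 3 * H).
Proof.
have [C C0 HC] := grid_incr_odd_moment 1.
exists C => // n n0; rewrite Ex_sum; last by move=> j _; exact: am_norm_grid_incr.
apply: (@le_trans _ _ (\sum_(j < n) C * l n ^+ 3)); first by apply: ler_sum => j _; exact: HC.
by rewrite sumr_const card_ord -[leLHS]mulr_natl mulrCA n_dev3.
Qed.

(** The right-hand side of [scheme_error] along the paths of [B]. *)
Definition remainder g n (w : T) := `|S g n n w| + \sum_(j < n) `|u n j w| ^+ 5 +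
  \sum_(j < n) (`|S g n j w| + `|S g n j.+1 w|) * `|u n j w| ^+ 3.

Lemma am_remainder g n : smooth_bounded g -> (0 < n)%N -> am (remainder g n).
Proof.
move=> gs n0.
have aS k : (k <= n)%N -> am (fun w => `|S g n k w|).
  by move=> kn; apply: all_moments_norm; exact: (am_cubic_sum Bfbm).
apply: all_momentsD; first apply: all_momentsD; first exact: aS.
  by apply: all_moments_sum => j _; exact: am_norm_grid_incr.
apply: all_moments_sum => j _; apply: all_momentsM; last exact: am_norm_grid_incr.
by apply: all_momentsD; apply: aS => //; exact: ltnW.
Qed.

(** The three parts have means of order s, n^(1-5H) and n^(1-3H) s, where s is the
    bound on the standard deviation of the cubic sums; s dominates, because
    H > 1/3. *)
Lemma remainder_mean g (dl : R) : smooth_bounded g -> 0 < dl <= 1 ->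
  exists2 C : R, 0 <= C & forall n, (0 < n)%N ->
  E (remainder g n) <= C * n%:R `^ (- (3 * H - 2^-1 - dl / 2)).
Proof.
move=> gs dl01; have [C C0 HC] := cubic_sum_le H13 H12 Bfbm gs dl01.
have [D D0 DE] := grid_incr_odd_moment 2.
have [F F0 FE] := grid_incr_moment H0 H12 Bfbm 3.
exists (2^-1 * (C + 1) + D + (C + F)) => [|n n0].
  by rewrite !addr_ge0// mulr_ge0// addr_ge0.
have l0 := mesh_dev_gt0 n0.
set s := n%:R `^ (- (3 * H - 2^-1 - dl / 2)).
have s0 : 0 < s by apply: powR_gt0; rewrite ltr0n.
have s2 : n%:R `^ dl * (n%:R * step_variance H n ^+ 3) = s ^+ 2.
  rewrite step_varianceX// -{2}(powRr1 (ler0n R n)) !natpowM// /s -powR_mulrn ?powR_ge0//.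
  by rewrite -powRrM; congr (_ `^ _); field.
have {HC} SC k : (k <= n)%N -> E (fun w => S g n k w ^+ 2) <= C * s ^+ 2.
  by move=> kn; rewrite -s2; exact: HC.
have aSk k : (k <= n)%N -> am (S g n k) by move=> kn; exact: (am_cubic_sum Bfbm).
have aS k : (k <= n)%N -> am (fun w => `|S g n k w|).
  by move=> kn; apply: all_moments_norm; exact: aSk.
have h1 : E (fun w => `|S g n n w|) <= 2^-1 * (C + 1) * s.
  have a2 : am (fun w => s^-1 * S g n n w ^+ 2) by apply: all_momentsZ; apply: all_momentsX; exact: aSk.
  apply: (@le_trans _ _ (E (fun w => 2^-1 * (s + s^-1 * S g n n w ^+ 2)))).
    apply: Ex_le => [||w]; first exact: aS.
      by apply: all_momentsZ; apply: all_momentsD => //; exact: (all_moments_cst _ s).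
    have := young_half 1 `|S g n n w| s0.
    by rewrite mul1r expr1n mulr1 real_normK ?num_real.
  rewrite ExZ; last by apply: all_momentsD => //; exact: (all_moments_cst _ s).
  rewrite ExD//; last exact: (all_moments_cst _ s).
  rewrite Ex_cst ExZ; last by apply: all_momentsX; exact: aSk.
  rewrite -mulrA ler_pM2l ?invr_gt0// mulrDl mul1r addrC lerD2r.
  by rewrite ler_pdivrMl// mulrCA -expr2 SC.
have h2 : E (fun w => \sum_(j < n) `|u n j w| ^+ 5) <= D * s.
  rewrite Ex_sum; last by move=> j _; exact: am_norm_grid_incr.
  apply: (@le_trans _ _ (\sum_(j < n) D * l n ^+ 5)); first by apply: ler_sum => j _; exact: DE.
  rewrite sumr_const card_ord -[leLHS]mulr_natl mulrCA ler_wpM2l//.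
  rewrite -{1}(powRr1 (ler0n R n)) -powR_mulrn ?powR_ge0// -powRrM natpowM//.
  by apply: natpow_le => //; move: H13; case/andP: dl01 => ? ?; lra.
have h3 k j : (k <= n)%N -> (j < n)%N ->
    E (fun w => `|S g n k w| * `|u n j w| ^+ 3) <= 2^-1 * (C + F) * (s * l n ^+ 3).
  move=> kn jn; set la := l n ^+ 3 / s.
  have l30 : 0 < l n ^+ 3 by rewrite exprn_gt0.
  have la0 : 0 < la by rewrite divr_gt0.
  have a1 : am (fun w => la * S g n k w ^+ 2) by apply: all_momentsZ; apply: all_momentsX; exact: aSk.
  have au6 : am (fun w => u n j w ^+ 6) := all_momentsX 6 (am_grid_incr Bfbm n0 jn).
  have a2 : am (fun w => la^-1 * u n j w ^+ 6) by apply: all_momentsZ.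
  apply: (@le_trans _ _ (E (fun w => 2^-1 * (la * S g n k w ^+ 2 + la^-1 * u n j w ^+ 6)))).
    apply: Ex_le => [||w].
    - by apply: all_momentsM; [exact: aS|exact: am_norm_grid_incr].
    - by apply: all_momentsZ; exact: all_momentsD.
    have := young_half `|S g n k w| (`|u n j w| ^+ 3) la0.
    by rewrite real_normK ?num_real// -exprM (even_norm _ 3).
  rewrite ExZ; last exact: all_momentsD.
  rewrite ExD// ExZ; last by apply: all_momentsX; exact: aSk.
  rewrite ExZ// (FE n j n0 jn) step_varianceE -exprM -mulrA ler_pM2l ?invr_gt0//.
  rewrite mulrDl; apply: lerD.
    apply: (@le_trans _ _ (la * (C * s ^+ 2))); first by rewrite ler_pM2l// SC.
    by rewrite /la le_eqVlt; apply/orP; left; apply/eqP; field; rewrite gt_eqF.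
  by rewrite /la le_eqVlt; apply/orP; left; apply/eqP; field; rewrite !gt_eqF.
have h4 : E (fun w => \sum_(j < n) (`|S g n j w| + `|S g n j.+1 w|) * `|u n j w| ^+ 3) <=
    (C + F) * s.
  rewrite Ex_sum; last first.
    move=> j _; apply: all_momentsM; last exact: am_norm_grid_incr.
    by apply: all_momentsD; apply: aS => //; exact: ltnW.
  apply: (@le_trans _ _ (\sum_(j < n) (C + F) * (s * l n ^+ 3))).
    apply: ler_sum => j _.
    rewrite (_ : (fun w => _) = fun w => `|S g n j w| * `|u n j w| ^+ 3 +
      `|S g n j.+1 w| * `|u n j w| ^+ 3); last by apply/funext => w; rewrite mulrDl.
    rewrite ExD; [|by apply: all_momentsM; [by apply: aS => //; exact: ltnW|exact: am_norm_grid_incr]..].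
    have := h3 j.+1 j (ltn_ord j) (ltn_ord j); have := h3 j j (ltnW (ltn_ord j)) (ltn_ord j).
    move: (E _) (E _) (_ * l n ^+ 3) => a b c; lra.
  rewrite sumr_const card_ord -[leLHS]mulr_natl mulrCA ler_wpM2l ?addr_ge0//.
  rewrite mulrCA ler_piMr ?(ltW s0)//; exact: n_dev3_le1.
have a5 : am (fun w => \sum_(j < n) `|u n j w| ^+ 5).
  by apply: all_moments_sum => j _; exact: am_norm_grid_incr.
rewrite /remainder ExD; last 2 first.
- by apply: all_momentsD => //; exact: aS.
- apply: all_moments_sum => j _; apply: all_momentsM; last exact: am_norm_grid_incr.
  by apply: all_momentsD; apply: aS => //; exact: ltnW.
rewrite ExD//; last exact: aS.
by rewrite !mulrDl; move: h1 h2 h4; rewrite !mulrDl; lra.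
Qed.

End Remainder.

(** * Convergence *)

Theorem theorem5 (d : measure_display) (T : measurableType d) (R : realType)
  (P : probability T R) (H : R) (B : R -> {RV P >-> R})
  (x0 : R) (sigma : R -> R) (X : R -> T -> R)
  (Xhat : nat -> R -> {RV P >-> R}) (alpha : R)
  (H_range : 3^-1 < H < 2^-1)
  (B_fbm : fractional_brownian_motion H B)
  (sigma_smooth : class_Cinf_b sigma)
  (sigma_bounded : exists M : R, forall x : R, `|sigma x| <= M)
  (X_solution : sde_solution B sigma x0 X)
  (Xhat_scheme : crank_nicholson B sigma x0 Xhat)
  (alpha_lt : alpha < 3 * H - 2^-1) :
  forall eta : R, 0 < eta ->
    P [set w | eta < `|n%:R `^ alpha * (Xhat n 1 w - X 1 w)|]
      @[n --> \oo] --> 0%E.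
Proof.
move=> eta eta0; case/andP: H_range => H13 H12.
have i01 : (1 : R) \in `[0, 1] by rewrite in_itv/= ler01 lexx.
have sm := class_Cinf_b_smooth sigma_smooth sigma_bounded.
have [[f fC5 XE] Xint] := X_solution.
have [fd f0] := solution_flow H13 H12 B_fbm sm fC5 XE Xint.
have [g [gs [rho [C [rho0 C0 HS]]]]] := scheme_error sm fd.
have [_ sm1] := smooth_bounded_derive sm.
have [K K0 HK] := smooth_bounded_bound sm1.
have K1 : 0 < K + 1 by rewrite ltr_wpDl.
(* With a cubic variation at most [r], [scheme_error] applies and every
   increment is at most 1 / (K + 1), so that every step is solvable. *)
pose r := Num.min rho ((K + 1)^-1 ^+ 3).
have r0 : 0 < r by rewrite lt_min rho0 exprn_gt0// invr_gt0.
(* Half of [dl] is lost in [remainder_mean]. *)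
pose dl := Num.min 1 (3 * H - 2^-1 - alpha).
have dl01 : 0 < dl <= 1 by rewrite lt_min ltr01 subr_gt0 alpha_lt ge_min lexx.
have dlg : dl <= 3 * H - 2^-1 - alpha by rewrite ge_min lexx orbT.
have [D D0 HD] := remainder_mean H13 H12 B_fbm gs dl01.
have [V V0 HV] := cubic_variation_mean H13 H12 B_fbm.
have C1 : 0 < C + 1 by rewrite ltr_wpDl.
pose thr n := eta / (C + 1) * n%:R `^ (- alpha).
have path_bound n w : (0 < n)%N -> B 0 w = 0 -> cubic_variation B n w <= r ->
    remainder B g n w <= thr n -> `|n%:R `^ alpha * (Xhat n 1 w - X 1 w)| <= eta.
  move=> n0 B0 Vr Qt.
  have n0R : 0 < n%:R :> R by rewrite ltr0n.
  have bij k : (k < n)%N -> bijective (fun x : R => x - 2^-1 * increment B n k w * sigma x).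
    move=> kn; apply: (implicit_map_bijective sm HK).
    have : `|increment B n k w| ^+ 3 <= (K + 1)^-1 ^+ 3.
      apply: (@le_trans _ _ r); last by rewrite ge_min lexx orbT.
      apply: le_trans Vr; rewrite /cubic_variation (bigD1 (Ordinal kn))//= lerDl.
      by apply: sumr_ge0 => j _; rewrite exprn_ge0.
    rewrite ler_pXn2r ?nnegrE ?invr_ge0 ?(ltW K1)// => uK.
    apply: le_trans (ler_wpM2l K0 uK) _.
    by rewrite ler_pdivrMr// mul1r lerDl.
  have [Xh0 XhS] := Xhat_scheme n w n0 bij.
  have := HS n (fun k => increment B n k w) (fun k => grid_value B n k w)
    (fun k => Xhat n (k%:R / n%:R) w).
  rewrite /grid_value mul0r B0 Xh0 f0 divff ?gt_eqF// => /(_ erefl erefl).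
  have bS k : B (k.+1%:R / n%:R) w = B (k%:R / n%:R) w + increment B n k w.
    by rewrite /increment addrC subrK.
  move=> /(_ bS XhS); have Vrho : \sum_(j < n) `|increment B n j w| ^+ 3 <= rho.
    by apply: le_trans Vr _; rewrite ge_min lexx.
  move=> /(_ Vrho) h; rewrite XE// normrM ger0_norm ?powR_ge0//.
  have {}h : `|Xhat n 1 w - f (B 1 w)| <= C * remainder B g n w by exact: h.
  apply: (@le_trans _ _ (n%:R `^ alpha * (C * thr n))).
    by rewrite ler_wpM2l ?powR_ge0//; apply: le_trans h _; rewrite ler_wpM2l.
  have p0 : 0 < n%:R `^ alpha by exact: powR_gt0.
  have -> : n%:R `^ alpha * (C * thr n) = eta * (C / (C + 1)).
    by rewrite /thr powRN; field; rewrite !gt_eqF.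
  by rewrite ler_piMr ?(ltW eta0)// ler_pdivrMr// mul1r lerDl.
have fc : continuous f := is_derive1_continuous fd.
have mE n : measurable [set w | eta < `|n%:R `^ alpha * (Xhat n 1 w - X 1 w)| ].
  apply: measurable_lt; apply: measurableT_comp => //; apply: measurable_funM => //.
  rewrite (_ : (fun w => _) = fun w => Xhat n 1 w - f (B 1 w)); last first.
    by apply/funext => w; rewrite XE.
  by apply: measurable_funB => //; apply: measurableT_comp => //; exact: continuous_measurable_fun.
apply: probability_cvg0 => // eps eps0.
have V1 : 0 < V + 1 by rewrite ltr_wpDl.
have D1 : 0 < D + 1 by rewrite ltr_wpDl.
have e1 : 0 < eps / 2 * r / (V + 1) by rewrite !divr_gt0// mulr_gt0// divr_gt0.
have e2 : 0 < eps / 2 * (eta / (C + 1)) / (D + 1) by rewrite !divr_gt0// mulr_gt0// divr_gt0.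
have a1 : 0 < 3 * H - 1 by move: H13; lra.
have a2 : 0 < 3 * H - 2^-1 - alpha - dl / 2 by case/andP: dl01; lra.
near=> n.
have n0 : (0 < n)%N by near: n; exact: nbhs_infty_gt.
have s1 : n%:R `^ (- (3 * H - 1)) <= eps / 2 * r / (V + 1) by near: n; exact: natpow_small.
have s2 : n%:R `^ (- (3 * H - 2^-1 - alpha - dl / 2)) <= eps / 2 * (eta / (C + 1)) / (D + 1).
  by near: n; exact: natpow_small.
have thr0 : 0 < thr n by rewrite mulr_gt0 ?divr_gt0// powR_gt0// ltr0n.
have aV := am_cubic_variation B_fbm n0.
have aQ := am_remainder B_fbm gs n0.
have mV := measurable_lt r (all_moments_measurable aV).
have mQ := measurable_lt (thr n) (all_moments_measurable aQ).
have mB0 : measurable [set w | B 0 w != 0].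
  rewrite (_ : [set w | _] = [set w | 0 < `|B 0 w| ]).
    by apply: measurable_lt; exact: measurableT_comp.
  by apply/seteqP; split => w /=; rewrite normr_gt0.
apply: (@le_trans _ _ (P ([set w | B 0 w != 0] `|` ([set w | r < cubic_variation B n w] `|`
   [set w | thr n < remainder B g n w])))).
  apply: le_measure; rewrite ?inE//.
    by apply: measurableU => //; exact: measurableU.
  move=> w /=; case: (eqVneq (B 0 w) 0) => [B0|]; last by left.
  have [rV|Vr] := ltP r (cubic_variation B n w); first by right; left.
  have [tQ|Qt] := ltP (thr n) (remainder B g n w); first by right; right.
  by rewrite ltNge (path_bound n w).
apply: le_trans (measureU2 _ mB0 (measurableU _ _ mV mQ)) _.
apply: (@le_trans _ _ (0 + ((eps / 2)%:E + (eps / 2)%:E))%E); last first.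
  by rewrite add0e -EFinD lee_fin; lra.
apply: leeD; first by rewrite le_eqVlt; apply/orP; left; apply/eqP; exact: (fbm_start H13 B_fbm).
apply: le_trans (measureU2 _ mV mQ) _; apply: leeD.
  apply: le_trans (markov_le aV _ r0) _.
    by move=> w; apply: sumr_ge0 => j _; rewrite exprn_ge0.
  rewrite lee_fin ler_pdivrMr//; apply: le_trans (HV n n0) _.
  rewrite -opprB; apply: le_trans (ler_wpM2l V0 s1) _.
  rewrite mulrA ler_pdivrMr// [leLHS]mulrC ler_pM2l ?lerDl//.
  by rewrite mulr_gt0// divr_gt0.
apply: le_trans (markov_le aQ _ thr0) _.
  move=> w; apply: addr_ge0; first apply: addr_ge0 => //.
    by apply: sumr_ge0 => j _; rewrite exprn_ge0.
  by apply: sumr_ge0 => j _; rewrite mulr_ge0 ?exprn_ge0// addr_ge0.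
rewrite lee_fin ler_pdivrMr//; apply: le_trans (HD n n0) _.
have -> : - (3 * H - 2^-1 - dl / 2) = - (3 * H - 2^-1 - alpha - dl / 2) + - alpha by ring.
rewrite -natpowM// /thr mulrA [leRHS]mulrA; apply: ler_wpM2r; first exact: powR_ge0.
apply: le_trans (ler_wpM2l D0 s2) _.
rewrite [leLHS]mulrA ler_pdivrMr// [leLHS]mulrC ler_pM2l ?lerDl//.
by rewrite mulr_gt0// divr_gt0.
Unshelve. all: end_near. Qed.
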